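(* The construction of the basic gerbe over $SU(n)$ given by the data $(\mathcal V,L,t)$, with $L_{ij}=\theta_{ij}^*(L_{\mu_j-\mu_i})\to V_{ij}$ and canonical trivial sections $t_{ijk}=1$ of $\delta L$ over $V_{ijk}$, is equivalent to the Gawedzki–Reis construction of the basic gerbe over $SU(n)$, given on the same cover $\mathcal V=\{V_1,\dots,V_n\}$ by the line bundles $E_{ij}\to V_{ij}$ ($i<j$) extending $E_{i+1}\otimes\cdots\otimes E_j\to SU(n)^{reg}$, together with the canonical isomorphisms $E_{ij}\otimes E_{jk}\cong E_{ik}$ over $V_{ijk}$ ($i<j<k$). In particular, for $i<j$, $L_{ij}=\theta_{ij}^*(L_{\mu_j-\mu_i})=\theta_{ij}^*(L_{\sum_{k=i+1}^j\nu_k})=E_{ij}$, where $\nu_k=e_k-\frac1n(1,\dots,1)$.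
   Context: **Gerbes.** A gerbe on a manifold, on an open cover $\{U_i\}$, consists of Hermitian line bundles $L_{ii'}$ on the double overlaps with $L_{ii'}\cong L_{i'i}^{-1}$, and a unitary section $\theta_{ii'i''}$ of $(\delta L)_{ii'i''}=L_{i'i''}\otimes L_{ii''}^{-1}\otimes L_{ii'}$ on triple overlaps with $\delta\theta=1$ on quadruple overlaps. The basic gerbe over a compact, simple, simply connected Lie group $G$ is the one corresponding to the generator of $H^3(G,\mathbb Z)\cong\mathbb Z$. **Alcove and cover.** Let $G=SU(n)$, with maximal torus $T$ the diagonal matrices, $\mathfrak t\cong\{\lambda\in\mathbb R^n:\sum_i\lambda_i=0\}$, $\exp(\lambda)=\mathrm{diag}(e^{2\pi\sqrt{-1}\lambda_1},\dots,e^{2\pi\sqrt{-1}\lambda_n})$, and $\mathfrak t\cong\mathfrak t^*$ via the basic inner product, induced from the standard inner product of $\mathbb R^n$ (standard basis $e_1,\dots,e_n$). Let $\Lambda^*$ be the weight lattice. The fundamental alcove is $\mathfrak A=\{\lambda\in\mathfrak t:\lambda_1\ge\cdots\ge\lambda_n\ge\lambda_1-1\}$. Every $A\in SU(n)$ is conjugate to $\exp(\lambda(A))$ for a unique $\lambda(A)\in\mathfrak A$; put $q:SU(n)\to\mathfrak A$, $q(A)=\lambda(A)$. For $1\le i\le n$ let $\mu_i$ be the vertex of $\mathfrak A$ with $\lambda_1=\cdots=\lambda_i>\lambda_{i+1}=\cdots=\lambda_n=\lambda_1-1$, that is, $\mu_i=\sum_{k=1}^ie_k-\frac in\sum_{k=1}^ne_k$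 (so $\mu_n=0$ and $\mu_i=\sum_{k=1}^i\nu_k$). Let $\mathfrak A_i=\{\lambda\in\mathfrak A:\lambda_i>\lambda_{i+1}\}$, with $\lambda_{n+1}:=\lambda_1-1$ (the complement in $\mathfrak A$ of the closed face opposite $\mu_i$). The standard open cover is $\mathcal V=\{V_i\}_{i=1}^n$, $V_i=q^{-1}(\mathfrak A_i)$; write $V_{ij}=V_i\cap V_j$, $V_{ijk}=V_i\cap V_j\cap V_k$. **The data $(\mathcal V,L,t)$.** Let $\theta_j:V_j\to\mathfrak g$ be the $G$-equivariant map with $\theta_j(\exp\xi)=\xi-\mu_j$ for $\xi\in\mathfrak A_j$, and $\theta_{ij}=\theta_i-\theta_j$ on $V_{ij}$; it takes values in the adjoint orbit through $\mu_j-\mu_i$. For $\mu\in\Lambda^*$ with stabilizer $G_\mu$, let $L_\mu=G\times_{G_\mu}\mathbb C_\mu\to G/G_\mu=G\cdot\mu$, where $\mathbb C_\mu$ is the 1-dimensional $G_\mu$-representation with infinitesimal character $\mu$; $L_\mu$ carries its unique left-invariant connection. Define $L_{ij}=\theta_{ij}^*(L_{\mu_j-\mu_i})$ with the pull-back connection. On $V_{ijk}$, $(\delta L)_{ijk}=L_{jk}L_{ik}^{-1}L_{ij}$ is the pull-back of the line bundle over $G/G_{ijk}$ defined by the zero weight $(\mu_k-\mu_j)-(\mu_k-\mu_i)+(\mu_j-\mu_i)=0$ of $G_{ijk}$ (the intersection of the centralizers of $\exp\mu_i,\exp\mu_j,\exp\mu_k$), hence is canonically trivial with trivial connection; $t_{ijk}=1$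 is the trivial section, and $\delta t=1$. **The Gawedzki–Reis data.** $SU(n)^{reg}$ is the set of matrices in $SU(n)$ all of whose eigenvalues have multiplicity one. Over it there are $n$ equivariant line bundles $E_1,\dots,E_n$, where $E_i$ is the eigenline bundle for the eigenvalue $e^{2\pi\sqrt{-1}\lambda_i(A)}$; $E_i=G\times_T\mathbb C_{\nu_i}$. For $i<j$ the tensor product $E_{i+1}\otimes\cdots\otimes E_j$ extends to a line bundle $E_{ij}\to V_{ij}$, and for $i<j<k$ there is a canonical isomorphism $E_{ij}\otimes E_{jk}\cong E_{ik}$ over $V_{ijk}$. These line bundles and isomorphisms define a gerbe over $SU(n)$ in the sense of Gawedzki–Reis, representing the generator of $H^3(SU(n),\mathbb Z)$. *)

(* Defs.v *)
From HB Require Import structures.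
From mathcomp Require Import all_boot all_order all_algebra.
From mathcomp Require Import all_classical all_reals all_analysis.
From mathcomp Require Import complex.
Set Implicit Arguments.
Unset Strict Implicit.
Unset Printing Implicit Defensive.
Import Order.TTheory GRing.Theory Num.Theory.
Import numFieldNormedType.Exports.
Local Open Scope classical_set_scope.
Local Open Scope ring_scope.
Local Open Scope sesquilinear_scope.

(** * Smooth functions

    Every manifold below ([SU(n)], its open subsets, adjoint orbits) is an
    embedded submanifold of the real vector space of complex [n x n] matrices.
    A function on such a subset is smooth when it extends locally to a
    C^infinity function of the real and imaginary parts of the entries. *)

Fixpoint Ck (R : realType) (V : normedModType R) (k : nat) (U : set V)
    (f : V -> R^o) : Prop :=
  match k with
  | 0 => forall x, U x -> {for x, continuous f}
  | k'.+1 => (forall x, U x -> differentiable f x) /\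
             (forall v, Ck k' U ('D_v f))
  end.

Definition Cinfty (R : realType) (V : normedModType R) (U : set V)
    (f : V -> R^o) : Prop := forall k, Ck k U f.

Section Matrices.
Variables (R : realType) (n : nat).
Local Notation C := (R[i]).
Local Notation Mat := ('M[C]_n).

Definition cabs (z : C) : R := ComplexField.Normc.normc z.

Definition reim (A : Mat) : 'M[R]_n * 'M[R]_n :=
  (map_mx (@complex.Re R) A, map_mx (@complex.Im R) A).

Definition open_in (S W : set Mat) : Prop :=
  exists2 O : set ('M[R]_n * 'M[R]_n), open O & W = S `&` (reim @^-1` O).

Definition smooth_on (S : set Mat) (f : Mat -> C) : Prop :=
  forall A, S A -> exists (O : set ('M[R]_n * 'M[R]_n))
    (a b : 'M[R]_n * 'M[R]_n -> R^o),
    [/\ open O, O (reim A), Cinfty O a, Cinfty O b &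
        forall B, S B -> O (reim B) -> f B = (a (reim B) +i* b (reim B))%C].

End Matrices.

(** * Linear maps between modules, as a module *)

Section LinearMaps.
Variables (K : comNzRingType) (U V : lmodType K).

Definition linear_pred : {pred (U -> V)} := fun f => `[< linear f >].

Fact linear_pred_closed : submod_closed linear_pred.
Proof.
split=> [|a f g /asboolP lf /asboolP lg]; apply/asboolP => c u v.
  by rewrite /= scaler0 addr0.
rewrite !addrfctE !scalrfctE lf lg !scalerDr !scalerA mulrC.
by rewrite -!addrA; congr (_ + _); rewrite addrCA.
Qed.

HB.instance Definition _ :=
  GRing.isSubmodClosed.Build K (U -> V) linear_pred linear_pred_closed.

Record linmap := Linmap {
  linmap_fun :> U -> V;
  linmap_lin : linmap_fun \in linear_pred }.

HB.instance Definition _ := [isSub for linmap_fun].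
HB.instance Definition _ := [Choice of linmap by <:].
HB.instance Definition _ := [SubChoice_isSubLmodule of linmap by <:].

End LinearMaps.

(** * Hermitian lines

    On a complex line a Hermitian metric is the same thing as a norm. *)

Section Lines.
Variable R : realType.
Local Notation C := (R[i]).

Record hline := HLine { hsort :> lmodType C; hnorm : hsort -> R }.

Definition is_hline (L : hline) : Prop :=
  [/\ exists2 u : L, u != 0 & forall v : L, exists c, v = c *: u,
      forall (c : C) (u : L), hnorm (c *: u) = cabs c * hnorm u &
      forall u : L, u != 0 -> 0 < hnorm u].

(* linear maps with the operator norm *)
Definition hom_line (L L' : hline) : hline :=
  @HLine (linmap L L')
    (fun f => sup [set hnorm (f u) | u in [set u : L | hnorm u = 1]]).

Definition unit_line : hline := @HLine (C^o) (@cabs R).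

Definition dual_line (L : hline) : hline := hom_line L unit_line.

(* For finite-dimensional spaces, L (x) L' = Hom (L^* , L'). *)
Definition tens_line (L L' : hline) : hline := hom_line (dual_line L) L'.

Fact ptens_subproof (L L' : hline) (u : L) (u' : L') :
  (fun f : dual_line L => (f u : C) *: u') \in @linear_pred C (dual_line L) L'.
Proof.
by apply/asboolP => a f g /=; rewrite scalerA -scalerDl.
Qed.

Definition ptens (L L' : hline) (u : L) (u' : L') : tens_line L L' :=
  Linmap (ptens_subproof u u').

(* the element u^-1 of the dual line: the functional with value 1 on u *)
Definition line_inv (L : hline) (u : L) : dual_line L :=
  xget 0 [set f : dual_line L | (f u : C) = 1].

End Lines.

(** * Hermitian line bundles over subsets of the space of matrices

    The smooth structure is given by an atlas of local frames: [lb_frame W e]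
    says that [e] is one of the distinguished nonvanishing sections over [W]
    (the values of [e] outside [W] are irrelevant, as are the fibres outside
    [lb_base]). [is_lbundle] collects the axioms. *)

Section Bundles.
Variables (R : realType) (n : nat).
Local Notation C := (R[i]).
Local Notation Mat := ('M[C]_n).

Record lbundle := LBundle {
  lb_base : set Mat;
  lb_fib :> Mat -> hline R;
  lb_frame : set Mat -> (forall A, lb_fib A) -> Prop }.

Definition is_lbundle (L : lbundle) : Prop :=
  [/\ forall A, lb_base L A -> is_hline (L A),
      forall W e, lb_frame W e -> open_in (lb_base L) W /\
        (forall A, W A -> (e A : L A) != 0),
      forall W e, lb_frame W e ->
        smooth_on W (fun A => (hnorm (e A : L A))%:C%C),
      forall A, lb_base L A ->
        exists W, exists2 e : forall B, L B, lb_frame W e & W A &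
      forall W e W' e', lb_frame W e -> lb_frame W' e' ->
        exists2 f, smooth_on (W `&` W') f &
          forall A, W A -> W' A -> (e' A : L A) = f A *: e A].

Definition smooth_section (X : set Mat) (L : lbundle) (s : forall A, L A) :
    Prop :=
  X `<=` lb_base L /\
  forall W e, lb_frame W e -> exists2 f, smooth_on (X `&` W) f &
    forall A, X A -> W A -> s A = f A *: e A.

Definition unitary_section (X : set Mat) (L : lbundle) (s : forall A, L A) :
    Prop :=
  smooth_section X s /\ forall A, X A -> hnorm (s A) = 1.

Definition bundle_iso (X : set Mat) (L L' : lbundle)
    (phi : forall A, L A -> L' A) : Prop :=
  [/\ X `<=` lb_base L `&` lb_base L',
      forall A, X A -> linear (phi A) /\ bijective (phi A),
      forall A (u : L A), X A -> hnorm (phi A u) = hnorm u &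
      forall W e W' e', lb_frame W e -> lb_frame W' e' ->
        exists2 f, smooth_on (X `&` (W `&` W')) f &
          forall A, X A -> W A -> W' A -> phi A (e A) = f A *: e' A].

Definition pullback (X : set Mat) (theta : Mat -> Mat) (L : lbundle) :
    lbundle :=
  @LBundle X (fun A => L (theta A))
    (fun W' e' => exists W (e : forall B, L B),
       [/\ lb_frame W e, W' = X `&` (theta @^-1` W) &
           e' = (fun A => e (theta A))]).

Definition dual_bundle (L : lbundle) : lbundle :=
  @LBundle (lb_base L) (fun A => dual_line (L A))
    (fun W e' => exists2 e : forall A, L A, lb_frame W e &
       e' = (fun A => line_inv (e A))).

Definition tens_bundle (L L' : lbundle) : lbundle :=
  @LBundle (lb_base L `&` lb_base L') (fun A => tens_line (L A) (L' A))
    (fun W0 e0 => exists W (e : forall A, L A) W' (e' : forall A, L' A),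
       [/\ lb_frame W e, lb_frame W' e', W0 = W `&` W' &
           e0 = (fun A => ptens (e A) (e' A))]).

(* [tens_range E m d] is E_m (x) E_{m+1} (x) ... (x) E_{m+d}. *)
Fixpoint tens_range (E : 'I_n -> lbundle) (m : 'I_n) (d : nat) : lbundle :=
  if d is d'.+1 then tens_bundle (E m) (tens_range E (ordS m) d') else E m.

Fixpoint pure_range (E : 'I_n -> lbundle) (A : Mat) (v : forall m, E m A)
    (m : 'I_n) (d : nat) : tens_range E m d A :=
  match d return tens_range E m d A with
  | 0 => v m
  | d'.+1 => ptens (v m) (pure_range v (ordS m) d')
  end.

(* A subbundle of the trivial bundle with fibre C^I: the metric is induced from
   the standard one, and a frame is smooth when its coordinates are. *)
Definition subbundle (I : finType) (X : set Mat)
    (U : Mat -> {vspace {ffun I -> C^o}}) : lbundle :=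
  @LBundle X
    (fun A => @HLine R (subvs_of (U A))
       (fun u => Num.sqrt (\sum_i cabs (vsval u i) ^+ 2)))
    (fun W e => [/\ open_in X W, forall A, W A -> e A != 0 &
       forall i, smooth_on W (fun A => vsval (e A) i)]).

End Bundles.

(** * Gerbes on an ordered open cover

    As L_ji = L_ij^-1, a gerbe is given by the L_ij with i < j and the sections
    of (delta L)_ijk with i < j < k. *)

Section Gerbes.
Variables (R : realType) (n p : nat).
Local Notation C := (R[i]).
Local Notation Mat := ('M[C]_n).

Definition delta (L : 'I_p -> 'I_p -> lbundle R n) (i j k : 'I_p) :
    lbundle R n :=
  tens_bundle (tens_bundle (L j k) (dual_bundle (L i k))) (L i j).

Definition delta_pure (L : 'I_p -> 'I_p -> lbundle R n) (A : Mat)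
    (x : forall a b, L a b A) (i j k : 'I_p) : delta L i j k A :=
  ptens (ptens (x j k) (line_inv (x i k))) (x i j).

Record gerbe_data := GerbeData {
  gb_bundle : 'I_p -> 'I_p -> lbundle R n;
  gb_section : forall i j k A, delta gb_bundle i j k A }.

(* The last clause is delta t = 1, computed in arbitrary bases x_ab of the
   lines L_ab at A, in which t_ijk = c_ijk x_jk (x) x_ik^-1 (x) x_ij. *)
Definition is_gerbe (M : set Mat) (V : 'I_p -> set Mat) (D : gerbe_data) :
    Prop :=
  [/\ (forall i, open_in M (V i)) /\ M = \bigcup_i V i,
      forall i j : 'I_p, (i < j)%N ->
        is_lbundle (gb_bundle D i j) /\
        lb_base (gb_bundle D i j) = V i `&` V j,
      forall i j k : 'I_p, (i < j)%N -> (j < k)%N ->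
        unitary_section (V i `&` V j `&` V k)
          (@gb_section D i j k) &
      forall i j k l : 'I_p, (i < j)%N -> (j < k)%N -> (k < l)%N ->
        forall A, V i A -> V j A -> V k A -> V l A ->
        forall (x : forall a b, gb_bundle D a b A)
               (c : 'I_p -> 'I_p -> 'I_p -> C),
        (forall a b : 'I_p, a \in [:: i; j; k; l] -> b \in [:: i; j; k; l] ->
           (a < b)%N -> x a b != 0) ->
        (forall a b d : 'I_p, a \in [:: i; j; k; l] ->
           b \in [:: i; j; k; l] -> d \in [:: i; j; k; l] ->
           (a < b)%N -> (b < d)%N ->
           @gb_section D a b d A = c a b d *: delta_pure x a b d) ->
        c j k l * (c i k l)^-1 * c i j l * (c i j k)^-1 = 1].

(* The isomorphism induced by the phi_ij on delta L maps
   x_jk (x) x_ik^-1 (x) x_ij to phi x_jk (x) (phi x_ik)^-1 (x) phi x_ij. *)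
Definition gerbe_equiv (V : 'I_p -> set Mat) (D D' : gerbe_data) : Prop :=
  exists phi : forall i j A, gb_bundle D i j A -> gb_bundle D' i j A,
    (forall i j : 'I_p, (i < j)%N -> bundle_iso (V i `&` V j) (phi i j)) /\
    (forall i j k : 'I_p, (i < j)%N -> (j < k)%N ->
       forall A, V i A -> V j A -> V k A ->
       forall (x : forall a b, gb_bundle D a b A) (c : C),
       x i j != 0 -> x j k != 0 -> x i k != 0 ->
       @gb_section D i j k A = c *: delta_pure x i j k ->
       @gb_section D' i j k A =
         c *: delta_pure (fun a b => phi a b A (x a b)) i j k).

(* The section of (delta L)_ijk corresponding to a family of isomorphisms
   m_ijk : L_ij (x) L_jk -> L_ik. *)
Definition section_of_mul (L : 'I_p -> 'I_p -> lbundle R n)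
    (m : forall i j k A, tens_bundle (L i j) (L j k) A -> L i k A)
    (i j k : 'I_p) (A : Mat) : delta L i j k A :=
  xget 0 [set s | forall (u : L i j A) (v : L j k A), u != 0 -> v != 0 ->
    s = ptens (ptens v (line_inv (m i j k A (ptens u v)))) u].

End Gerbes.

(** * The group, the alcove and the standard cover

    Indices are ordinals, hence 0-based: the ordinal [i] stands for the index
    i+1 of the usual 1-based numbering. In particular the condition i < k <= j
    on ordinals is the same as on 1-based indices. *)

Section SUn.
Variables (R : realType) (n : nat).
Local Notation C := (R[i]).
Local Notation Mat := ('M[C]_n).

Definition SU : set Mat := [set A | A \is unitarymx /\ \det A = 1].

(* exp(2 pi sqrt(-1) t) *)
Definition expi (t : R) : C := (cos (2 * pi * t) +i* sin (2 * pi * t))%C.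

(* elements of the Cartan subalgebra t *)
Definition cartan (v : 'rV[R]_n) : Prop := \sum_k v 0 k = 0.

Definition texp (v : 'rV[R]_n) : Mat := diag_mx (map_mx expi v).

Definition inner (v w : 'rV[R]_n) : R := \sum_k v 0 k * w 0 k.

(* The Lie algebra of SU(n) is realized as the space of traceless Hermitian
   matrices, X standing for 2 pi sqrt(-1) X; then v in t is the diagonal matrix
   [tdiag v], and t is identified with its dual by [inner]. *)
Definition tdiag (v : 'rV[R]_n) : Mat := diag_mx (map_mx (real_complex R) v).

Definition Ad (g X : Mat) : Mat := g *m X *m g^t*.

(* lambda_{i+1}, where lambda_{n+1} = lambda_1 - 1 *)
Definition lam_next (lam : 'rV[R]_n) (i : 'I_n) : R :=
  lam 0 (ordS i) - (i.+1 == n)%:R.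

Definition alcove : set 'rV[R]_n :=
  [set lam | cartan lam /\ forall i, lam_next lam i <= lam 0 i].

Definition alcove_at (i : 'I_n) : set 'rV[R]_n :=
  [set lam | alcove lam /\ lam_next lam i < lam 0 i].

Definition diagonalizes (A g : Mat) (lam : 'rV[R]_n) : Prop :=
  [/\ SU g, alcove lam & A = Ad g (texp lam)].

Definition q (A : Mat) : 'rV[R]_n :=
  xget 0 [set lam | exists g, diagonalizes A g lam].

Definition Vcover (i : 'I_n) : set Mat := [set A | SU A /\ alcove_at i (q A)].

Definition nu (k : 'I_n) : 'rV[R]_n := delta_mx 0 k - n%:R^-1 *: const_mx 1.

Definition mu (i : 'I_n) : 'rV[R]_n :=
  \sum_(k < n | (k <= i)%N) delta_mx 0 k - (i.+1%:R / n%:R) *: const_mx 1.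

(** ** The data (V, L, t) *)

Definition theta1 (j : 'I_n) (A : Mat) : Mat :=
  xget 0 [set X | exists g lam,
    diagonalizes A g lam /\ X = Ad g (tdiag (lam - mu j))].

Definition theta (i j : 'I_n) (A : Mat) : Mat := theta1 i A - theta1 j A.

Definition adorbit (w : 'rV[R]_n) : set Mat := [set Ad g (tdiag w) | g in SU].

Definition stab (w : 'rV[R]_n) : set Mat :=
  [set h | SU h /\ Ad h (tdiag w) = tdiag w].

(* chi is the unitary character of the group [stab w] with infinitesimal
   character w. As [stab w] is connected and each of its elements is conjugate
   in it to an element of the maximal torus, such a chi is determined by its
   weight on the torus; in particular it is smooth. *)
Definition has_weight (w : 'rV[R]_n) (chi : Mat -> C) : Prop :=
  [/\ forall h, stab w h -> cabs (chi h) = 1,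
      forall h h', stab w h -> stab w h' -> chi (h *m h') = chi h * chi h' &
      forall xi, cartan xi -> chi (texp xi) = expi (inner w xi)].

Definition wchar (w : 'rV[R]_n) : Mat -> C :=
  xget (fun=> 1) [set chi | has_weight w chi].

(* The fibre of G x_{G_w} C_w over a point X of the orbit of w, where
   (g h, z) ~ (g, chi(h) z) for h in G_w: the class [g,z] is identified with
   the function on the coset {g | Ad g w = X} (extended by 0) which maps g h to
   chi(h)^-1 z. *)
Definition assoc_pred (w : 'rV[R]_n) (X : Mat) : {pred (Mat -> C^o)} :=
  fun f => `[< (forall g, ~ (SU g /\ Ad g (tdiag w) = X) -> f g = 0) /\
               (forall g h, SU g -> stab w h ->
                  f (g *m h) = (wchar w h)^-1 * f g) >].

Fact assoc_pred_closed w X : submod_closed (assoc_pred w X).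
Proof.
split=> [|a f f' /asboolP[f0 fE] /asboolP[f'0 f'E]]; apply/asboolP.
  by split=> // g h _ _; rewrite /= mulr0.
split=> [g Ng|g h Gg Sh]; rewrite addrfctE scalrfctE.
  by rewrite f0// f'0// scaler0 addr0.
by rewrite fE// f'E// mulrDr scalerAr.
Qed.

HB.instance Definition _ w X := GRing.isSubmodClosed.Build C (Mat -> C^o)
  (assoc_pred w X) (assoc_pred_closed w X).

Record assoc_fib (w : 'rV[R]_n) (X : Mat) := AssocFib {
  assoc_fun :> Mat -> C^o;
  assoc_funP : assoc_fun \in assoc_pred w X }.

HB.instance Definition _ w X := [isSub for @assoc_fun w X].
HB.instance Definition _ w X := [Choice of assoc_fib w X by <:].
HB.instance Definition _ w X := [SubChoice_isSubLmodule of assoc_fib w X by <:].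

(* A local section is smooth when the equivariant function on G describing it
   is. *)
Definition Lweight (w : 'rV[R]_n) : lbundle R n :=
  @LBundle R n (adorbit w)
    (fun X => @HLine R (assoc_fib w X)
       (fun f => sup [set cabs (f g) | g in SU]))
    (fun W e => [/\ open_in (adorbit w) W, forall X, W X -> e X != 0 &
       smooth_on [set g | SU g /\ W (Ad g (tdiag w))]
         (fun g => assoc_fun (e (Ad g (tdiag w))) g)]).

(* the class [g,1] *)
Definition bracket (w : 'rV[R]_n) (g X : Mat) : Lweight w X :=
  xget 0 [set f : assoc_fib w X | f g = 1].

Definition Lbasic (i j : 'I_n) : lbundle R n :=
  pullback (Vcover i `&` Vcover j) (theta i j) (Lweight (mu j - mu i)).

(* The trivial section 1 of the line bundle with zero weight: at
   A = g exp(lambda) g^-1 it is [g,1] (x) [g,1]^-1 (x) [g,1]. *)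
Definition tbasic (i j k : 'I_n) (A : Mat) : delta Lbasic i j k A :=
  let g := xget 1%:M [set g | exists lam, diagonalizes A g lam] in
  delta_pure (L := Lbasic)
    (fun a b => bracket (mu b - mu a) g (theta a b A)) i j k.

Definition basic_gerbe : gerbe_data R n n := GerbeData tbasic.

(** ** The Gawedzki-Reis data *)

(* The exterior algebra of C^n: omega S is the coefficient of
   e_{s_1} /\ ... /\ e_{s_k} where s_1 < ... < s_k are the elements of S. *)
Definition ext : Type := {ffun {set 'I_n} -> C^o}.

Definition shuffle_sign (S T : {set 'I_n}) : C :=
  (-1) ^+ #|[set z : 'I_n * 'I_n | [&& z.1 \in S, z.2 \in T & (z.2 < z.1)%N]]|.

Definition wedge (x y : ext) : ext :=
  [ffun S : {set 'I_n} => \sum_(T : {set 'I_n} | T \subset S)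
     shuffle_sign T (S :\: T) * x T * y (S :\: T)].

Definition ext1 : ext := [ffun S : {set 'I_n} => (S == finset.set0)%:R].

Definition ext_vec (v : {ffun 'I_n -> C^o}) : ext :=
  [ffun S : {set 'I_n} => \sum_(k | S == [set k]%SET) v k].

Definition wedge_seq (s : seq {ffun 'I_n -> C^o}) : ext :=
  foldr (fun v x => wedge (ext_vec v) x) ext1 s.

(* The vectors v with A v = expi (lambda_k) v are the transposes of the rows of
   this matrix. *)
Definition eigenmx (k : 'I_n) (A : Mat) : Mat :=
  eigenspace A^T (expi (q A 0 k)).

Definition rowvec (W : Mat) (a : 'I_n) : {ffun 'I_n -> C^o} :=
  [ffun k => W a k].

Definition SUreg : set Mat :=
  [set A | SU A /\ forall a, (mup a (char_poly A) <= 1)%N].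

Definition eigenline (k : 'I_n) : lbundle R n :=
  subbundle SUreg (fun A => <<[seq rowvec (eigenmx k A) a | a : 'I_n]>>%VS).

(* The extension E_ij of E_{i+1} (x) ... (x) E_j to V_ij: its fibre is the top
   exterior power of the sum of the eigenspaces for the lambda_k with
   i < k <= j, a space of dimension j - i on V_ij. Its metric and smooth
   structure are induced from the exterior algebra of C^n, in which the e_S are
   orthonormal. *)
Definition specmx (i j : 'I_n) (A : Mat) : Mat :=
  (\sum_(k < n | (i < k <= j)%N) eigenmx k A)%MS.

Definition Egr (i j : 'I_n) : lbundle R n :=
  subbundle (Vcover i `&` Vcover j) (fun A =>
    <<[seq wedge_seq [seq rowvec (specmx i j A) a | a <- s]
       | s : (j - i).-tuple 'I_n]>>%VS).

(* the isomorphism E_ij (x) E_jk -> E_ik mapping x (x) y to x /\ y *)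
Definition gr_mul (i j k : 'I_n) (A : Mat) (s : tens_bundle (Egr i j) (Egr j k) A) :
    Egr i k A :=
  xget 0 [set z : Egr i k A | exists (x : Egr i j A) (y : Egr j k A),
    s = ptens x y /\ vsval z = wedge (vsval x) (vsval y)].

Definition gr_gerbe : gerbe_data R n n :=
  GerbeData (section_of_mul gr_mul).

(* E_{i+1} (x) ... (x) E_j on the regular set, for i < j *)
Definition Eprod (i j : 'I_n) : lbundle R n :=
  tens_range eigenline (ordS i) (j - i).-1.

Definition Eprod_pure (A : Mat) (v : forall k, eigenline k A) (i j : 'I_n) :
    Eprod i j A := pure_range v (ordS i) (j - i).-1.

End SUn.

(* Main.v *)
(* At A = g exp(lambda) g^-1 in V_i and V_j, theta_ij(A) is, up to a scalar, the
   orthogonal projection P_ij(A) onto the span of the columns g_k of g with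
   i < k <= j. Put omega_ij(g) = g_(i+1) /\ ... /\ g_j. For h in the stabilizer of
   mu_j - mu_i one has omega_ij(g h) = chi(h) omega_ij(g), where chi is the unique
   character of weight mu_j - mu_i; hence f |-> f(g) omega_ij(g) identifies the
   fibre of L_ij at A isometrically with the line E_ij in the exterior algebra.
   Under this identification both gerbe structures come from
   omega_ij(g) /\ omega_jk(g) = omega_ik(g), so the cocycle conditions are the
   associativity of the exterior product and the equivalence is tautological.

   The analytic input is that P_ij is smooth: locally it is the positive spectral
   projection of an invertible hermitian polynomial in A and A^-1, and the sign of
   an invertible hermitian matrix is a smooth function of it. *)
Require Import Defs.
From HB Require Import structures.
From mathcomp Require Import all_boot all_order all_algebra.
From mathcomp Require Import fingroup perm.
From mathcomp Require Import all_classical all_reals all_analysis.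
From mathcomp Require Import complex ring lra zify.
Set Implicit Arguments.
Unset Strict Implicit.
Unset Printing Implicit Defensive.
Import Order.TTheory GRing.Theory Num.Theory.
Import numFieldNormedType.Exports.
Local Open Scope classical_set_scope.
Local Open Scope ring_scope.
Local Open Scope sesquilinear_scope.

(** * Smooth functions *)

(** Fibres, sections and even the map [q] are defined by choice ([xget]), so for each of them a
    value independent of the diagonalizing matrix has to be identified before anything can be
    computed. The obstacle lies at points where eigenvalues coincide: eigenvectors cannot be
    followed through them, and only projections onto whole blocks of eigenspaces survive. These are
    written as (sign H + 1)/2. Smoothness of the sign is proved directly from the iterated
    directional derivatives in [Ck]: two signs differ by the solution of a Sylvester equation whose
    coercivity is needed at one of the two points only. This yields a derivative rational in H and
    sign H, and each order of smoothness then gives the next. Fibres of duals and tensor products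
    are iterated spaces of linear maps. Sending all of them into one exterior algebra turns metrics,
    frames and cocycles into statements about coordinates; norms multiply under the exterior product
    there because the lines come from disjoint blocks of one unitary frame. *)

Section CkCalculus.
Variables (R : realType) (V : normedModType R).
Implicit Types (U W : set V) (f g : V -> R^o).

Lemma near_open U x (P : V -> Prop) : open U -> U x ->
  (forall y, U y -> P y) -> \forall y \near x, P y.
Proof. by move=> oU Ux UP; apply: filterS (open_nbhs_nbhs (conj oU Ux)). Qed.

Lemma near_differentiable f g x : (\near x, f x = g x) ->
  differentiable f x -> differentiable g x.
Proof.
move=> fg /diff_locallyP[cf ef].
have fgx : f x = g x by exact: nbhs_singleton fg.
have E : g \o shift x = cst (g x) + 'd f x +o_ 0 id.
  apply/eqaddoP => e e0.
  move/eqaddoP: ef => /(_ e e0) H.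
  have fg0 : \forall y \near 0, f (y + x) = g (y + x).
    by rewrite (near_shift x) /=; near=> z; rewrite /= sub0r addrNK; near: z.
  near=> y.
  have -> : (g \o shift x - (cst (g x) + 'd f x)) y =
            (f \o shift x - (cst (f x) + 'd f x)) y.
    by rewrite !fctE /= -fgx; congr (_ - _); apply/esym; near: y.
  by near: y.
have dE : 'd g x = 'd f x :> (V -> R^o) by apply: diff_unique.
by apply/diff_locallyP; rewrite dE.
Unshelve. all: by end_near. Qed.

Lemma Ck_sub k U W f : W `<=` U -> Ck k U f -> Ck k W f.
Proof.
move=> WU; elim: k f => [|k IH] f /=; first by move=> H x /WU; apply: H.
by case=> H1 H2; split=> [x /WU /H1//|v]; apply: IH.
Qed.

(** Openness of [U] makes the equality hold near each point, hence for the directional derivatives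
    too. Every explicit formula for a derivative enters the inductions on [k] below through this
    lemma. *)
Lemma Ck_eq k U f g : open U -> (forall x, U x -> f x = g x) ->
  Ck k U f -> Ck k U g.
Proof.
move=> oU; elim: k f g => [|k IH] f g fg /=.
  move=> H x Ux; have nfg : \forall y \near x, f y = g y by exact: near_open fg.
  have := H _ Ux; rewrite /prop_for /continuous_at -(fg _ Ux).
  by apply: cvg_trans; apply: near_eq_cvg.
case=> H1 H2; split=> [x Ux|v].
  by apply: near_differentiable (H1 _ Ux); exact: near_open fg.
apply: IH (H2 v) => x Ux; apply: near_eq_derive; exact: near_open fg.
Qed.

Lemma CkS k U f : Ck k.+1 U f <->
  (forall x, U x -> differentiable f x) /\ (forall v, Ck k U ('D_v f)).
Proof. by []. Qed.

Lemma Ck_pred k U f : Ck k.+1 U f -> Ck k U f.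
Proof.
elim: k f => [|k IH] f [H1 H2].
  by move=> x Ux; apply: differentiable_continuous; apply: H1.
by split=> // v; apply: IH.
Qed.

Lemma Ck_cst k U (a : R) : Ck k U (fun _ => a : R^o).
Proof.
elim: k a => [|k IH] a /=; first by move=> x _; apply: cst_continuous.
split=> [x _|v]; first exact: differentiable_cst.
have -> : 'D_v (fun _ : V => a : R^o) = (fun _ => 0).
  by apply/funext => x; rewrite (derive_cst (a : R^o)).
exact: IH.
Qed.

Lemma CkD k U f g : open U -> Ck k U f -> Ck k U g ->
  Ck k U (fun x => f x + g x).
Proof.
move=> oU; elim: k f g => [|k IH] f g /=.
  by move=> H1 H2 x Ux; apply: cvgD; [exact: H1|exact: H2].
case=> f1 f2 [g1 g2]; split=> [x Ux|v].
  exact: (differentiableD (f1 _ Ux) (g1 _ Ux)).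
apply: Ck_eq (IH _ _ (f2 v) (g2 v)) => // x Ux.
by rewrite -(deriveD (diff_derivable (f1 _ Ux)) (diff_derivable (g1 _ Ux))).
Qed.

Lemma CkM k U f g : open U -> Ck k U f -> Ck k U g ->
  Ck k U (fun x => f x * g x).
Proof.
move=> oU; elim: k f g => [|k IH] f g.
  by move=> H1 H2 x Ux; apply: cvgM; [exact: H1|exact: H2].
move=> Ckf Ckg; have /CkS[f1 f2] := Ckf; have /CkS[g1 g2] := Ckg.
apply/CkS; split=> [x Ux|v].
  exact: (differentiableM (f1 _ Ux) (g1 _ Ux)).
apply: (@Ck_eq _ _ (fun x => f x * 'D_v g x + g x * 'D_v f x)) => // [x Ux|].
  by have := deriveM (diff_derivable (f1 _ Ux)) (diff_derivable (g1 _ Ux)) => ->.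
have := f2 v; have := g2 v; have := Ck_pred Ckf; have := Ck_pred Ckg.
by move=> *; apply: CkD => //; apply: IH.
Qed.

Lemma CkN k U f : open U -> Ck k U f -> Ck k U (fun x => - f x).
Proof.
move=> oU Hf; apply: (@Ck_eq _ _ (fun x => -1 * f x)) => //.
  by move=> x _; rewrite mulN1r.
by apply: CkM => //; apply: Ck_cst.
Qed.

Lemma Ck_sum k U (I : Type) (r : seq I) (P : pred I) (F : I -> V -> R^o) :
  open U -> (forall i, P i -> Ck k U (F i)) ->
  Ck k U (fun x => \sum_(i <- r | P i) F i x).
Proof.
move=> oU H; elim: r => [|i r IH].
  by apply: (@Ck_eq _ _ (fun=> 0)) (Ck_cst _ _ _) => // x _; rewrite big_nil.
case Pi : (P i).
  apply: (@Ck_eq _ _ (fun x => F i x + \sum_(i <- r | P i) F i x)) => //.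
    by move=> x _; rewrite big_cons Pi.
  by apply: CkD => //; apply: H.
by apply: Ck_eq IH => // x _; rewrite big_cons Pi.
Qed.

(** The derivative of 1/f is a polynomial in 1/f and f', so the induction hypothesis on 1/f itself
    bootstraps; [Ck_sqrt] follows the same pattern. *)
Lemma CkV k U f : open U -> (forall x, U x -> f x != 0) -> Ck k U f ->
  Ck k U (fun x => (f x)^-1).
Proof.
move=> oU f0; elim: k => [|k IH].
  by move=> H x Ux; apply: cvgV; [exact: f0|exact: H].
move=> Ckf; have /CkS[f1 f2] := Ckf; apply/CkS; split=> [x Ux|v].
  exact: (differentiableV (f1 _ Ux) (f0 _ Ux)).
have CV := IH (Ck_pred Ckf).
apply: (@Ck_eq _ _ (fun x => - ((f x)^-1 * (f x)^-1) * 'D_v f x)) => //.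
  move=> x Ux; rewrite (deriveV (f0 _ Ux) (diff_derivable (f1 _ Ux))).
  by rewrite expr2 invfM.
apply: CkM (f2 v) => //; by apply: CkN => //; apply: CkM.
Qed.

Lemma differentiable_sqrt f x : 0 < f x -> differentiable f x ->
  differentiable (fun y => Num.sqrt (f y) : R^o) x /\
  forall v, 'D_v (fun y => Num.sqrt (f y) : R^o) x =
    (2 * Num.sqrt (f x))^-1 * 'D_v f x.
Proof.
move=> f0 df.
have ds : differentiable (@Num.sqrt R : R^o -> R^o) (f x).
  by apply/derivable1_diffP; exact: (ex_derive (is_derive := is_derive1_sqrt f0)).
have dc := differentiable_comp df ds; split=> // v.
rewrite (deriveE _ dc) (diff_comp df ds) /= (deriveE _ df).
rewrite -[X in 'd _ _ X]mulr1 -[_ * 1]/(_ *: (1 : R^o)) linearZ /=.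
rewrite -(deriveE _ ds) derive_sqrt// /GRing.scale /= mulrC //.
Qed.

Lemma Ck_sqrt k U f : open U -> (forall x, U x -> 0 < f x) -> Ck k U f ->
  Ck k U (fun x => Num.sqrt (f x)).
Proof.
move=> oU f0; elim: k => [|k IH].
  move=> H x Ux; apply: (continuous_comp (H _ Ux)); exact: sqrt_continuous.
move=> Ckf; have /CkS[f1 f2] := Ckf; apply/CkS; split=> [x Ux|v].
  exact: (differentiable_sqrt (f0 _ Ux) (f1 _ Ux)).1.
have CV := IH (Ck_pred Ckf).
apply: (@Ck_eq _ _ (fun x => (2 * Num.sqrt (f x))^-1 * 'D_v f x)) => //.
  by move=> x Ux; rewrite (differentiable_sqrt (f0 _ Ux) (f1 _ Ux)).2.
apply: CkM (f2 v) => //; apply: CkV => // [x Ux|].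
  by rewrite mulf_neq0 ?pnatr_eq0// gt_eqF// sqrtr_gt0 f0.
by apply: CkM => //; apply: Ck_cst.
Qed.

Lemma Ck_linear k U (f : {linear V -> R^o}) : continuous f -> Ck k U f.
Proof.
move=> cf; case: k => [|k]; first by move=> x _; exact: cf.
split=> [x _|v]; first exact: linear_differentiable.
have -> : 'D_v f = (fun _ => f v : R^o).
  apply/funext => x; rewrite deriveE; last exact: linear_differentiable.
  by rewrite diff_lin.
exact: Ck_cst.
Qed.

(** A quadratic remainder is o(h), and the differential is unique. The estimate available for the
    matrix sign has exactly this form. *)
Lemma diff_quadratic f x (L : {linear V -> R^o}) (c C d : R) :
  0 < d -> (forall h, `|L h| <= c * `|h|) ->
  (forall h, `|h| < d -> `|f (x + h) - f x - L h| <= C * `|h| ^+ 2) ->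
  differentiable f x /\ 'd f x = L :> (V -> R^o).
Proof.
move=> d0 Lc H.
have cL : continuous L.
  apply: bounded_linear_continuous; apply/linear_boundedP.
  near=> M => v; apply: le_trans (Lc v) _.
  by apply: ler_wpM2r; [exact: normr_ge0|near: M; exact: (nbhs_pinfty_ge (num_real _))].
have C1 : 0 < `|C| + 1 by rewrite ltr_wpDl.
have E : f \o shift x = cst (f x) + L +o_ 0 id.
  apply/eqaddoP => e e0.
  near=> h.
  have hd : `|h| < d.
    by near: h; exact: nbhs0_lt.
  have -> : (f \o shift x - (cst (f x) + L)) h = f (x + h) - f x - L h.
    by rewrite !fctE /= opprD addrA [h + x]addrC.
  apply: le_trans (H _ hd) _; rewrite expr2 mulrA; apply: ler_wpM2r => //.
  (* [C] may be zero or negative, hence the divisor [|C| + 1]. *)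
  have hC : `|h| <= e / (`|C| + 1).
    by near: h; apply: (@nbhs0_le R V); exact: (divr_gt0 e0 C1).
  rewrite mulrC; apply: le_trans (_ : `|h| * (`|C| + 1) <= _).
    by apply: ler_wpM2l => //; rewrite (le_trans (ler_norm _))// lerDl.
  by rewrite -ler_pdivlMr.
have dE : 'd f x = L :> (V -> R^o) by apply: diff_unique.
by split=> //; apply/diff_locallyP; rewrite dE.
Unshelve. all: by end_near. Qed.

End CkCalculus.

(** * The chain rule for C^k functions, in linear coordinates *)

Section CkComposition.
Variables (R : realType) (V W : normedModType R) (I : finType).
Variables (co : I -> {linear W -> R^o}) (bas : I -> W).
Hypothesis co_continuous : forall i, continuous (co i).
Hypothesis co_bas : forall w, w = \sum_i co i w *: bas i.

Lemma differentiable_coords (G : V -> W) x :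
  (forall i, differentiable (fun y => co i (G y) : R^o) x) ->
  differentiable G x.
Proof.
move=> H; have -> : G = fun y => \sum_i co i (G y) *: bas i.
  by apply/funext => y; exact: co_bas.
elim: (index_enum I) => [|i r IH].
  rewrite (_ : (fun y => _) = cst 0); first exact: differentiable_cst.
  by apply/funext => y; rewrite big_nil.
rewrite (_ : (fun y => _) = (fun y => co i (G y) *: bas i) +
  (fun y => \sum_(j <- r) co j (G y) *: bas j)).
  by apply: differentiableD => //; apply: differentiableZl; exact: H.
by apply/funext => y; rewrite big_cons.
Qed.

(** The derivative of F o G along v is the sum over the basis of the derivative of the i-th
    coordinate of G times the i-th partial derivative of F composed with G; the induction hypothesis
    applies to the latter, which is why [F] is generalized. *)
Lemma Ck_comp k (U : set V) (U' : set W) (F : W -> R^o) (G : V -> W) :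
  open U -> (forall x, U x -> U' (G x)) -> Ck k U' F ->
  (forall i, Ck k U (fun y => co i (G y) : R^o)) -> Ck k U (F \o G).
Proof.
move=> oU UU'; elim: k F => [|k IH] F.
  move=> HF HG x Ux; apply: continuous_comp (HF _ (UU' _ Ux)).
  have -> : G = fun y => \sum_i co i (G y) *: bas i.
    by apply/funext => y; exact: co_bas.
  elim: (index_enum I) => [|i r IH'].
    rewrite (_ : (fun y => _) = cst 0); first exact: cst_continuous.
    by apply/funext => y; rewrite big_nil.
  rewrite (_ : (fun y => _) = (fun y => co i (G y) *: bas i) +
    (fun y => \sum_(j <- r) co j (G y) *: bas j)).
    by apply: cvgD => //; apply: cvgZr_tmp; exact: HG.
  by apply/funext => y; rewrite big_cons.
move=> HF HG; have /CkS[F1 F2] := HF.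
have G1 x : U x -> differentiable G x.
  by move=> Ux; apply: differentiable_coords => i; have /CkS[H _] := HG i; exact: H.
apply/CkS; split=> [x Ux|v].
  exact: differentiable_comp (G1 _ Ux) (F1 _ (UU' _ Ux)).
apply: (@Ck_eq _ _ _ _ (fun x => \sum_i 'D_v (fun y => co i (G y) : R^o) x *
    ('D_(bas i) F \o G) x)) => // [x Ux|]; last first.
  apply: Ck_sum => // i _; apply: CkM => //.
    by have /CkS[_ H] := HG i; exact: H.
  by apply: IH => [|j]; [exact: F2|exact: Ck_pred].
have dG := G1 _ Ux; have dF := F1 _ (UU' _ Ux).
rewrite [RHS]deriveE; last exact: differentiable_comp.
rewrite (diff_comp dG dF) /= [in RHS](co_bas ('d G x v)) linear_sum.
apply: eq_bigr => i _; rewrite linearZ /= (deriveE _ dF); congr (_ * _).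
have dc : differentiable (co i) (G x) by exact: linear_differentiable.
rewrite deriveE; last exact: (differentiable_comp dG dc).
rewrite (_ : (fun y => _) = co i \o G)// (diff_comp dG dc) /=.
by rewrite diff_lin.
Qed.

End CkComposition.

(** * Smooth functions of complex matrices through their real coordinates *)

Section MatrixSmooth.
Variables (R : realType) (n : nat).
Local Notation C := (R[i]).
Local Notation Mat := ('M[C]_n).
Local Notation VV := ('M[R]_n * 'M[R]_n)%type.

Definition cmx (p : VV) : Mat := \matrix_(i, j) (p.1 i j +i* p.2 i j)%C.

Lemma reimK : cancel (@reim R n) cmx.
Proof. by move=> A; apply/matrixP => i j; rewrite !mxE; case: (A i j). Qed.

Lemma cmxK : cancel cmx (@reim R n).
Proof.
by case=> a b; congr pair; apply/matrixP => i j; rewrite !mxE.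
Qed.

Definition VVidx : finType := (bool * ('I_n * 'I_n))%type.

Definition VVco (i : VVidx) (p : VV) : R^o :=
  if i.1 then p.1 i.2.1 i.2.2 else p.2 i.2.1 i.2.2.

Fact VVco_linear i : linear (VVco i).
Proof. by move=> a p p'; rewrite /VVco; case: ifP => _; rewrite !mxE. Qed.

HB.instance Definition _ i :=
  GRing.isLinear.Build R VV R^o _ (VVco i) (VVco_linear i).

Lemma VVco_reim i A : VVco i (reim A) =
  if i.1 then complex.Re (A i.2.1 i.2.2) else complex.Im (A i.2.1 i.2.2).
Proof. by rewrite /VVco /= !mxE. Qed.

Definition VVbas (i : VVidx) : VV :=
  if i.1 then (delta_mx i.2.1 i.2.2, 0) else (0, delta_mx i.2.1 i.2.2).

Lemma VVco_continuous i : continuous (VVco i).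
Proof.
case: i => -[] [i j] p; rewrite /VVco /=.
  apply: (@continuous_comp _ _ _ fst (fun M : 'M[R]_n => M i j : R^o)).
    exact: cvg_fst.
  exact: coord_continuous.
apply: (@continuous_comp _ _ _ snd (fun M : 'M[R]_n => M i j : R^o)).
  exact: cvg_snd.
exact: coord_continuous.
Qed.

Lemma VVco_bas p : p = \sum_i VVco i p *: VVbas i.
Proof.
pose F (b : bool) (ij : 'I_n * 'I_n) := VVco (b, ij) p *: VVbas (b, ij).
transitivity (\sum_b \sum_ij F b ij); last first.
  by rewrite pair_bigA; apply: eq_bigr => -[].
rewrite big_bool /F /= /VVco /VVbas /=.
rewrite (eq_bigr (fun ij => (p.1 ij.1 ij.2 *: delta_mx ij.1 ij.2, 0))); last first.
  by move=> ij _; congr pair; rewrite scaler0.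
rewrite [X in _ + X](eq_bigr (fun ij => (0, p.2 ij.1 ij.2 *: delta_mx ij.1 ij.2))); last first.
  by move=> ij _; congr pair; rewrite scaler0.
have E (M : 'M[R]_n) : \sum_(ij : 'I_n * 'I_n) M ij.1 ij.2 *: delta_mx ij.1 ij.2 = M.
  by rewrite [RHS]matrix_sum_delta pair_bigA.
case: p {F} => p1 p2 /=.
have big1 (f : 'I_n * 'I_n -> 'M[R]_n) : \sum_ij ((f ij, 0) : VV) = (\sum_ij f ij, 0).
  by elim/big_rec2: _ => // ij x y _ ->; rewrite -[RHS]/(_, _); congr pair; rewrite /= ?addr0.
have big2 (f : 'I_n * 'I_n -> 'M[R]_n) : \sum_ij ((0, f ij) : VV) = (0, \sum_ij f ij).
  by elim/big_rec2: _ => // ij x y _ ->; rewrite -[RHS]/(_, _); congr pair; rewrite /= ?addr0.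
by rewrite big1 big2 !E; congr pair; rewrite /= ?addr0 ?add0r.
Qed.

(** C^k on a set of the real coordinate space, one order at a time. A function is [smooth_on] a
    subset when it agrees locally with one that is [csmooth] of every order on an open set
    ([smooth_onP]). *)
Definition csmooth (k : nat) (D : set VV) (f : Mat -> C) : Prop :=
  Ck k D (fun p => complex.Re (f (cmx p))) /\
  Ck k D (fun p => complex.Im (f (cmx p))).

Implicit Types (D U : set VV) (f g : Mat -> C) (S T : set Mat).

Lemma csmooth_sub k D U f : U `<=` D -> csmooth k D f -> csmooth k U f.
Proof. by move=> UO [H1 H2]; split; apply: Ck_sub UO _. Qed.

Lemma csmooth_eq k D f g : open D -> (forall p, D p -> f (cmx p) = g (cmx p)) ->
  csmooth k D f -> csmooth k D g.
Proof.
by move=> oO E [H1 H2]; split; [apply: Ck_eq oO _ H1|apply: Ck_eq oO _ H2] => p /E ->.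
Qed.

Lemma csmooth_cst k D c : csmooth k D (fun=> c).
Proof. by split; apply: Ck_cst. Qed.

Lemma csmooth_coord k D i j : csmooth k D (fun A => A i j).
Proof.
split.
  rewrite (_ : (fun p => _) = VVco (true, (i, j))).
    exact/Ck_linear/VVco_continuous.
  by apply/funext => p; rewrite mxE.
rewrite (_ : (fun p => _) = VVco (false, (i, j))).
  exact/Ck_linear/VVco_continuous.
by apply/funext => p; rewrite mxE.
Qed.

Lemma csmoothD k D f g : open D -> csmooth k D f -> csmooth k D g ->
  csmooth k D (fun A => f A + g A).
Proof.
move=> oO [f1 f2] [g1 g2]; split.
  by apply: Ck_eq (CkD oO f1 g1) => // p _; rewrite raddfD.
by apply: Ck_eq (CkD oO f2 g2) => // p _; rewrite raddfD.
Qed.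

Lemma csmoothM k D f g : open D -> csmooth k D f -> csmooth k D g ->
  csmooth k D (fun A => f A * g A).
Proof.
move=> oO [f1 f2] [g1 g2]; split.
  apply: Ck_eq (CkD oO (CkM oO f1 g1) (CkN oO (CkM oO f2 g2))) => // p _.
  by case: (f _) => a b; case: (g _) => c d.
apply: Ck_eq (CkD oO (CkM oO f1 g2) (CkM oO f2 g1)) => // p _.
by case: (f _) => a b; case: (g _) => c d.
Qed.

Lemma conjCE (z : C) : z^* = conjc z.
Proof. by []. Qed.

Lemma csmooth_conj k D f : open D -> csmooth k D f ->
  csmooth k D (fun A => (f A)^*).
Proof.
move=> oO [f1 f2]; split.
  by apply: Ck_eq f1 => // p _; rewrite conjCE; case: (f _).
by apply: Ck_eq (CkN oO f2) => // p _; rewrite conjCE; case: (f _).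
Qed.

Lemma csmoothV k D f : open D -> (forall p, D p -> f (cmx p) != 0) ->
  csmooth k D f -> csmooth k D (fun A => (f A)^-1).
Proof.
move=> oO f0 [f1 f2].
pose d p := complex.Re (f (cmx p)) * complex.Re (f (cmx p)) +
  complex.Im (f (cmx p)) * complex.Im (f (cmx p)).
have dC : Ck k D d by apply: CkD => //; apply: CkM.
have d0 p : D p -> d p != 0.
  move=> /f0; rewrite /d; case: (f _) => a b /=; apply: contra.
  rewrite paddr_eq0 ?sqr_ge0 -?expr2 ?sqr_ge0// !sqrf_eq0.
  by move=> /andP[/eqP-> /eqP->].
have VC := CkV oO d0 dC; split.
  apply: Ck_eq (CkM oO f1 VC) => // p _; rewrite /d; case: (f _) => a b /=.
  by rewrite -!expr2.
apply: Ck_eq (CkN oO (CkM oO f2 VC)) => // p _; rewrite /d; case: (f _) => a b /=.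
by rewrite -!expr2.
Qed.

Lemma csmooth_sqrt k D f : open D -> (forall p, D p -> 0 < complex.Re (f (cmx p))) ->
  csmooth k D f -> csmooth k D (fun A => (Num.sqrt (complex.Re (f A)))%:C%C).
Proof.
move=> oO f0 [f1 f2]; split; last by apply: Ck_cst.
exact: Ck_sqrt.
Qed.

Lemma reim_continuous_at D (G : Mat -> Mat) p : open D -> D p ->
  (forall i j, csmooth 0 D (fun A => G A i j)) ->
  {for p, continuous (fun p => reim (G (cmx p)))}.
Proof.
move=> oO Op H.
rewrite (_ : (fun p => _) = fun p => \sum_i VVco i (reim (G (cmx p))) *: VVbas i);
  last by apply/funext => y; exact: VVco_bas.
elim: (index_enum _) => [|i r IH'].
  rewrite (_ : (fun y => _) = cst 0); first exact: cst_continuous.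
  by apply/funext => y; rewrite big_nil.
rewrite (_ : (fun y => _) = (fun y => VVco i (reim (G (cmx y))) *: VVbas i) +
  (fun y => \sum_(j <- r) VVco j (reim (G (cmx y))) *: VVbas j)).
  apply: cvgD => //; apply: cvgZr_tmp; have [H1 H2] := H i.2.1 i.2.2.
  suff /(_ p Op) : Ck 0 D (fun y => VVco i (reim (G (cmx y)))) by [].
  under eq_fun do rewrite VVco_reim.
  by case: (i.1); [exact: H1|exact: H2].
by apply/funext => y; rewrite big_cons.
Qed.

Lemma csmooth_comp k D U F (G : Mat -> Mat) : open D ->
  (forall p, D p -> U (reim (G (cmx p)))) -> csmooth k U F ->
  (forall i j, csmooth k D (fun A => G A i j)) ->
  csmooth k D (fun A => F (G A)).
Proof.
move=> oO OU [F1 F2] HG.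
have HG' i : Ck k D (fun y => VVco i (reim (G (cmx y))) : R^o).
  have [H1 H2] := HG i.2.1 i.2.2; under eq_fun do rewrite VVco_reim.
  by case: (i.1); [exact: H1|exact: H2].
split.
  apply: Ck_eq (Ck_comp VVco_continuous VVco_bas oO OU F1 HG') => // p _ /=.
  by rewrite reimK.
apply: Ck_eq (Ck_comp VVco_continuous VVco_bas oO OU F2 HG') => // p _ /=.
by rewrite reimK.
Qed.

Lemma smooth_onP S f : smooth_on S f <->
  forall A, S A -> exists D h, [/\ open D, D (reim A),
    forall k, csmooth k D h & forall B, S B -> D (reim B) -> f B = h B].
Proof.
split=> H A SA; have := H A SA.
  move=> [D [a [b [oO OA Ca Cb E]]]].
  exists D, (fun B => (a (reim B) +i* b (reim B))%C); split=> // k.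
  split; [apply: Ck_eq (Ca k)|apply: Ck_eq (Cb k)] => //= p _; by rewrite cmxK.
move=> [D [h [oO OA Ch E]]]; exists D, (fun p => complex.Re (h (cmx p))),
  (fun p => complex.Im (h (cmx p))); split=> //; try by move=> k; case: (Ch k).
by move=> B SB OB; rewrite E// reimK; case: (h B).
Qed.

Lemma smooth_on_sub S T f : S `<=` T -> smooth_on T f -> smooth_on S f.
Proof.
move=> ST H A SA; have [D [a [b [? ? ? ? E]]]] := H A (ST _ SA).
by exists D, a, b; split=> // B /ST; apply: E.
Qed.

Lemma smooth_on_eq S f g : (forall A, S A -> f A = g A) ->
  smooth_on S f -> smooth_on S g.
Proof.
move=> fg H A SA; have [D [a [b [? ? ? ? E]]]] := H A SA.
by exists D, a, b; split=> // B SB OB; rewrite -fg// E.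
Qed.

Lemma smooth_on_local S f :
  (forall A, S A -> exists D, [/\ open D, D (reim A) &
     smooth_on (S `&` (@reim R n @^-1` D)) f]) -> smooth_on S f.
Proof.
move=> H A SA; have [D [oO OA Sf]] := H A SA.
have [D' [a [b [oO' OA' Ca Cb E]]]] := Sf A (conj SA OA).
exists (D `&` D'), a, b; split=> //; first exact: openI.
- by move=> k; apply: Ck_sub (Ca k) => ? [].
- by move=> k; apply: Ck_sub (Cb k) => ? [].
by move=> B SB [OB OB']; apply: E.
Qed.

Lemma smooth_on_cst S c : smooth_on S (fun=> c).
Proof.
apply/smooth_onP => A SA; exists setT, (fun=> c); split=> //; first exact: openT.
by move=> k; apply: csmooth_cst.
Qed.

Lemma smooth_on_coord S i j : smooth_on S (fun A => A i j).
Proof.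
apply/smooth_onP => A SA; exists setT, (fun A => A i j); split=> //.
  exact: openT.
by move=> k; apply: csmooth_coord.
Qed.

Lemma smooth_onD S f g : smooth_on S f -> smooth_on S g ->
  smooth_on S (fun A => f A + g A).
Proof.
move=> /smooth_onP Hf /smooth_onP Hg; apply/smooth_onP => A SA.
have [D [h [oO OA Ch E]]] := Hf A SA; have [D' [h' [oO' OA' Ch' E']]] := Hg A SA.
have oOO := openI oO oO'.
exists (D `&` D'), (fun A => h A + h' A); split=> //.
  move=> k; apply: csmoothD => //.
    by apply: csmooth_sub (Ch k) => ? [].
  by apply: csmooth_sub (Ch' k) => ? [].
by move=> B SB [OB OB']; rewrite E// E'.
Qed.

Lemma smooth_onM S f g : smooth_on S f -> smooth_on S g ->
  smooth_on S (fun A => f A * g A).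
Proof.
move=> /smooth_onP Hf /smooth_onP Hg; apply/smooth_onP => A SA.
have [D [h [oO OA Ch E]]] := Hf A SA; have [D' [h' [oO' OA' Ch' E']]] := Hg A SA.
have oOO := openI oO oO'.
exists (D `&` D'), (fun A => h A * h' A); split=> //.
  move=> k; apply: csmoothM => //.
    by apply: csmooth_sub (Ch k) => ? [].
  by apply: csmooth_sub (Ch' k) => ? [].
by move=> B SB [OB OB']; rewrite E// E'.
Qed.

Lemma smooth_on_conj S f : smooth_on S f -> smooth_on S (fun A => (f A)^*).
Proof.
move=> /smooth_onP Hf; apply/smooth_onP => A SA.
have [D [h [oO OA Ch E]]] := Hf A SA.
exists D, (fun A => (h A)^*); split=> //.
  by move=> k; apply: csmooth_conj.
by move=> B SB OB; rewrite E.
Qed.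

Lemma smooth_onN S f : smooth_on S f -> smooth_on S (fun A => - f A).
Proof.
move=> H; apply: (@smooth_on_eq _ (fun A => -1 * f A)) => [A _|].
by rewrite mulN1r.
by apply: smooth_onM => //; apply: smooth_on_cst.
Qed.

Lemma smooth_onB S f g : smooth_on S f -> smooth_on S g ->
  smooth_on S (fun A => f A - g A).
Proof. by move=> Hf Hg; apply: smooth_onD => //; apply: smooth_onN. Qed.

Lemma smooth_on_sum S (I : Type) (r : seq I) (P : pred I) (F : I -> Mat -> C) :
  (forall i, P i -> smooth_on S (F i)) ->
  smooth_on S (fun A => \sum_(i <- r | P i) F i A).
Proof.
move=> H; elim: r => [|i r IH].
  by apply: (@smooth_on_eq _ (fun=> 0)) => [x _|]; rewrite ?big_nil//; exact: smooth_on_cst.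
case Pi : (P i); last by apply: smooth_on_eq IH => x _; rewrite big_cons Pi.
apply: (@smooth_on_eq _ (fun A => F i A + \sum_(i <- r | P i) F i A)).
  by move=> x _; rewrite big_cons Pi.
by apply: smooth_onD => //; apply: H.
Qed.

Lemma smooth_on_prod S (I : Type) (r : seq I) (P : pred I) (F : I -> Mat -> C) :
  (forall i, P i -> smooth_on S (F i)) ->
  smooth_on S (fun A => \prod_(i <- r | P i) F i A).
Proof.
move=> H; elim: r => [|i r IH].
  by apply: (@smooth_on_eq _ (fun=> 1)) => [x _|]; rewrite ?big_nil//; exact: smooth_on_cst.
case Pi : (P i); last by apply: smooth_on_eq IH => x _; rewrite big_cons Pi.
apply: (@smooth_on_eq _ (fun A => F i A * \prod_(i <- r | P i) F i A)).
  by move=> x _; rewrite big_cons Pi.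
by apply: smooth_onM => //; apply: H.
Qed.

Lemma csmooth_open D f (P : set (R * R)) : open D -> csmooth 0 D f -> open P ->
  open (D `&` [set p | P (complex.Re (f (cmx p)), complex.Im (f (cmx p)))]).
Proof.
move=> oO [H1 H2] oP; rewrite openE => p [Op Pp]; apply: filterI.
  exact: open_nbhs_nbhs.
have c : {for p, continuous
    (fun p => (complex.Re (f (cmx p)), complex.Im (f (cmx p))) : R^o * R^o)}.
  exact: (cvg_pair (H1 _ Op) (H2 _ Op)).
by apply: c; apply: open_nbhs_nbhs.
Qed.

Lemma open_neq0 : open [set z : R * R | (z.1 +i* z.2)%C != 0 :> C].
Proof.
rewrite (_ : [set _ | _] = (fst @^-1` [set x | x != 0]) `|` (snd @^-1` [set x | x != 0])).
  by apply: openU; apply: open_comp (@open_neq _ 0) => ? _;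
    [exact: cvg_fst|exact: cvg_snd].
apply/seteqP; split=> -[a b] /=; rewrite eq_complex /= negb_and.
  by move=> /orP.
by move=> /orP.
Qed.

Lemma smooth_onV S f : (forall A, S A -> f A != 0) -> smooth_on S f ->
  smooth_on S (fun A => (f A)^-1).
Proof.
move=> f0 /smooth_onP Hf; apply/smooth_onP => A SA.
have [D [h [oO OA Ch E]]] := Hf A SA.
(* The extension [h] may vanish off [S], so its domain is shrunk to the open set where it does
   not. *)
have oO' := csmooth_open oO (Ch 0) open_neq0.
set D' := D `&` _ in oO'.
exists D', (fun A => (h A)^-1); split=> //.
- split=> //=; rewrite reimK; rewrite -E//.
  by have := f0 _ SA; case: (f A).
- move=> k; apply: csmoothV => //.
    by move=> p [_ /=]; case: (h _).
  by apply: csmooth_sub (Ch k) => ? [].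
by move=> B SB [OB _]; rewrite E.
Qed.

Lemma smooth_on_sqrt S f : (forall A, S A -> 0 < complex.Re (f A)) ->
  smooth_on S f -> smooth_on S (fun A => (Num.sqrt (complex.Re (f A)))%:C%C).
Proof.
move=> f0 /smooth_onP Hf; apply/smooth_onP => A SA.
have [D [h [oO OA Ch E]]] := Hf A SA.
have oP : open [set z : R * R | 0 < z.1].
  by apply: (@open_comp _ _ (@fst R R) _ _ (@open_gt _ 0)) => ? _; exact: cvg_fst.
have oO' := csmooth_open oO (Ch 0) oP.
set D' := D `&` _ in oO'.
exists D', (fun A => (Num.sqrt (complex.Re (h A)))%:C%C); split=> //.
- by split=> //=; rewrite reimK -E// f0.
- move=> k; apply: csmooth_sqrt => //.
    by move=> p [_ /=].
  by apply: csmooth_sub (Ch k) => ? [].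
by move=> B SB [OB _]; rewrite E.
Qed.

(** Each entry has its own extension on its own domain; the finite intersection of the domains
    carries one matrix-valued extension, as composition requires. *)
Lemma smooth_on_ext_mx S (G : Mat -> Mat) A :
  (forall i j, smooth_on S (fun A => G A i j)) -> S A ->
  exists D H, [/\ open D, D (reim A),
    forall k i j, csmooth k D (fun A => (H A : Mat) i j) &
    forall B, S B -> D (reim B) -> G B = H B].
Proof.
move=> HG SA.
have /choice[D_ HD_] : forall ij : 'I_n * 'I_n, exists D, exists h,
  [/\ open D, D (reim A), forall k, csmooth k D h &
      forall B, S B -> D (reim B) -> G B ij.1 ij.2 = h B].
  by move=> ij; have /smooth_onP := HG ij.1 ij.2; apply.
have /choice[h_ Hh] := HD_.
exists (\bigcap_(ij in [set` index_enum ('I_n * 'I_n)%type]) D_ ij), (fun A => \matrix_(i, j) h_ (i, j) A).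
split.
- rewrite bigcap_seq.
  by elim/big_ind: _ => [||ij _]; [exact: openT|exact: openI|have [] := Hh ij].
- by move=> ij _; have [] := Hh ij.
- move=> k i j; have [_ _ H _] := Hh (i, j).
  rewrite (_ : (fun A => _) = h_ (i, j)).
    by apply: csmooth_sub (H k) => p Dp; apply: Dp; rewrite /= mem_index_enum.
  by apply/funext => B; rewrite mxE.
move=> B SB OB; apply/matrixP => i j; rewrite mxE.
have [_ _ _ H] := Hh (i, j); by apply: H => //; apply: OB; rewrite /= mem_index_enum.
Qed.

Lemma open_reim_comp D (H : Mat -> Mat) U : open D -> open U ->
  (forall i j, csmooth 0 D (fun A => H A i j)) ->
  open (D `&` [set p | U (reim (H (cmx p)))]).
Proof.
move=> oO oU CH; rewrite openE => p [Op Up]; apply: filterI.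
  exact: open_nbhs_nbhs.
apply: (reim_continuous_at oO Op CH); exact: open_nbhs_nbhs.
Qed.

Lemma smooth_on_comp S T F (G : Mat -> Mat) : (forall A, S A -> T (G A)) ->
  smooth_on T F -> (forall i j, smooth_on S (fun A => G A i j)) ->
  smooth_on S (fun A => F (G A)).
Proof.
move=> ST /smooth_onP HF HG; apply/smooth_onP => A SA.
have [D [H [oO OA CH EH]]] := smooth_on_ext_mx HG SA.
have [U [h [oU UA Ch Eh]]] := HF _ (ST _ SA).
have oO' := open_reim_comp oO oU (CH 0).
exists (D `&` [set p | U (reim (H (cmx p)))]), (fun A => h (H A)); split=> //.
- by split=> //=; rewrite reimK -EH.
- move=> k; apply: csmooth_comp (Ch k) _ => //; first by move=> p [].
  by move=> i j; apply: csmooth_sub (CH k i j) => ? [].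
by move=> B SB [OB /=]; rewrite reimK EH// => UB; apply: Eh => //; rewrite -EH//; exact: ST.
Qed.

Lemma open_inP S W : open_in S W <-> W `<=` S /\
  forall A, W A -> exists D, [/\ open D, D (reim A) &
    forall B, S B -> D (reim B) -> W B].
Proof.
split.
  move=> [D oO ->]; split=> [A []//|A [SA OA]]; exists D; split=> //.
move=> [WS H].
exists (\bigcup_(D in [set D | open D /\ forall B, S B -> D (reim B) -> W B]) D).
  by apply: bigcup_open => D [].
apply/seteqP; split=> [A WA|A [SA [D [_ H'] OA]]]; last exact: H'.
by split; [exact: WS|have [D [? ? ?]] := H A WA; exists D].
Qed.

Lemma open_in_comp S T W (G : Mat -> Mat) : (forall A, S A -> T (G A)) ->
  (forall i j, smooth_on S (fun A => G A i j)) -> open_in T W ->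
  open_in S (S `&` [set A | W (G A)]).
Proof.
move=> ST HG [U oU ->]; apply/open_inP; split=> [A []//|A [SA [TA UA]]].
have [D [H [oO OA CH EH]]] := smooth_on_ext_mx HG SA.
exists (D `&` [set p | U (reim (H (cmx p)))]); split.
- exact: open_reim_comp oO oU (CH 0).
- by split=> //=; rewrite reimK -EH.
move=> B SB [OB /=]; rewrite reimK => UB; split=> //; split; first exact: ST.
by rewrite /= EH.
Qed.

Lemma open_in_neq0 S f : smooth_on S f -> open_in S (S `&` [set A | f A != 0]).
Proof.
move=> /smooth_onP Hf; apply/open_inP; split=> [A []//|A [SA fA]].
have [D [h [oO OA Ch E]]] := Hf A SA.
exists (D `&` [set p | (complex.Re (h (cmx p)) +i* complex.Im (h (cmx p)))%C != 0 :> C]).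
split.
- exact: (csmooth_open oO (Ch 0) open_neq0).
- by split=> //=; rewrite reimK -E//; move: fA => /=; case: (f A).
by move=> B SB [OB /=]; rewrite reimK -E// => H; split=> //=; move: H; case: (f B).
Qed.

End MatrixSmooth.

(** * The sign of a hermitian matrix *)

Section AdjointMatrix.
Variable C : numClosedFieldType.

Lemma adjM m n p (A : 'M[C]_(m, n)) (B : 'M[C]_(n, p)) :
  (A *m B)^t* = B^t* *m A^t*.
Proof. by rewrite trmx_mul map_mxM. Qed.

Lemma adjD m n (A B : 'M[C]_(m, n)) : (A + B)^t* = A^t* + B^t*.
Proof. by rewrite linearD map_mxD. Qed.

Lemma adjN m n (A : 'M[C]_(m, n)) : (- A)^t* = - A^t*.
Proof. by rewrite linearN map_mxN. Qed.

Lemma adjB m n (A B : 'M[C]_(m, n)) : (A - B)^t* = A^t* - B^t*.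
Proof. by rewrite adjD adjN. Qed.

Lemma adjZ m n a (A : 'M[C]_(m, n)) : (a *: A)^t* = a^* *: A^t*.
Proof. by rewrite linearZ map_mxZ. Qed.

Lemma adj1 n : (1%:M : 'M[C]_n)^t* = 1%:M.
Proof. by rewrite trmx1 map_mx1. Qed.

Lemma adj_diag n (d : 'rV[C]_n) : (diag_mx d)^t* = diag_mx (map_mx Num.conj_op d).
Proof. by rewrite tr_diag_mx map_diag_mx. Qed.

Lemma adjE m n (A : 'M[C]_(m, n)) i j : (A^t*) i j = (A j i)^*.
Proof. by rewrite !mxE. Qed.

Lemma tr_adj n (A : 'M[C]_n) : \tr (A^t*) = (\tr A)^*.
Proof. by rewrite /mxtrace rmorph_sum; apply: eq_bigr => i _; rewrite adjE. Qed.

Lemma mxtraceB n (A B : 'M[C]_n) : \tr (A - B) = \tr A - \tr B.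
Proof. by rewrite linearB. Qed.

Lemma unitary_mulmxV n (U : 'M[C]_n) : U \is unitarymx -> U *m U^t* = 1%:M.
Proof. by move/unitarymxP. Qed.

Lemma unitary_mulVmx n (U : 'M[C]_n) : U \is unitarymx -> U^t* *m U = 1%:M.
Proof. by move/unitarymxP => H; apply: mulmx1C. Qed.

Lemma det_adj n (A : 'M[C]_n) : \det (A^t*) = (\det A)^*.
Proof. by rewrite det_map_mx det_tr. Qed.

(** The square of the Frobenius norm, kept squared to avoid roots: being a trace it suits positivity
    arguments, while [norm1] below is submultiplicative and suits error terms. *)
Definition frob2 m n (X : 'M[C]_(m, n)) : C := \sum_i \sum_j `|X i j| ^+ 2.

Definition norm1 m n (X : 'M[C]_(m, n)) : C := \sum_i \sum_j `|X i j|.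

Lemma frob2E m n (X : 'M[C]_(m, n)) : frob2 X = \tr (X^t* *m X).
Proof.
rewrite /mxtrace /frob2 exchange_big; apply: eq_bigr => j _.
by rewrite mxE; apply: eq_bigr => i _; rewrite adjE normCK mulrC.
Qed.

Lemma frob2_ge0 m n (X : 'M[C]_(m, n)) : 0 <= frob2 X.
Proof. by apply: sumr_ge0 => i _; apply: sumr_ge0 => j _; rewrite exprn_ge0. Qed.

Lemma norm1_ge0 m n (X : 'M[C]_(m, n)) : 0 <= norm1 X.
Proof. by apply: sumr_ge0 => i _; apply: sumr_ge0 => j _. Qed.

Lemma norm1_entry m n (X : 'M[C]_(m, n)) i j : `|X i j| <= norm1 X.
Proof.
rewrite /norm1 (bigD1 i)//= (bigD1 j)//= -addrA lerDl addr_ge0//.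
  by apply: sumr_ge0.
by apply: sumr_ge0 => ? _; apply: sumr_ge0.
Qed.

Lemma frob2_entry m n (X : 'M[C]_(m, n)) i j : `|X i j| ^+ 2 <= frob2 X.
Proof.
rewrite /frob2 (bigD1 i)//= (bigD1 j)//= -addrA lerDl addr_ge0//.
  by apply: sumr_ge0 => ? _; rewrite exprn_ge0.
by apply: sumr_ge0 => ? _; apply: sumr_ge0 => ? _; rewrite exprn_ge0.
Qed.

Lemma norm1D m n (X Y : 'M[C]_(m, n)) : norm1 (X + Y) <= norm1 X + norm1 Y.
Proof.
rewrite /norm1 -big_split /=; apply: ler_sum => i _; rewrite -big_split /=.
by apply: ler_sum => j _; rewrite mxE ler_normD.
Qed.

Lemma norm1N m n (X : 'M[C]_(m, n)) : norm1 (- X) = norm1 X.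
Proof. by apply: eq_bigr => i _; apply: eq_bigr => j _; rewrite mxE normrN. Qed.

Lemma norm1M m n p (X : 'M[C]_(m, n)) (Y : 'M[C]_(n, p)) :
  norm1 (X *m Y) <= norm1 X * norm1 Y.
Proof.
apply: le_trans (_ : \sum_i \sum_j \sum_k `|X i k| * `|Y k j| <= _).
  apply: ler_sum => i _; apply: ler_sum => j _; rewrite mxE.
  apply: le_trans (ler_norm_sum _ _ _) _.
  by apply: ler_sum => k _; rewrite normrM.
rewrite mulr_suml; apply: ler_sum => i _; rewrite exchange_big mulr_suml /=.
apply: ler_sum => k _; rewrite -mulr_sumr ler_wpM2l//.
rewrite /norm1 (bigD1 k)//= lerDl.
by apply: sumr_ge0 => ? _; apply: sumr_ge0.
Qed.

Lemma frob2_le_norm1 m n (X : 'M[C]_(m, n)) : frob2 X <= norm1 X ^+ 2.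
Proof.
rewrite expr2 {1}/norm1 mulr_suml; apply: ler_sum => i _.
rewrite mulr_suml; apply: ler_sum => j _; rewrite expr2 ler_wpM2l//.
exact: norm1_entry.
Qed.

Lemma norm1_le_frob2 n (X : 'M[C]_n) c : 0 <= c -> frob2 X <= c ^+ 2 ->
  norm1 X <= (n * n)%:R * c.
Proof.
move=> c0 Xc; have H i j : `|X i j| <= c.
  by rewrite -(ler_pXn2r (n := 2))// (le_trans (frob2_entry _ _ _)).
apply: le_trans (_ : \sum_(i < n) \sum_(j < n) c <= _).
  by apply: ler_sum => i _; apply: ler_sum => j _.
by rewrite sumr_const card_ord sumr_const card_ord -mulrnA mulr_natl.
Qed.

Lemma frob2B_le m n (X Y : 'M[C]_(m, n)) :
  frob2 (X - Y) <= frob2 X *+ 2 + frob2 Y *+ 2.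
Proof.
have -> : frob2 X *+ 2 + frob2 Y *+ 2 = frob2 (X - Y) + frob2 (X + Y).
  rewrite !frob2E adjB adjD mulmxBl mulmxDl !mulmxBr !mulmxDr.
  by rewrite !(mxtraceD, mxtraceB); ring.
by rewrite lerDl frob2_ge0.
Qed.

(** Tested on square matrices instead of vectors, so that it applies directly to the unknown of a
    Sylvester equation. *)
Definition psdmx n (K : 'M[C]_n) : Prop :=
  forall X : 'M[C]_n, 0 <= \tr (X^t* *m K *m X).

(** Pairing the equation with D gives k |D|^2 <= T := tr(D^* F), since the term with [K'] is
    nonnegative. Expanding 0 <= |k D - F|^2 = k^2 |D|^2 - 2 k T + |F|^2 then bounds k^2 |D|^2 by
    |F|^2. Only [K] has to be coercive. *)
Lemma psd_sylvester n (K K' D F : 'M[C]_n) (k : C) : 0 < k ->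
  K^t* = K -> K'^t* = K' ->
  (forall X : 'M[C]_n, k * frob2 X <= \tr (X^t* *m K *m X)) -> psdmx K' ->
  K *m D + D *m K' = F -> k ^+ 2 * frob2 D <= frob2 F.
Proof.
move=> k0 hK hK' Kk psd' E.
set T := \tr (D^t* *m F).
have T1 : k * frob2 D <= T.
  rewrite /T -E mulmxDr mxtraceD mulmxA.
  have -> : \tr (D^t* *m (D *m K')) = \tr (D^t* ^t* *m K' *m D^t*).
    by rewrite trmxCK mulmxA mxtrace_mulC -mulmxA [in RHS]mxtrace_mulC -mulmxA mxtrace_mulC.
  by rewrite -[leLHS]addr0 lerD// psd'.
have Tr : \tr (F^t* *m D) = T.
  have -> : \tr (F^t* *m D) = T^* by rewrite /T -tr_adj adjM trmxCK.
  by apply/CrealP; apply: ger0_real; apply: le_trans T1; rewrite mulr_ge0 ?frob2_ge0// ltW.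
have H : 0 <= k ^+ 2 * frob2 D - k * (T *+ 2) + frob2 F.
  suff <- : frob2 (k *: D - F) = k ^+ 2 * frob2 D - k * (T *+ 2) + frob2 F.
    exact: frob2_ge0.
  rewrite !frob2E adjB adjZ (CrealP (gtr0_real k0)) mulmxBl !mulmxBr.
  by rewrite !mxtraceB -!scalemxAl -!scalemxAr !mxtraceZ Tr -/T; ring.
have T2 : k * ((k * frob2 D) *+ 2) <= k * (T *+ 2).
  by apply: ler_wpM2l; [exact: ltW|rewrite !mulr2n; exact: lerD].
have : 0 <= k ^+ 2 * frob2 D - k * ((k * frob2 D) *+ 2) + frob2 F.
  by apply: le_trans H _; rewrite lerD2r lerB.
move=> H2; rewrite -subr_ge0; apply: le_trans H2 _.
by rewrite le_eqVlt; apply/orP; left; apply/eqP; ring.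
Qed.

Lemma unitary_diag_hermitian n (P : 'M[C]_n) (d : 'rV[C]_n) : P \is unitarymx ->
  (forall i, d 0 i \is Num.real) ->
  (P^t* *m diag_mx d *m P)^t* = P^t* *m diag_mx d *m P.
Proof.
move=> uP dr; rewrite !adjM trmxCK adj_diag mulmxA.
suff -> : map_mx Num.conj_op d = d by [].
by apply/rowP => i; rewrite mxE; apply/CrealP.
Qed.

Lemma hermitian_diag n (H : 'M[C]_n) : H^t* = H ->
  exists P (d : 'rV[C]_n), [/\ P \is unitarymx, forall i, d 0 i \is Num.real &
    H = P^t* *m diag_mx d *m P].
Proof.
move=> hH; have Hh : H \is hermsymmx.
  by apply/is_hermitianmxP; rewrite expr0 scale1r.
have /orthomx_spectralP := hermitian_normalmx Hh.
rewrite invmx_unitary ?spectral_unitarymx// => E.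
exists (spectralmx H), (spectral_diag H); split=> //.
  exact: spectral_unitarymx.
by move=> i; have /mxOverP := hermitian_spectral_diag_real Hh; apply.
Qed.

Lemma trace_diag_quad n (P X : 'M[C]_n) (d : 'rV[C]_n) :
  \tr (X^t* *m (P^t* *m diag_mx d *m P) *m X) =
  \sum_i d 0 i * \sum_j `|(P *m X) i j| ^+ 2.
Proof.
rewrite !mulmxA -adjM -mulmxA mxtrace_mulC mulmxA mxtrace_mulC mul_diag_mx.
rewrite /mxtrace; apply: eq_bigr => i _.
rewrite !mxE; congr (_ * _); apply: eq_bigr => j _.
by rewrite adjE normCK.
Qed.

Lemma frob2_unitaryl n (P X : 'M[C]_n) : P \is unitarymx -> frob2 (P *m X) = frob2 X.
Proof.
by move=> uP; rewrite !frob2E adjM -mulmxA [P^t* *m _]mulmxA unitary_mulVmx// mul1mx.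
Qed.

Lemma frob2_unitaryr n (P X : 'M[C]_n) : P \is unitarymx -> frob2 (X *m P) = frob2 X.
Proof.
move=> uP; rewrite !frob2E adjM mxtrace_mulC mulmxA -[X *m P *m _]mulmxA.
by rewrite unitary_mulmxV// mulmx1 mxtrace_mulC.
Qed.

Lemma psd_diag n (P : 'M[C]_n) (d : 'rV[C]_n) : P \is unitarymx ->
  psdmx (P^t* *m diag_mx d *m P) <-> forall i, 0 <= d 0 i.
Proof.
move=> uP; split=> [H i|H X].
  have := H (P^t* *m delta_mx i i).
  rewrite trace_diag_quad mulmxA unitary_mulmxV// mul1mx.
  rewrite (bigD1 i)//= [X in _ + X]big1 ?addr0 => [|k ki]; last first.
    rewrite big1 ?mulr0// => j _.
    by rewrite mxE (negbTE ki) normr0 expr0n.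
  rewrite (bigD1 i)//= [X in _ + X]big1 ?addr0 => [|k ki]; last first.
    by rewrite mxE (negbTE ki) andbF normr0 expr0n.
  by rewrite mxE !eqxx normr1 expr1n mulr1.
rewrite trace_diag_quad; apply: sumr_ge0 => i _; apply: mulr_ge0 => //.
by apply: sumr_ge0 => j _; rewrite exprn_ge0.
Qed.

Lemma psd_coercive n (K : 'M[C]_n) : K^t* = K -> psdmx K -> K \in unitmx ->
  exists2 k : C, 0 < k &
    forall X : 'M[C]_n, k * frob2 X <= \tr (X^t* *m K *m X).
Proof.
move=> hK psdK uK; have [P [d [uP dr E]]] := hermitian_diag hK.
have d0 : forall i, 0 <= d 0 i by apply/(psd_diag _ uP); rewrite -E.
have dP i : 0 < d 0 i.
  rewrite lt_neqAle d0 andbT eq_sym; apply/negP => /eqP di0.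
  move: uK; rewrite unitmxE E !det_mulmx det_diag (bigD1 i)//= di0.
  by rewrite mul0r mulr0 mul0r unitr0.
(* 1/s lies below every eigenvalue, as s exceeds each 1/d_i; the summand 1 keeps s positive when n =
   0. *)
pose s := 1 + \sum_i (d 0 i)^-1.
have s0 : 0 < s by rewrite ltr_pwDl// sumr_ge0// => i _; rewrite invr_ge0.
exists s^-1 => [|X]; first by rewrite invr_gt0.
rewrite E trace_diag_quad -(frob2_unitaryl X uP) mulr_sumr.
apply: ler_sum => i _; apply: ler_wpM2r.
  by apply: sumr_ge0 => j _; rewrite exprn_ge0.
rewrite -[leRHS]invrK lef_pV2 ?posrE ?invr_gt0//.
rewrite /s (bigD1 i)//= addrCA lerDl addr_ge0//.
by apply: sumr_ge0 => j _; rewrite invr_ge0.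
Qed.

(* S is the unitary factor of the polar decomposition: S H = |H|. *)
Definition is_sign n (H S : 'M[C]_n) : Prop :=
  [/\ S^t* = S, S *m S = 1%:M, S *m H = H *m S & psdmx (S *m H)].

Lemma sign_diag n (P : 'M[C]_n) (d s : 'rV[C]_n) : P \is unitarymx ->
  (forall i, d 0 i \is Num.real) ->
  (forall i, s 0 i = if 0 <= d 0 i then 1 else -1) ->
  is_sign (P^t* *m diag_mx d *m P) (P^t* *m diag_mx s *m P).
Proof.
move=> uP dr sE.
have M (a b : 'rV[C]_n) : (P^t* *m diag_mx a *m P) *m (P^t* *m diag_mx b *m P) =
    P^t* *m (diag_mx a *m diag_mx b) *m P.
  rewrite -!mulmxA; congr (_ *m (_ *m _)); rewrite mulmxA unitary_mulmxV//.
  by rewrite mul1mx.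
split.
- apply: unitary_diag_hermitian => // i; rewrite sE; case: ifP => _.
    exact: real1.
  by rewrite realN real1.
- rewrite M mulmx_diag (_ : (\row__ _) = const_mx 1).
    by rewrite diag_const_mx mulmx1 unitary_mulVmx.
  by apply/rowP => i; rewrite !mxE sE; case: ifP => _; rewrite ?mulr1// mulrNN mulr1.
- by rewrite !M diag_mxC.
rewrite M mulmx_diag; apply/psd_diag => // i; rewrite mxE sE.
case: ifP => [|/negbT]; first by rewrite mul1r.
by rewrite -real_ltNge// mulN1r oppr_ge0 => /ltW.
Qed.

(** The eigenvalue 0 is given the sign 1, so existence needs no invertibility; in [sign_quadratic]
    the nearby matrix is only known to be hermitian. *)
Lemma sign_exists n (H : 'M[C]_n) : H^t* = H -> exists S, is_sign H S.
Proof.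
move=> hH; have [P [d [uP dr ->]]] := hermitian_diag hH.
exists (P^t* *m diag_mx (\row_i (if 0 <= d 0 i then 1 else -1)) *m P).
by apply: sign_diag => // i; rewrite mxE.
Qed.

Section SignDifference.
Variables (n : nat) (H S H' S' : 'M[C]_n) (k : C).
Hypotheses (hH : H^t* = H) (hH' : H'^t* = H').
Hypotheses (sS : is_sign H S) (sS' : is_sign H' S') (k0 : 0 < k).
Hypothesis Kk : forall X : 'M[C]_n, k * frob2 X <= \tr (X^t* *m (S *m H) *m X).

Lemma sign_mul_hermitian : (S *m H)^t* = S *m H.
Proof. by case: sS => hS _ E _; rewrite adjM hH hS E. Qed.

Lemma sign_unitary : S \is unitarymx.
Proof. by case: sS => hS E _ _; apply/unitarymxP; rewrite hS. Qed.

(* A Sylvester equation for S' - S with positive coefficients |H| and |H'|: it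
   bounds S' - S and determines it to first order. *)
Lemma sign_difference :
  (S *m H) *m (S' - S) + (S' - S) *m (S' *m H') =
  (H' - H) - S *m (H' - H) *m S'.
Proof.
case: sS => hS SS SH _; case: sS' => hS' SS' SH' _.
rewrite mulmxBr !mulmxBl mulmxBr mulmxBl.
rewrite [S' *m (S' *m H')]mulmxA SS' mul1mx.
rewrite {2}SH -[H *m S *m S]mulmxA SS mulmx1 SH'.
rewrite [S *m (H' *m S')]mulmxA.
set a := S *m H *m S'; set b := S *m H' *m S'.
by apply/matrixP => i j; rewrite !mxE; ring.
Qed.

End SignDifference.

End AdjointMatrix.

(** * Smooth matrix-valued functions and a differentiability criterion *)

Section SmoothMatrices.
Variables (R : realType) (n : nat).
Local Notation C := (R[i]).
Local Notation Mat := ('M[C]_n).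
Local Notation VV := ('M[R]_n * 'M[R]_n)%type.
Implicit Types (U : set VV) (S : set Mat).

Definition csmooth_mx p q k U (M : Mat -> 'M[C]_(p, q)) : Prop :=
  forall i j, csmooth k U (fun A => M A i j).

Definition smooth_mx p q S (M : Mat -> 'M[C]_(p, q)) : Prop :=
  forall i j, smooth_on S (fun A => M A i j).

Lemma csmooth_sum k U (I : Type) (r : seq I) (P : pred I) (F : I -> Mat -> C) :
  open U -> (forall i, P i -> csmooth k U (F i)) ->
  csmooth k U (fun A => \sum_(i <- r | P i) F i A).
Proof.
move=> oU H; elim: r => [|i r IH].
  apply: (@csmooth_eq _ _ _ _ (fun=> 0)) => // [x _|]; rewrite ?big_nil//.
  exact: csmooth_cst.
case Pi : (P i); last first.
  by apply: csmooth_eq IH => // x _; rewrite big_cons Pi.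
apply: (@csmooth_eq _ _ _ _ (fun A => F i A + \sum_(i <- r | P i) F i A)) => //.
  by move=> x _; rewrite big_cons Pi.
by apply: csmoothD => //; apply: H.
Qed.

Lemma csmooth_prod k U (I : Type) (r : seq I) (P : pred I) (F : I -> Mat -> C) :
  open U -> (forall i, P i -> csmooth k U (F i)) ->
  csmooth k U (fun A => \prod_(i <- r | P i) F i A).
Proof.
move=> oU H; elim: r => [|i r IH].
  apply: (@csmooth_eq _ _ _ _ (fun=> 1)) => // [x _|]; rewrite ?big_nil//.
  exact: csmooth_cst.
case Pi : (P i); last first.
  by apply: csmooth_eq IH => // x _; rewrite big_cons Pi.
apply: (@csmooth_eq _ _ _ _ (fun A => F i A * \prod_(i <- r | P i) F i A)) => //.
  by move=> x _; rewrite big_cons Pi.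
by apply: csmoothM => //; apply: H.
Qed.

Lemma csmooth_mx_eq k U p q (M N : Mat -> 'M[C]_(p, q)) : open U ->
  (forall x, U x -> M (cmx x) = N (cmx x)) -> csmooth_mx k U M -> csmooth_mx k U N.
Proof. by move=> oU E H i j; apply: csmooth_eq (H i j) => // x /E ->. Qed.

Lemma csmooth_mx_cst k U p q (M : 'M[C]_(p, q)) : csmooth_mx k U (fun=> M).
Proof. by move=> i j; apply: csmooth_cst. Qed.

Lemma csmooth_mulmx k U p q r (M : Mat -> 'M[C]_(p, q)) (N : Mat -> 'M[C]_(q, r)) :
  open U -> csmooth_mx k U M -> csmooth_mx k U N ->
  csmooth_mx k U (fun A => M A *m N A).
Proof.
move=> oU HM HN i j.
apply: (@csmooth_eq _ _ _ _ (fun A => \sum_l M A i l * N A l j)) => //.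
  by move=> x _; rewrite mxE.
by apply: csmooth_sum => // l _; apply: csmoothM.
Qed.

Lemma csmooth_addmx k U p q (M N : Mat -> 'M[C]_(p, q)) :
  open U -> csmooth_mx k U M -> csmooth_mx k U N ->
  csmooth_mx k U (fun A => M A + N A).
Proof.
move=> oU HM HN i j.
apply: (@csmooth_eq _ _ _ _ (fun A => M A i j + N A i j)) => //.
  by move=> x _; rewrite mxE.
exact: csmoothD.
Qed.

Lemma csmooth_scalemx k U p q a (M : Mat -> 'M[C]_(p, q)) :
  open U -> csmooth_mx k U M -> csmooth_mx k U (fun A => a *: M A).
Proof.
move=> oU HM i j.
apply: (@csmooth_eq _ _ _ _ (fun A => a * M A i j)) => //.
  by move=> x _; rewrite mxE.
by apply: csmoothM => //; apply: csmooth_cst.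
Qed.

Lemma csmooth_submx k U p q (M N : Mat -> 'M[C]_(p, q)) :
  open U -> csmooth_mx k U M -> csmooth_mx k U N ->
  csmooth_mx k U (fun A => M A - N A).
Proof.
move=> oU HM HN.
apply: (@csmooth_mx_eq _ _ _ _ (fun A => M A + (-1) *: N A)) => //.
  by move=> x _; rewrite scaleN1r.
by apply: csmooth_addmx => //; apply: csmooth_scalemx.
Qed.

Lemma csmooth_adjmx k U p q (M : Mat -> 'M[C]_(p, q)) :
  open U -> csmooth_mx k U M -> csmooth_mx k U (fun A => (M A)^t*).
Proof.
move=> oU HM i j.
apply: (@csmooth_eq _ _ _ _ (fun A => (M A j i)^*)) => //.
  by move=> x _; rewrite adjE.
exact: csmooth_conj.
Qed.

Lemma csmooth_det k U p (M : Mat -> 'M[C]_p) :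
  open U -> csmooth_mx k U M -> csmooth k U (fun A => \det (M A)).
Proof.
move=> oU HM; apply: csmooth_sum => // s _.
apply: csmoothM => //; first exact: csmooth_cst.
by apply: csmooth_prod => // i _.
Qed.

Lemma csmooth_invmx k U p (M : Mat -> 'M[C]_p) :
  open U -> (forall x, U x -> M (cmx x) \in unitmx) -> csmooth_mx k U M ->
  csmooth_mx k U (fun A => invmx (M A)).
Proof.
move=> oU uM HM i j.
apply: (@csmooth_eq _ _ _ _ (fun A => (\det (M A))^-1 * cofactor (M A) j i)) => //.
  by move=> x /uM ux; rewrite /invmx ux !mxE.
apply: csmoothM => //.
  by apply: csmoothV (csmooth_det oU HM) => // x /uM; rewrite unitmxE unitfE.
rewrite /cofactor; apply: csmoothM => //; first exact: csmooth_cst.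
apply: csmooth_det => // a b.
by apply: csmooth_eq (HM (lift j a) (lift i b)) => // x _; rewrite !mxE.
Qed.

Lemma smooth_mx_id S : smooth_mx S id.
Proof. by move=> i j; apply: smooth_on_coord. Qed.

Lemma smooth_mx_eq S p q (M N : Mat -> 'M[C]_(p, q)) :
  (forall A, S A -> M A = N A) -> smooth_mx S M -> smooth_mx S N.
Proof. by move=> E H i j; apply: smooth_on_eq (H i j) => A /E ->. Qed.

Lemma smooth_mx_cst S p q (M : 'M[C]_(p, q)) : smooth_mx S (fun=> M).
Proof. by move=> i j; apply: smooth_on_cst. Qed.

Lemma smooth_mx_sub S T p q (M : Mat -> 'M[C]_(p, q)) : S `<=` T ->
  smooth_mx T M -> smooth_mx S M.
Proof. by move=> ST H i j; apply: smooth_on_sub (H i j). Qed.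

Lemma smooth_mulmx S p q r (M : Mat -> 'M[C]_(p, q)) (N : Mat -> 'M[C]_(q, r)) :
  smooth_mx S M -> smooth_mx S N -> smooth_mx S (fun A => M A *m N A).
Proof.
move=> HM HN i j.
apply: (@smooth_on_eq _ _ _ (fun A => \sum_l M A i l * N A l j)) => [A _|].
  by rewrite mxE.
by apply: smooth_on_sum => l _; apply: smooth_onM.
Qed.

Lemma smooth_addmx S p q (M N : Mat -> 'M[C]_(p, q)) :
  smooth_mx S M -> smooth_mx S N -> smooth_mx S (fun A => M A + N A).
Proof.
move=> HM HN i j.
apply: (@smooth_on_eq _ _ _ (fun A => M A i j + N A i j)) => [A _|].
  by rewrite mxE.
exact: smooth_onD.
Qed.

Lemma smooth_scalemx S p q a (M : Mat -> 'M[C]_(p, q)) :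
  smooth_mx S M -> smooth_mx S (fun A => a *: M A).
Proof.
move=> HM i j.
apply: (@smooth_on_eq _ _ _ (fun A => a * M A i j)) => [A _|].
  by rewrite mxE.
by apply: smooth_onM => //; apply: smooth_on_cst.
Qed.

Lemma smooth_submx S p q (M N : Mat -> 'M[C]_(p, q)) :
  smooth_mx S M -> smooth_mx S N -> smooth_mx S (fun A => M A - N A).
Proof.
move=> HM HN; apply: (@smooth_mx_eq _ _ _ (fun A => M A + (-1) *: N A)) => [A _|].
  by rewrite scaleN1r.
by apply: smooth_addmx => //; apply: smooth_scalemx.
Qed.

Lemma smooth_adjmx S p q (M : Mat -> 'M[C]_(p, q)) :
  smooth_mx S M -> smooth_mx S (fun A => (M A)^t*).
Proof.
move=> HM i j; apply: (@smooth_on_eq _ _ _ (fun A => (M A j i)^*)) => [A _|].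
  by rewrite adjE.
exact: smooth_on_conj.
Qed.

Lemma smooth_det S p (M : Mat -> 'M[C]_p) :
  smooth_mx S M -> smooth_on S (fun A => \det (M A)).
Proof.
move=> HM; apply: smooth_on_sum => s _.
apply: smooth_onM; first exact: smooth_on_cst.
by apply: smooth_on_prod => i _.
Qed.

Lemma cabs_normr (z : C) : (cabs z)%:C%C = `|z|.
Proof. by []. Qed.

Lemma normr_Re (z : C) : `|complex.Re z|%R <= cabs z.
Proof.
case: z => a b; rewrite /cabs /= -sqrtr_sqr ler_sqrt ?addr_ge0 ?sqr_ge0//.
by rewrite lerDl sqr_ge0.
Qed.

Lemma normr_Im (z : C) : `|complex.Im z|%R <= cabs z.
Proof.
case: z => a b; rewrite /cabs /= -sqrtr_sqr ler_sqrt ?addr_ge0 ?sqr_ge0//.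
by rewrite lerDr sqr_ge0.
Qed.

(** [G x] is a candidate differential, linear over the reals, with quadratic remainder; f is then
    one order smoother than G. Order 0 is concluded without any smoothness of G, which lets a
    bootstrap start when G depends on f. *)
Lemma csmooth_succ U k (f : Mat -> C) (G : VV -> VV -> C) : open U ->
  (forall x, U x ->
     [/\ forall a u v, G x (a *: u + v) = a%:C%C * G x u + G x v,
         exists c, forall v, cabs (G x v) <= c * `|v| &
         exists c d, 0 < d /\ forall v, `|v| < d ->
           cabs (f (cmx (x + v)) - f (cmx x) - G x v) <= c * `|v| ^+ 2]) ->
  csmooth 0 U f /\
  ((forall v, csmooth k U (fun A => G (reim A) v)) -> csmooth k.+1 U f).
Proof.
move=> oU HG.
have ReB (a b : C) : complex.Re (a - b) = complex.Re a - complex.Re b by rewrite raddfB.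
have ImB (a b : C) : complex.Im (a - b) = complex.Im a - complex.Im b by rewrite raddfB.
have [HR HI] : (forall x, U x ->
    differentiable (fun p => complex.Re (f (cmx p)) : R^o) x /\
    'd (fun p => complex.Re (f (cmx p)) : R^o) x = (fun v => complex.Re (G x v)) :> (VV -> R^o)) /\
  (forall x, U x ->
    differentiable (fun p => complex.Im (f (cmx p)) : R^o) x /\
    'd (fun p => complex.Im (f (cmx p)) : R^o) x = (fun v => complex.Im (G x v)) :> (VV -> R^o)).
  split=> x Ux; have [lG [c Gc] [c' [d [d0 Gd]]]] := HG x Ux.
  - have lin : linear (fun v => complex.Re (G x v) : R^o).
      by move=> a u v; rewrite lG; case: (G x u) => ? ?; case: (G x v) => ? ? /=;
         rewrite mul0r subr0.
    pose L : {linear VV -> R^o} :=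
      HB.pack (fun v => complex.Re (G x v) : R^o) (GRing.isLinear.Build _ _ _ _ _ lin).
    have := @diff_quadratic _ _ (fun p => complex.Re (f (cmx p)) : R^o) x L c c' d d0.
    apply=> v /=; first by rewrite (le_trans (normr_Re _))//.
    by move=> /Gd; apply: le_trans; rewrite -!ReB; apply: normr_Re.
  have lin : linear (fun v => complex.Im (G x v) : R^o).
    by move=> a u v; rewrite lG; case: (G x u) => ? ?; case: (G x v) => ? ? /=;
       rewrite mul0r addr0.
  pose L : {linear VV -> R^o} :=
    HB.pack (fun v => complex.Im (G x v) : R^o) (GRing.isLinear.Build _ _ _ _ _ lin).
  have := @diff_quadratic _ _ (fun p => complex.Im (f (cmx p)) : R^o) x L c c' d d0.
  apply=> v /=; first by rewrite (le_trans (normr_Im _))//.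
  by move=> /Gd; apply: le_trans; rewrite -!ImB; apply: normr_Im.
split.
  by split=> x Ux; apply: differentiable_continuous; [case: (HR x Ux)|case: (HI x Ux)].
move=> CG; split; apply/CkS; split=> [x Ux|v].
- by have [] := HR x Ux.
- have [H _] := CG v; apply: Ck_eq H => // x Ux; rewrite cmxK.
  by have [df dE] := HR x Ux; rewrite deriveE// dE.
- by have [] := HI x Ux.
have [_ H] := CG v; apply: Ck_eq H => // x Ux; rewrite cmxK.
by have [df dE] := HI x Ux; rewrite deriveE// dE.
Qed.

End SmoothMatrices.

(** * The Sylvester equation K X + X K = F *)

Section Sylvester.
Variables (C : numClosedFieldType) (n : nat).
Implicit Types (K X F : 'M[C]_n).

(** The operator X |-> K X + X K on vectorized matrices. Solving the equation by inverting its
    matrix makes the solution rational in the entries of K and F, hence as smooth as they are. *)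
Definition sylv_mx K : 'M[C]_(n * n) := lin_mulmx K + lin_mulmxr K.

Definition sylv K F : 'M[C]_n := vec_mx (mxvec F *m invmx (sylv_mx K)).

Lemma mul_sylv_mx K X : mxvec X *m sylv_mx K = mxvec (K *m X + X *m K).
Proof. by rewrite mulmxDr !mul_vec_lin /= linearD. Qed.

(** Injectivity suffices, and it is [psd_sylvester] with F = 0 and K' = K. *)
Lemma sylv_mx_unit K (k : C) : 0 < k -> K^t* = K ->
  (forall X, k * frob2 X <= \tr (X^t* *m K *m X)) -> sylv_mx K \in unitmx.
Proof.
move=> k0 hK Kk; rewrite -row_free_unit; apply/inj_row_free => v.
rewrite -[v]vec_mxK mul_sylv_mx => /(congr1 vec_mx); rewrite mxvecK linear0 => E.
have pK : psdmx K by move=> X; apply: le_trans (Kk X); rewrite mulr_ge0 ?frob2_ge0// ltW.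
have := psd_sylvester k0 hK hK Kk pK E.
have -> : frob2 (0 : 'M[C]_n) = 0.
  by rewrite /frob2 big1// => i _; rewrite big1// => j _; rewrite mxE normr0 expr0n.
rewrite pmulr_rle0 ?exprn_gt0// => f0.
suff -> : vec_mx v = 0 by rewrite linear0.
apply/matrixP => i j; rewrite [RHS]mxE; apply/eqP; rewrite -normr_eq0 -sqrf_eq0.
by rewrite eq_le exprn_ge0// (le_trans (frob2_entry _ _ _) f0).
Qed.

Lemma sylvP K F : sylv_mx K \in unitmx -> K *m sylv K F + sylv K F *m K = F.
Proof.
move=> uK; apply: (can_inj mxvecK); rewrite -mul_sylv_mx vec_mxK.
by rewrite -mulmxA mulVmx// mulmx1.
Qed.

Lemma sylv_linear K a F F' : sylv K (a *: F + F') = a *: sylv K F + sylv K F'.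
Proof. by rewrite /sylv !linearP /= mulmxDl -scalemxAl linearP. Qed.

End Sylvester.

(** * Uniqueness and first-order expansion of the sign *)

Section SignSmooth.
Variables (C : numClosedFieldType) (n : nat).
Local Notation Mat := ('M[C]_n).

(** The projection onto hermitian matrices. These do not form an open set, and composing the sign
    with [herm] extends it to an open set of matrices, as smoothness on a subset demands. *)
Definition herm (A : Mat) : Mat := 2^-1 *: (A + A^t*).

Lemma herm_hermitian A : (herm A)^t* = herm A.
Proof.
rewrite /herm adjZ adjD trmxCK [A^t* + A]addrC; congr (_ *: _).
by apply/CrealP; rewrite realV realn.
Qed.

Lemma herm_id A : A^t* = A -> herm A = A.
Proof.
move=> E; rewrite /herm E; have -> : A + A = 2 *: A by rewrite scaler_nat mulr2n.
by rewrite scalerA mulVf ?scale1r// pnatr_eq0.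
Qed.

Definition signmx (H : Mat) : Mat := xget 0 [set S | is_sign H S].

Lemma signmxP H : H^t* = H -> is_sign H (signmx H).
Proof. by move=> /sign_exists[S HS]; rewrite /signmx; apply: (xgetI 0 HS). Qed.

Lemma sign_unit (H S : Mat) : is_sign H S -> H \in unitmx -> S *m H \in unitmx.
Proof.
case=> _ SS _ _ uH; rewrite unitmx_mul uH andbT.
by case/mulmx1_unit: SS.
Qed.

(** For H' = H the right-hand side of [sign_difference] vanishes, and |H| is coercive because H is
    invertible. *)
Lemma sign_unique (H S S' : Mat) : H^t* = H -> H \in unitmx ->
  is_sign H S -> is_sign H S' -> S = S'.
Proof.
move=> hH uH sS sS'.
have [k k0 Kk] := psd_coercive (sign_mul_hermitian hH sS)
  (let: And4 _ _ _ p := sS in p) (sign_unit sS uH).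
have := psd_sylvester k0 (sign_mul_hermitian hH sS) (sign_mul_hermitian hH sS') Kk
  (let: And4 _ _ _ p := sS' in p) (sign_difference sS sS').
rewrite subrr mulmx0 mul0mx subr0.
have -> : frob2 (0 : Mat) = 0.
  by rewrite /frob2 big1// => i _; rewrite big1// => j _; rewrite mxE normr0 expr0n.
rewrite pmulr_rle0 ?exprn_gt0// => f0; apply/matrixP => i j.
apply/eqP; rewrite eq_sym -subr_eq0 -normr_eq0 -sqrf_eq0 eq_le exprn_ge0// andbT.
by have := le_trans (frob2_entry _ i j) f0; rewrite !mxE.
Qed.

Lemma signmxE H S : H^t* = H -> H \in unitmx -> is_sign H S -> signmx H = S.
Proof. by move=> hH uH sS; exact: sign_unique hH uH (signmxP hH) sS. Qed.

(* The derivative of the sign: the linearization of [sign_difference]. *)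
Definition dsign (A E : Mat) : Mat :=
  let S := signmx A in sylv (S *m A) (E - S *m E *m S).

Lemma dsign_linear (H E E' : Mat) a i j :
  dsign H (a *: E + E') i j = a * dsign H E i j + dsign H E' i j.
Proof.
rewrite /dsign; set S := signmx H.
rewrite (_ : _ - _ = a *: (E - S *m E *m S) + (E' - S *m E' *m S)).
  by rewrite sylv_linear mxE [X in X + _]mxE.
by rewrite mulmxDr mulmxDl -scalemxAr -scalemxAl scalerBr opprD addrACA.
Qed.

(** Let E = H' - H, let D be the difference of the signs and X = [dsign H E]. The Sylvester
    equations for D and X give |D| = O(|E|) and |X| = O(|E|); subtracting them gives a Sylvester
    equation for D - X whose right-hand side is a sum of products of two such small terms. *)
Lemma sign_quadratic (H : Mat) : H^t* = H -> H \in unitmx ->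
  (exists2 c, 0 <= c & forall E, norm1 (dsign H E) <= c * norm1 E) /\
  exists2 c, 0 <= c & forall H', H'^t* = H' -> norm1 (H' - H) <= 1 ->
    norm1 (signmx H' - signmx H - dsign H (H' - H)) <= c * norm1 (H' - H) ^+ 2.
Proof.
move=> hH uH; have sS := signmxP hH; set S := signmx H in sS *.
have [hS SS SH psdK] := sS.
have hK := sign_mul_hermitian hH sS.
have [k k0 Kk] := psd_coercive hK psdK (sign_unit sS uH).
have uK := sylv_mx_unit k0 hK Kk.
have uS := sign_unitary sS.
have k1 : 0 <= k^-1 by rewrite invr_ge0 ltW.
(* The lower bound [k] belongs to the fixed matrix [S *m H]; [K'] is merely positive semidefinite,
   so the constants do not depend on [H']. *)
have bnd (D F K' : Mat) c : 0 <= c -> K'^t* = K' -> psdmx K' ->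
    (S *m H) *m D + D *m K' = F -> frob2 F <= c ^+ 2 ->
    norm1 D <= (n * n)%:R * (k^-1 * c).
  move=> c0 hK' pK' E Fc; apply: norm1_le_frob2; first exact: mulr_ge0.
  have := psd_sylvester k0 hK hK' Kk pK' E.
  rewrite -ler_pdivlMl ?exprn_gt0// => /le_trans; apply.
  by rewrite exprMn exprVn ler_wpM2l// invr_ge0 exprn_ge0// ltW.
have FE (E S' : Mat) : S' \is unitarymx ->
    frob2 (E - S *m E *m S') <= (2 * norm1 E) ^+ 2.
  move=> uS'; apply: le_trans (frob2B_le _ _) _.
  rewrite frob2_unitaryr// frob2_unitaryl// -mulr2n -mulrnA exprMn.
  by rewrite -natrX mulr_natl lerMn2r frob2_le_norm1.
have cn (m : nat) (c : C) : 0 <= c -> 0 <= m%:R * c by move=> ?; rewrite mulr_ge0.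
set c2 := (n * n)%:R * (k^-1 * 2).
have c20 : 0 <= c2 by rewrite cn// mulr_ge0.
have Xb (E : Mat) : norm1 (dsign H E) <= c2 * norm1 E.
  rewrite /c2 -!mulrA; apply: (bnd _ (E - S *m E *m S) (S *m H)) => //.
  - by rewrite mulr_ge0// norm1_ge0.
  - exact: sylvP.
  - exact: FE.
split; first by exists c2.
set s := norm1 S; set h := norm1 H.
have s0 : 0 <= s by exact: norm1_ge0.
have h0 : 0 <= h by exact: norm1_ge0.
(* [h + 1] bounds the norm of [H'], which lies within distance 1 of [H]; [c3] is the Lipschitz
   constant of [S *m H] at [H]. *)
set c3 := c2 * (h + 1) + s.
have c30 : 0 <= c3 by rewrite addr_ge0// mulr_ge0// addr_ge0.
set c4 := s * c2 + c2 * c3.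
have c40 : 0 <= c4 by rewrite addr_ge0// mulr_ge0.
exists ((n * n)%:R * (k^-1 * c4)) => [|H' hH' e1]; first by rewrite cn// mulr_ge0.
have sS' := signmxP hH'; set S' := signmx H' in sS' *.
set E := H' - H in e1 *; set e := norm1 E in e1 *; set D := S' - S.
have e0 : 0 <= e by exact: norm1_ge0.
set X := dsign H E.
have DE : (S *m H) *m D + D *m (S' *m H') = E - S *m E *m S'.
  exact: sign_difference.
have hK' := sign_mul_hermitian hH' sS'; have [hS' SS' SH' psdK'] := sS'.
have Db : norm1 D <= c2 * e.
  rewrite /c2 -!mulrA; apply: bnd hK' psdK' DE _; first by rewrite mulr_ge0.
  by apply: FE; exact: sign_unitary sS'.
have XE : (S *m H) *m X + X *m (S *m H) = E - S *m E *m S by exact: sylvP.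
have KK : S' *m H' - S *m H = D *m H' + S *m E.
  by rewrite mulmxBl mulmxBr addrA subrK.
have KKb : norm1 (S' *m H' - S *m H) <= c3 * e.
  rewrite KK; apply: le_trans (norm1D _ _) _; rewrite mulrDl; apply: lerD.
    apply: le_trans (norm1M _ _) _; rewrite mulrAC; apply: ler_pM => //; try exact: norm1_ge0.
    have -> : H' = H + E by rewrite addrC subrK.
    by apply: le_trans (norm1D _ _) _; rewrite lerD2l.
  exact: norm1M.
(* The equation for [X] has [S *m H] on both sides, the one for [D] has [S' *m H'] on the right; the
   mismatch is the term in [X] on the right-hand side. *)
have YE : (S *m H) *m (D - X) + (D - X) *m (S' *m H') =
    - (S *m E *m D) - X *m (S' *m H' - S *m H).
  have -> : (S *m H) *m (D - X) + (D - X) *m (S' *m H') =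
     ((S *m H) *m D + D *m (S' *m H')) - ((S *m H) *m X + X *m (S *m H))
     - X *m (S' *m H' - S *m H).
    rewrite !mulmxBr mulmxBl; apply/matrixP => i j; rewrite !mxE; ring.
  have MD (Y : Mat) : Y *m D = Y *m S' - Y *m S by rewrite mulmxBr.
  rewrite DE XE; congr (_ - _); rewrite MD.
  by apply/matrixP => i j; rewrite !mxE; ring.
rewrite -!mulrA; apply: bnd hK' psdK' YE _; first by rewrite mulr_ge0// exprn_ge0.
apply: le_trans (frob2_le_norm1 _) _.
rewrite ler_pXn2r ?nnegrE ?norm1_ge0//; last by rewrite mulr_ge0// exprn_ge0.
apply: le_trans (norm1D _ _) _; rewrite !norm1N mulrDl; apply: lerD.
  apply: le_trans (norm1M _ _) _; rewrite expr2 [leRHS](_ : _ = (s * e) * (c2 * e)); last by ring.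
  by apply: ler_pM => //; try exact: norm1_ge0; exact: norm1M.
apply: le_trans (norm1M _ _) _; rewrite expr2 [leRHS](_ : _ = (c2 * e) * (c3 * e)); last by ring.
by apply: ler_pM => //; try exact: norm1_ge0; exact: Xb.
Qed.

End SignSmooth.

(** * Smoothness of the sign on invertible hermitian matrices *)

Section SignSmoothOn.
Variables (R : realType) (n : nat).
Local Notation C := (R[i]).
Local Notation Mat := ('M[C]_n).
Local Notation VV := ('M[R]_n * 'M[R]_n)%type.

Lemma norm1_cmx (v : VV) : norm1 (cmx v) <= ((n * n)%:R * (`|v| *+ 2))%:C%C.
Proof.
have H i j : `|cmx v i j| <= (`|v| *+ 2)%:C%C.
  have co (M : 'M[R]_n) : `|M i j| <= `|M|.
    rewrite [leRHS]/Num.Def.normr /= mx_normrE.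
    exact: (le_bigmax _ (fun x : 'I_n * 'I_n => `|M x.1 x.2|) (i, j)).
  have v1 : `|v.1 i j| <= `|v| by rewrite (le_trans (co _))// prod_normE le_max lexx.
  have v2 : `|v.2 i j| <= `|v| by rewrite (le_trans (co _))// prod_normE le_max lexx orbT.
  rewrite mxE normc_def /= lecR; apply: le_trans (_ : `|v.1 i j| + `|v.2 i j| <= _).
    rewrite -[leRHS]ger0_norm ?addr_ge0// -sqrtr_sqr ler_sqrt ?sqr_ge0// sqrrD.
    by rewrite !real_normK ?num_real// addrAC lerDl mulrn_wge0// mulr_ge0.
  by rewrite mulr2n lerD.
apply: le_trans (_ : \sum_(i < n) \sum_(j < n) (`|v| *+ 2)%:C%C <= _).
  by apply: ler_sum => i _; apply: ler_sum => j _.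
by rewrite sumr_const card_ord sumr_const card_ord -mulrnA mulr_natl -rmorphMn.
Qed.

Lemma Re_ler (x y : C) : x <= y -> complex.Re x <= complex.Re y.
Proof. by rewrite lecE => /andP[]. Qed.

Lemma cabs_le_Re (z c : C) (r : R) : `|z| <= c * r%:C%C -> cabs z <= complex.Re c * r.
Proof.
move=> /Re_ler; case: c => a b /=.
by rewrite mulr0 subr0.
Qed.

Lemma cmx_linear (a : R) (u v : VV) : cmx (a *: u + v) = a%:C%C *: cmx u + cmx v.
Proof.
apply/matrixP => i j; rewrite !mxE; apply/eqP; rewrite eq_complex /=.
by rewrite !mul0r subr0 addr0 !eqxx.
Qed.

Lemma cmxD (u v : VV) : cmx (u + v) = cmx u + cmx v.
Proof. by have := cmx_linear 1 u v; rewrite !scale1r. Qed.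

Lemma herm_linear (a : R) (A B : Mat) :
  herm (a%:C%C *: A + B) = a%:C%C *: herm A + herm B.
Proof.
rewrite /herm adjD adjZ (_ : (a%:C%C)^* = a%:C%C :> C); last exact: conjc_real.
by rewrite !scalerDr !scalerA [2^-1 * _]mulrC addrACA.
Qed.

Lemma hermD (A B : Mat) : herm (A + B) = herm A + herm B.
Proof. by have := herm_linear 1 A B; rewrite !scale1r. Qed.

Lemma norm1_adj m p (A : 'M[C]_(m, p)) : norm1 (A^t*) = norm1 A.
Proof.
rewrite /norm1 exchange_big; apply: eq_bigr => i _; apply: eq_bigr => j _.
by rewrite adjE norm_conjC.
Qed.

Lemma norm1_herm (A : Mat) : norm1 (herm A) <= norm1 A.
Proof.
have -> : norm1 (herm A) = 2^-1 * norm1 (A + A^t*).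
  rewrite /norm1 mulr_sumr; apply: eq_bigr => i _; rewrite mulr_sumr.
  apply: eq_bigr => j _; rewrite mxE normrM ger0_norm//.
rewrite ler_pdivrMl// mulr_natl mulr2n; apply: le_trans (norm1D _ _) _.
by rewrite norm1_adj.
Qed.

Definition nonsing : set VV := [set p | \det (herm (cmx p)) != 0].

Lemma csmooth_herm k (U : set VV) : open U -> csmooth_mx k U (fun A : Mat => herm A).
Proof.
move=> oU; apply: csmooth_scalemx => //; apply: csmooth_addmx => //.
  by move=> i j; apply: csmooth_coord.
by apply: csmooth_adjmx => // i j; apply: csmooth_coord.
Qed.

Lemma open_nonsing : open nonsing.
Proof.
have := csmooth_open openT (csmooth_det openT (csmooth_herm 0 openT)) (@open_neq0 R).
rewrite setTI; congr open; apply/seteqP; split=> p /=; rewrite /nonsing /=.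
  by case: (\det _).
by case: (\det _).
Qed.

Lemma dsign_herm_cmx (H : Mat) (a : R) (u v : VV) i j :
  dsign H (herm (cmx (a *: u + v))) i j =
  a%:C%C * dsign H (herm (cmx u)) i j + dsign H (herm (cmx v)) i j.
Proof.
rewrite cmx_linear.
rewrite herm_linear.
exact: (dsign_linear H (herm (cmx u)) (herm (cmx v)) a%:C%C i j).
Qed.

Lemma csmooth_sylv k (U : set VV) (K F : Mat -> Mat) : open U ->
  (forall p, U p -> sylv_mx (K (cmx p)) \in unitmx) ->
  csmooth_mx k U K -> csmooth_mx k U F ->
  csmooth_mx k U (fun A => sylv (K A) (F A)).
Proof.
move=> oU uK CK CF i j.
pose G A := mxvec (F A) *m invmx (sylv_mx (K A)).
suff CG : csmooth_mx k U G.
  by apply: csmooth_eq (CG 0 (mxvec_index i j)) => // p _; rewrite [RHS]mxE.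
apply: csmooth_mulmx => //.
  move=> a b; case/mxvec_indexP: b => b c; rewrite ord1.
  by apply: csmooth_eq (CF b c) => // p _; rewrite mxvecE.
apply: csmooth_invmx => // r s; case/mxvec_indexP: s => b c.
pose X : Mat := vec_mx (delta_mx 0 r).
have CX : csmooth_mx k U (fun A => K A *m X + X *m K A).
  by apply: csmooth_addmx => //; apply: csmooth_mulmx => //; apply: csmooth_mx_cst.
apply: csmooth_eq (CX b c) => // p _.
rewrite -[LHS]mxvecE -mul_sylv_mx vec_mxK.
by rewrite -rowE mxE.
Qed.

(* Bootstrapping: [dsign H] is rational in H and its sign, hence as smooth as
   the sign. *)
Lemma csmooth_sign k : csmooth_mx k nonsing (fun A : Mat => signmx (herm A)).
Proof.
have oU := open_nonsing.
have uU p : nonsing p -> herm (cmx p) \in unitmx by rewrite unitmxE unitfE.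
have main k' i j : csmooth 0 nonsing (fun A : Mat => signmx (herm A) i j) /\
    ((forall v : VV, csmooth k' nonsing (fun A => dsign (herm (cmx (reim A))) (herm (cmx v)) i j)) ->
    csmooth k'.+1 nonsing (fun A : Mat => signmx (herm A) i j)).
  apply: (@csmooth_succ _ _ _ _ _ (fun p v => dsign (herm (cmx p)) (herm (cmx v)) i j)) => //.
    move=> x Ux; have [[c c0 Hc] [d d0 Hd]] := sign_quadratic (herm_hermitian _) (uU _ Ux).
    set N : R := (n * n)%:R * 2.
    have N0 : 0 <= N by rewrite mulr_ge0.
    have Nv (v : VV) : norm1 (herm (cmx v)) <= (N * `|v|)%:C%C.
      have H1 := norm1_herm (cmx v); have H2 := norm1_cmx v.
      have H3 := le_trans H1 H2.
      apply: (le_trans H3).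
      by rewrite lecR /N -mulrA -[`|v| *+ 2]mulr_natl.
    split.
    - by move=> a u v; exact: dsign_herm_cmx.
    - exists (complex.Re c * N) => v; rewrite -mulrA; apply: cabs_le_Re.
      apply: le_trans (norm1_entry _ _ _) _; apply: le_trans (Hc _) _.
      by apply: ler_wpM2l.
    (* [N] times the norm of [v] bounds [norm1 (herm (cmx v))], so this radius keeps the increment
       within distance 1, the range of [sign_quadratic]; the [+ 1] keeps it positive when n = 0. *)
    exists (complex.Re d * N ^+ 2), (N + 1)^-1; split; first by rewrite invr_gt0 ltr_wpDl.
    move=> v vd; rewrite -mulrA -exprMn; apply: cabs_le_Re.
    have E : herm (cmx (x + v)) - herm (cmx x) = herm (cmx v).
      by rewrite cmxD hermD addrC addKr.
    have := Hd (herm (cmx (x + v))) (herm_hermitian _); rewrite E => H.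
    apply: le_trans (_ : norm1 (signmx (herm (cmx (x + v))) - signmx (herm (cmx x)) -
       dsign (herm (cmx x)) (herm (cmx v))) <= _).
      by apply: le_trans (norm1_entry _ i j); rewrite !mxE.
    apply: le_trans (H _) _.
      apply: le_trans (Nv v) _; rewrite lecR.
      have : N * `|v| <= (N + 1) * (N + 1)^-1.
        by apply: ler_pM => //; [rewrite lerDl|exact: ltW].
      by rewrite mulfV// gt_eqF// ltr_wpDl.
    apply: ler_wpM2l => //; rewrite rmorphXn /= ler_pXn2r ?nnegrE ?norm1_ge0//.
    by rewrite lecR mulr_ge0.
elim: k => [|k IH] i j; first by have [] := main 0 i j.
have [_] := main k i j; apply=> v; under eq_fun do rewrite reimK.
move: i j; rewrite -/(csmooth_mx k nonsing (fun A : Mat => dsign (herm A) (herm (cmx v)))).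
rewrite /dsign.
have CH : csmooth_mx k nonsing (fun A : Mat => herm A) by exact: csmooth_herm.
have Cv : csmooth_mx k nonsing (fun _ : Mat => herm (cmx v)) by exact: csmooth_mx_cst.
apply: csmooth_sylv => //.
- move=> p Up; have hH := herm_hermitian (cmx p); have sS := signmxP hH.
  have hK := sign_mul_hermitian hH sS; have [_ _ _ psdK] := sS.
  have [k0 k00 Kk] := psd_coercive hK psdK (sign_unit sS (uU _ Up)).
  exact: sylv_mx_unit k00 hK Kk.
- exact: (@csmooth_mulmx _ _ _ _ _ _ _ (fun A => signmx (herm A)) (fun A => herm A) oU IH CH).
have CSE := @csmooth_mulmx _ _ _ _ _ _ _ (fun A => signmx (herm A)) (fun=> herm (cmx v)) oU IH Cv.
have CSES := csmooth_mulmx oU CSE IH.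
exact: (csmooth_submx oU Cv CSES).
Qed.

Lemma smooth_signmx :
  smooth_mx [set H : Mat | H^t* = H /\ H \in unitmx] (fun H => signmx H).
Proof.
move=> i j; apply/smooth_onP => A [hA uA].
exists nonsing, (fun A => signmx (herm A) i j); split.
- exact: open_nonsing.
- by rewrite /nonsing /= reimK herm_id// -unitfE -unitmxE.
- by move=> k; apply: csmooth_sign.
by move=> B [hB _] _; rewrite herm_id.
Qed.

End SignSmoothOn.

(** * The exterior algebra *)

Section Exterior.
Variables (R : realType) (n : nat).
Local Notation C := (R[i]).
Local Open Scope set_scope.
Local Notation vec := {ffun 'I_n -> C^o}.
Local Notation ext := {ffun {set 'I_n} -> C^o}.
Implicit Types (v w : vec) (x y z : ext) (S T U : {set 'I_n}) (k l : 'I_n).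
Implicit Types (s t : seq vec).

Definition inversions S T : nat :=
  #|[set z : 'I_n * 'I_n | [&& z.1 \in S, z.2 \in T & (z.2 < z.1)%N]]|.

Lemma inversionsE S T : inversions S T = (\sum_(a in S) \sum_(b in T) (b < a))%N.
Proof.
rewrite pair_big_dep /= /inversions -sum1dep_card big_mkcond [RHS]big_mkcond /=.
apply: eq_bigr => -[a b] _ /=.
by case: (a \in S); case: (b \in T); case: ltnP.
Qed.

Lemma big_setD_split (F : 'I_n -> nat) U T : U \subset T ->
  (\sum_(a in T) F a)%N = (\sum_(a in U) F a + \sum_(a in T :\: U) F a)%N.
Proof.
move=> /finset.setIidPr E; rewrite (bigID (mem U)) /=; congr (_ + _)%N; apply: eq_bigl => a.
  by rewrite -[in RHS]E inE.
by rewrite !inE andbC.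
Qed.

(** [shuffle_sign] counts a classical set of pairs; [inversions] counts a finite one, to which the
    lemmas on big operators apply. *)
Lemma shuffle_signE S T : @shuffle_sign R n S T = (-1) ^+ inversions S T.
Proof.
rewrite /shuffle_sign /inversions; congr (_ ^+ _); apply: eq_card => z.
by rewrite [in RHS]inE; apply/idP/idP => [/set_mem|zS]; [|exact: mem_set].
Qed.

Lemma shuffle_signDl U T V : U \subset T -> @shuffle_sign R n T V =
  shuffle_sign R U V * shuffle_sign R (T :\: U) V.
Proof.
move=> UT; rewrite !shuffle_signE -exprD; congr (_ ^+ _).
by rewrite !inversionsE (big_setD_split _ UT).
Qed.

Lemma shuffle_signDr U T V : U \subset T -> @shuffle_sign R n V T =
  shuffle_sign R V U * shuffle_sign R V (T :\: U).
Proof.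
move=> UT; rewrite !shuffle_signE -exprD; congr (_ ^+ _).
rewrite !inversionsE -big_split.
by apply: eq_bigr => a _; rewrite (big_setD_split _ UT).
Qed.

(** Both sides are sums over ordered partitions of S into three sets, matched by T = U :|: V. Their
    signs agree because the number of inversions is additive in each argument. *)
Lemma wedgeA x y z : wedge (wedge x y) z = wedge x (wedge y z).
Proof.
apply/ffunP => S; rewrite !ffunE.
transitivity (\sum_(T : {set 'I_n} | T \subset S) \sum_(U : {set 'I_n} | U \subset T)
   shuffle_sign R T (S :\: T) * shuffle_sign R U (T :\: U) *
   x U * y (T :\: U) * z (S :\: T)).
  apply: eq_bigr => T _; rewrite ffunE mulr_sumr mulr_suml.
  by apply: eq_bigr => U _; ring.
rewrite (exchange_big_dep (fun U => U \subset S)) /=; last first.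
  by move=> T U TS UT; apply: fintype.subset_trans TS.
apply: eq_bigr => U US; rewrite ffunE mulr_sumr.
rewrite (reindex_onto (fun V => U :|: V) (fun T => T :\: U)) /=; last first.
  move=> T /andP[_ UT]; apply/setP => a; rewrite !inE; case aU: (a \in U) => //=.
  by rewrite (fintype.subsetP UT).
apply: eq_big => [V|V].
  apply/idP/idP.
    case/andP => /andP[VS _] /eqP E; rewrite -E; apply/fintype.subsetP => a.
    by rewrite !inE => /andP[-> /= H]; apply: (fintype.subsetP VS); rewrite inE.
  move=> VS; rewrite finset.subUset US finset.subsetUl (fintype.subset_trans VS) ?finset.subsetDl//=.
  apply/eqP/setP => a; rewrite !inE; case aU: (a \in U) => //=.
  by apply/esym/negP => /(fintype.subsetP VS); rewrite inE aU.
case/andP => /andP[VS _] /eqP E; rewrite E.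
have ES : S :\: (U :|: V) = S :\: U :\: V by rewrite finset.setDDl.
have UT : U \subset U :|: V by exact: finset.subsetUl.
have TS : V \subset S :\: U.
  rewrite -E; apply/fintype.subsetP => a; rewrite !inE => /andP[-> /= H].
  by apply: (fintype.subsetP VS); rewrite inE.
rewrite (shuffle_signDl _ UT) (shuffle_signDr U TS) E ES; ring.
Qed.

Lemma wedge1x x : wedge (@ext1 R n) x = x.
Proof.
apply/ffunP => S; rewrite ffunE (bigD1 finset.set0) ?finset.sub0set//= [X in _ + X]big1 ?addr0.
  rewrite ffunE eqxx finset.setD0 mulr1 shuffle_signE inversionsE.
  by rewrite big1 ?mul1r// => a; rewrite inE.
by move=> T /andP[_ T0]; rewrite ffunE (negbTE T0) mulr0 mul0r.
Qed.

Lemma wedge_linearl a x y z : wedge (a *: x + y) z = a *: wedge x z + wedge y z.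
Proof.
apply/ffunP => S; rewrite !ffunE scaler_sumr -big_split /=.
by apply: eq_bigr => T _; rewrite !ffunE /GRing.scale /=; ring.
Qed.

Lemma wedge_linearr a x y z : wedge z (a *: x + y) = a *: wedge z x + wedge z y.
Proof.
apply/ffunP => S; rewrite !ffunE scaler_sumr -big_split /=.
by apply: eq_bigr => T _; rewrite !ffunE /GRing.scale /=; ring.
Qed.

Lemma wedge0x x : wedge 0 x = 0.
Proof.
by apply/ffunP => S; rewrite !ffunE big1// => T _; rewrite !ffunE mulr0 mul0r.
Qed.

Lemma wedgex0 x : wedge x 0 = 0.
Proof. by apply/ffunP => S; rewrite !ffunE big1// => T _; rewrite !ffunE mulr0. Qed.

Lemma wedgeZl a x z : wedge (a *: x) z = a *: wedge x z.
Proof. by have := wedge_linearl a x 0 z; rewrite wedge0x !addr0. Qed.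

Lemma wedgeDr x y z : wedge z (x + y) = wedge z x + wedge z y.
Proof. by have := wedge_linearr 1 x y z; rewrite !scale1r. Qed.

Lemma wedgeZr a x z : wedge z (a *: x) = a *: wedge z x.
Proof. by have := wedge_linearr a x 0 z; rewrite wedgex0 !addr0. Qed.

Lemma wedgeNr x z : wedge z (- x) = - wedge z x.
Proof. by rewrite -scaleN1r wedgeZr scaleN1r. Qed.

Lemma ext_vec_linear a v w : ext_vec (a *: v + w) = a *: ext_vec v + ext_vec w.
Proof.
apply/ffunP => S; rewrite !ffunE scaler_sumr -big_split /=.
by apply: eq_bigr => k _; rewrite !ffunE.
Qed.

(** The sign of moving e_k from the front of a product to its place among the factors indexed by S;
    whether k itself belongs to S does not matter. *)
Definition below_sign k S : C := (-1) ^+ #|[set z in S | (z < k)%N]|.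

Lemma wedge_vecE v x S :
  wedge (ext_vec v) x S = \sum_(k in S) below_sign k S * v k * x (S :\ k).
Proof.
rewrite ffunE; transitivity (\sum_(T : {set 'I_n} | T \subset S) \sum_(k | T == [set k])
   shuffle_sign R T (S :\: T) * v k * x (S :\: T)).
  by apply: eq_bigr => T _; rewrite ffunE mulr_sumr mulr_suml.
rewrite (exchange_big_dep predT) //= [RHS]big_mkcond /=; apply: eq_bigr => k _.
case: ifP => kS; last first.
  rewrite big1// => T /andP[TS /eqP E]; move: TS; rewrite E finset.sub1set.
  by rewrite kS.
rewrite (big_pred1 [set k]) => [|T]; last first.
  by rewrite /= andbC; case: (eqVneq T [set k]) => //= ->; rewrite finset.sub1set kS.
congr (_ * _ * _); rewrite shuffle_signE inversionsE /below_sign big_set1.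
congr (_ ^+ _); rewrite -sum1dep_card [LHS]big_mkcond [RHS]big_mkcond /=.
apply: eq_bigr => b _; rewrite !inE; case: (eqVneq b k) => [->|_] /=.
  by rewrite ltnn andbF.
by case: (b \in S); case: ltnP.
Qed.

Definition vdot v w : C := \sum_k (v k)^* * w k.

Definition edot x y : C := \sum_S (x S)^* * y S.

(** The interior product with v, antilinear in v: the adjoint of left exterior multiplication by v
    ([edot_wedge]). *)
Definition contract v x : ext :=
  [ffun S : {set 'I_n} => \sum_(k | k \notin S) below_sign k S * (v k)^* * x (k |: S)].

Lemma below_signD1 k l S : l \in S -> l != k ->
  below_sign k S = (-1) ^+ (l < k)%N * below_sign k (S :\ l).
Proof.
move=> lS lk; rewrite /below_sign -exprD; congr (_ ^+ _).
rewrite (cardsD1 l) inE lS /=; congr (_ + _)%N; apply: eq_card => z.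
by rewrite !inE; case: eqP => //= ->.
Qed.

Lemma below_sign_id k S : below_sign k (S :\ k) = below_sign k S.
Proof.
rewrite /below_sign; congr (_ ^+ _); apply: eq_card => z.
by rewrite !inE; case: eqP => //= ->; rewrite ltnn andbF.
Qed.

Lemma below_sign_idU k S : below_sign k (k |: S) = below_sign k S.
Proof.
rewrite /below_sign; congr (_ ^+ _); apply: eq_card => z.
by rewrite !inE; case: eqP => //= ->; rewrite ltnn !andbF.
Qed.

Lemma sign_ltn_gtn k l : k != l ->
  (-1) ^+ (l < k)%N * (-1) ^+ (k < l)%N = -1 :> C.
Proof.
by rewrite -val_eqE neq_ltn => /orP[] kl;
   rewrite kl ltnNge (ltnW kl) expr0 expr1 ?mulr1 ?mul1r.
Qed.

Lemma below_sign_exchangeU k l S : l \in S -> k \notin S ->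
  below_sign k S * below_sign l (k |: S) =
  - (below_sign l S * below_sign k (S :\ l)).
Proof.
move=> lS kS; have kl : k != l by apply: contraNneq kS => ->.
rewrite (below_signD1 lS) 1?eq_sym//.
rewrite (@below_signD1 l k (k |: S)) ?finset.setU11// finset.setU1K//.
transitivity ((-1) ^+ (l < k)%N * (-1) ^+ (k < l)%N *
   (below_sign l S * below_sign k (S :\ l))); first by ring.
by rewrite sign_ltn_gtn// mulN1r.
Qed.

Lemma below_sign_exchangeD k l S : l \in S -> k \in S -> k != l ->
  below_sign k S * below_sign l (S :\ k) =
  - (below_sign l S * below_sign k (S :\ l)).
Proof.
move=> lS kS kl; rewrite (below_signD1 lS) 1?eq_sym//.
rewrite [below_sign l S](below_signD1 kS)//.
have E := sign_ltn_gtn kl.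
transitivity ((-1) ^+ (l < k)%N * (((-1) ^+ (k < l)%N * (-1) ^+ (k < l)%N)) *
   (below_sign l (S :\ k) * below_sign k (S :\ l))).
  by rewrite -signr_addb addbb expr0; ring.
by rewrite mulrA E; ring.
Qed.

Lemma wedge_vecC v w x :
  wedge (ext_vec v) (wedge (ext_vec w) x) = - wedge (ext_vec w) (wedge (ext_vec v) x).
Proof.
apply/ffunP => S; rewrite [RHS]ffunE !wedge_vecE.
pose F k l := below_sign k S * below_sign l (S :\ k) * v k * w l * x (S :\ k :\ l).
transitivity (\sum_(k in S) \sum_(l in S | l != k) F k l).
  apply: eq_bigr => k kS; rewrite wedge_vecE mulr_sumr; apply: eq_big => [l|l _].
    by rewrite !inE andbC.
  by rewrite /F; ring.
rewrite (exchange_big_dep (mem S)) /=; last by move=> k l _ /andP[].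
rewrite -sumrN; apply: eq_bigr => l lS; rewrite wedge_vecE mulr_sumr -sumrN.
apply: eq_big => [k|k /and3P[kS _ lk]]; first by rewrite !inE lS eq_sym andbC.
rewrite /F below_sign_exchangeD//; last by rewrite eq_sym.
have -> : S :\ k :\ l = S :\ l :\ k by rewrite finset.setDDl finset.setUC -finset.setDDl.
by ring.
Qed.

(** The Clifford relation between interior and exterior multiplication. The diagonal terms k = l
    with k outside S come from the left side, those with k in S from the product on the right, and
    together they form the inner product; the other terms cancel by [below_sign_exchangeU]. *)
Lemma contract_wedge v w x :
  contract v (wedge (ext_vec w) x) = vdot v w *: x - wedge (ext_vec w) (contract v x).
Proof.
apply/ffunP => S; rewrite ffunE [RHS]ffunE [X in _ + X]ffunE [X in X + _]ffunE wedge_vecE.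
pose F k l := below_sign k S * below_sign l (k |: S) * (v k)^* * w l * x (k |: S :\ l).
have -> : \sum_(k | k \notin S) below_sign k S * (v k)^* * wedge (ext_vec w) x (k |: S) =
    \sum_(k | k \notin S) (v k)^* * w k * x S + \sum_(k | k \notin S) \sum_(l in S) F k l.
  rewrite -big_split; apply: eq_bigr => k kS /=; rewrite wedge_vecE mulr_sumr.
  rewrite (bigD1 k) ?finset.setU11//=; congr (_ + _).
    rewrite finset.setU1K// below_sign_idU /below_sign; set m := #|_|.
    transitivity ((-1) ^+ m * (-1) ^+ m * ((v k)^* * w k * x S)); first by ring.
    by rewrite -exprD addnn -mul2n exprM sqrrN !expr1n mul1r.
  apply: eq_big => [l|l /andP[]].
    by rewrite !inE; case: (eqVneq l k) => [->|_] /=; rewrite ?andbF ?(negbTE kS) ?andbT.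
  rewrite !inE => /orP[/eqP->|lS lk]; first by rewrite eqxx.
  have -> : (k |: S) :\ l = k |: S :\ l.
    by apply/setP => a; rewrite !inE; case: (eqVneq a k) => //= ->; rewrite eq_sym lk.
  by rewrite /F; ring.
have -> : \sum_(l in S) below_sign l S * w l * contract v x (S :\ l) =
    \sum_(l in S) (v l)^* * w l * x S - \sum_(l in S) \sum_(k | k \notin S) F k l.
  rewrite -sumrN -big_split; apply: eq_bigr => l lS /=; rewrite ffunE mulr_sumr.
  rewrite (bigD1 l) ?finset.setD11//=; congr (_ + _).
    rewrite finset.setD1K// below_sign_id /below_sign; set m := #|_|.
    transitivity ((-1) ^+ m * (-1) ^+ m * ((v l)^* * w l * x S)); first by ring.
    by rewrite -exprD addnn -mul2n exprM sqrrN !expr1n mul1r.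
  rewrite -sumrN; apply: eq_big => [k|k /andP[]].
    by rewrite !inE; case: (eqVneq k l) => [->|_] /=; rewrite ?andbF ?lS ?andbT.
  move=> kS' kl; have kS : k \notin S by move: kS'; rewrite !inE kl.
  by rewrite /F below_sign_exchangeU//; ring.
rewrite /GRing.scale /= /vdot mulr_suml [in RHS](bigID (mem S)) /=.
rewrite opprD opprK [X in _ = _ + (- X + _)](_ : _ = \sum_(l in S) (v l)^* * w l * x S)//.
rewrite [X in _ = _ + (_ + X)]exchange_big /=.
by rewrite addrACA subrr add0r.
Qed.

(** After exchanging sums, the sets containing k are reindexed by removing k from them. *)
Lemma edot_wedge v x y : edot (wedge (ext_vec v) x) y = edot x (contract v y).
Proof.
rewrite /edot.
transitivity (\sum_k \sum_(S : {set 'I_n} | k \in S)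
   below_sign k S * (v k)^* * (x (S :\ k))^* * y S).
  rewrite (exchange_big_dep predT) //=; apply: eq_bigr => S _.
  rewrite wedge_vecE rmorph_sum mulr_suml; apply: eq_bigr => k _.
  by rewrite !rmorphM /below_sign rmorphXn rmorphN1.
transitivity (\sum_k \sum_(S : {set 'I_n} | k \notin S)
   below_sign k S * (v k)^* * (x S)^* * y (k |: S)).
  apply: eq_bigr => k _.
  rewrite (reindex_onto (fun S => k |: S) (fun S => S :\ k)) /=; last first.
    by move=> S kS; rewrite finset.setD1K.
  apply: eq_big => [S|S].
    rewrite finset.setU11 /=; case kS: (k \in S); last by rewrite finset.setU1K ?kS ?eqxx.
    by apply/negbTE/eqP => /setP/(_ k); rewrite !inE eqxx kS.
  by rewrite finset.setU11 /= => /eqP E; rewrite E below_sign_idU.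
rewrite (exchange_big_dep predT) //=; apply: eq_bigr => S _.
rewrite ffunE mulr_sumr; apply: eq_bigr => k _; by ring.
Qed.

Lemma edot_linearr a x y z : edot x (a *: y + z) = a * edot x y + edot x z.
Proof.
rewrite /edot mulr_sumr -big_split; apply: eq_bigr => S _ /=.
by rewrite !ffunE /GRing.scale /=; ring.
Qed.

Lemma edotDr x y z : edot x (y + z) = edot x y + edot x z.
Proof. by have := edot_linearr 1 x y z; rewrite scale1r mul1r. Qed.

Lemma edot0r x : edot x 0 = 0.
Proof. by rewrite /edot big1// => S _; rewrite ffunE mulr0. Qed.

Lemma edotZr a x y : edot x (a *: y) = a * edot x y.
Proof. by have := edot_linearr a x y 0; rewrite edot0r !addr0. Qed.

Lemma edotNr x y : edot x (- y) = - edot x y.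
Proof. by rewrite -scaleN1r edotZr mulN1r. Qed.

Lemma edotC x y : edot x y = (edot y x)^*.
Proof.
rewrite /edot rmorph_sum; apply: eq_bigr => S _.
by rewrite rmorphM /= conjCK mulrC.
Qed.

Lemma edotE x : edot x x = \sum_S `|x S| ^+ 2.
Proof. by apply: eq_bigr => S _; rewrite normCK mulrC. Qed.

Lemma edot_eq0 x : (edot x x == 0) = (x == 0).
Proof.
rewrite edotE psumr_eq0 => [|S _]; last by rewrite exprn_ge0.
apply/allP/eqP => [H|-> S _]; last by rewrite /= ffunE normr0 expr0n.
apply/ffunP => S; rewrite ffunE; apply/eqP; rewrite -normr_eq0 -sqrf_eq0.
by apply: H; rewrite mem_index_enum.
Qed.

Lemma edot_ext1 : edot (@ext1 R n) (@ext1 R n) = 1.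
Proof.
rewrite /edot (bigD1 finset.set0)//= [X in _ + X]big1 ?addr0 => [|S S0].
  by rewrite ffunE eqxx mulr1 rmorph1.
by rewrite ffunE (negbTE S0) mulr0.
Qed.

Lemma contract_ext1 v : contract v (@ext1 R n) = 0.
Proof.
apply/ffunP => S; rewrite !ffunE big1// => k _; rewrite ffunE.
rewrite (_ : _ == _ = false) ?mulr0//; apply/negbTE/eqP => /setP/(_ k).
by rewrite !inE eqxx.
Qed.

Lemma contract_wedge_seq0 v s : (forall w, w \in s -> vdot v w = 0) ->
  contract v (wedge_seq s) = 0.
Proof.
elim: s => [|w s IH] H; first exact: contract_ext1.
rewrite /wedge_seq /= -/(wedge_seq s) contract_wedge H ?mem_head// scale0r sub0r.
by rewrite IH ?wedgex0 ?oppr0// => u us; apply: H; rewrite in_cons us orbT.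
Qed.

Lemma edot_wedge_orthonormal (I : eqType) (r : seq I) (f : I -> vec) : uniq r ->
  {in r &, forall i j, vdot (f i) (f j) = (i == j)%:R} ->
  edot (wedge_seq (map f r)) (wedge_seq (map f r)) = 1.
Proof.
elim: r => [|i r IH] /=; first by rewrite edot_ext1.
case/andP => ir ur H; rewrite {1}/wedge_seq /= edot_wedge.
rewrite /wedge_seq /= -/(wedge_seq _) contract_wedge H ?mem_head// eqxx scale1r.
rewrite contract_wedge_seq0 ?wedgex0 ?subr0 ?IH//.
  by move=> a b ar br; apply: H; rewrite in_cons ?ar ?br orbT.
move=> w /mapP[j jr ->]; rewrite H ?mem_head ?in_cons ?jr ?orbT//.
by case: eqP => // E; rewrite E jr in ir.
Qed.

(* The inner product of two decomposable elements depends only on the inner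
   products of the factors: expand by contracting the factors one by one. *)
Lemma edot_wedge_gram (I J : eqType) (q : seq I) (r : seq J)
    (g g' : I -> vec) (f f' : J -> vec) :
  {in q & r, forall i j, vdot (g i) (f j) = vdot (g' i) (f' j)} ->
  edot (wedge_seq (map g q)) (wedge_seq (map f r)) =
  edot (wedge_seq (map g' q)) (wedge_seq (map f' r)).
Proof.
elim: q r => [|i q IH] r H.
  case: r H => [|j r] H //=; rewrite /wedge_seq /= -!/(wedge_seq _).
  have Z (k : vec) y : edot (@ext1 R n) (wedge (ext_vec k) y) = 0.
    by rewrite edotC edot_wedge contract_ext1 edot0r rmorph0.
  by rewrite !Z.
rewrite {1 3}/wedge_seq /= -!/(wedge_seq _) !edot_wedge.
(* Generalization for the induction on [r']: the contraction has already passed the factors indexed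
   by [p] and still acts on those of [r']. *)
suff K p : {subset p <= r} -> forall r', {subset r' <= r} ->
    edot (wedge_seq (map g q)) (foldr (fun j y => wedge (ext_vec (f j)) y)
      (contract (g i) (wedge_seq (map f r'))) p) =
    edot (wedge_seq (map g' q)) (foldr (fun j y => wedge (ext_vec (f' j)) y)
      (contract (g' i) (wedge_seq (map f' r'))) p).
  by apply: (K [::]).
move=> pr r'; elim: r' p pr => [|j r' IHr] p pr r'r.
  rewrite /= !contract_ext1.
  have Z (h : J -> vec) : foldr (fun j y => wedge (ext_vec (h j)) y) 0 p = 0.
    by elim: p {pr} => //= ? ? ->; rewrite wedgex0.
  by rewrite !Z !edot0r.
have jr : j \in r by apply: r'r; rewrite mem_head.
have E (h : J -> vec) (u : vec) :
    foldr (fun j y => wedge (ext_vec (h j)) y) (contract u (wedge_seq (map h (j :: r')))) p =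
    vdot u (h j) *: wedge_seq (map h (p ++ r')) -
    foldr (fun j y => wedge (ext_vec (h j)) y) (contract u (wedge_seq (map h r'))) (rcons p j).
  rewrite {1}/wedge_seq /= -/(wedge_seq _) contract_wedge.
  elim: p {pr} => [|a p IHp] //=.
  by rewrite IHp wedgeDr wedgeZr wedgeNr.
rewrite !E !edotDr !edotZr !edotNr H ?mem_head//; congr (_ * _ - _).
  apply: IH => a b aq; rewrite mem_cat => /orP[bp|br'].
    by apply: H; [rewrite in_cons aq orbT|exact: pr].
  by apply: H; [rewrite in_cons aq orbT|apply: r'r; rewrite in_cons br' orbT].
apply: IHr => a.
  by rewrite mem_rcons in_cons => /orP[/eqP->//|]; exact: pr.
by move=> ar; apply: r'r; rewrite in_cons ar orbT.
Qed.

Lemma wedge_seq_cat s t : wedge_seq (s ++ t) = wedge (wedge_seq s) (wedge_seq t).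
Proof.
elim: s => [|v s IH] /=; first by rewrite wedge1x.
by rewrite {1}/wedge_seq /= -/(wedge_seq _) IH -wedgeA.
Qed.

Lemma wedge_seq_linear a v w s t :
  wedge_seq (s ++ (a *: v + w) :: t) =
  a *: wedge_seq (s ++ v :: t) + wedge_seq (s ++ w :: t).
Proof.
rewrite !wedge_seq_cat /wedge_seq /= -!/(wedge_seq _) ext_vec_linear.
by rewrite wedge_linearl wedge_linearr.
Qed.

Lemma wedge_seq_move v s t :
  wedge_seq (s ++ v :: t) = (-1) ^+ size s *: wedge_seq (v :: s ++ t).
Proof.
elim: s => [|w s IH] /=; first by rewrite expr0 scale1r.
rewrite {1}/wedge_seq /= -/(wedge_seq _) IH wedgeZr /wedge_seq /= -!/(wedge_seq _).
by rewrite wedge_vecC scalerN -scaleNr exprS mulN1r.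
Qed.

(** Two equal factors are brought together at the front; by anticommutativity their product equals
    its own negative. *)
Lemma wedge_seq_dup s : ~~ uniq s -> wedge_seq s = 0.
Proof.
elim: s => //= v s IH; rewrite negb_and negbK => /orP[|/IH E]; last first.
  by rewrite /wedge_seq /= -/(wedge_seq _) E wedgex0.
case/splitPr => s1 s2; rewrite /wedge_seq /= -/(wedge_seq _) wedge_seq_move wedgeZr.
rewrite /wedge_seq /= -/(wedge_seq _).
set x := wedge_seq _; suff -> : wedge (ext_vec v) (wedge (ext_vec v) x) = 0 by rewrite scaler0.
have /eqP := wedge_vecC v v x; rewrite -addr_eq0 => /eqP /ffunP H.
apply/ffunP => S; have /eqP := H S; rewrite !ffunE -mulr2n -mulr_natl mulf_eq0.
by rewrite pnatr_eq0 /= => /eqP.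
Qed.

Lemma wedge_seq_perm s t : perm_eq s t -> exists a, wedge_seq s = a *: wedge_seq t.
Proof.
elim: t s => [|v t IH] s; first by move=> /perm_nilP ->; exists 1; rewrite scale1r.
move=> st; have : v \in s by rewrite (perm_mem st) mem_head.
case/splitPr E : s / => [s1 s2]; rewrite wedge_seq_move.
have : perm_eq (s1 ++ s2) t.
  rewrite -(perm_cons v); apply: perm_trans st; rewrite E perm_sym.
  by apply/permPl; exact: (perm_catCA s1 [:: v] s2).
case/IH => a Ea; exists ((-1) ^+ size s1 * a).
by rewrite /wedge_seq /= -!/(wedge_seq _) Ea wedgeZr scalerA.
Qed.

(** Multilinearity: every factor is expanded over the generators [xs], so products of generators
    decide membership. *)
Lemma wedge_seq_span (xs us : seq vec) (W : {vspace ext}) :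
  (forall u, u \in us -> u \in <<xs>>%VS) ->
  (forall t, size t = size us -> {subset t <= xs} -> wedge_seq t \in W) ->
  wedge_seq us \in W.
Proof.
move=> H HW; rewrite -[us]cat0s.
have : forall t, size t = size us -> {subset t <= xs} -> wedge_seq ([::] ++ t) \in W by [].
(* The prefix [p] collects the factors already replaced by generators. *)
elim: us [::] H {HW} => [|u us IH] p H HW; first by apply: HW.
have := H u (mem_head _ _); rewrite -[xs]in_tupleE => /coord_span ->.
elim/big_rec: _ => [|i y _ Hy].
  have := wedge_seq_linear (-1) 0 0 p us; rewrite scaler0 addr0 scaleN1r addNr => ->.
  exact: mem0v.
rewrite wedge_seq_linear; apply: rpredD => //; apply: rpredZ.
rewrite -cat_rcons; apply: IH => [w wu|t st tx].
  by apply: H; rewrite in_cons wu orbT.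
rewrite cat_rcons; apply: HW => /=; first by rewrite st.
move=> w; rewrite in_cons => /orP[/eqP->|/tx//].
by rewrite mem_nth// -[xs in size xs]in_tupleE size_tuple.
Qed.

(** A product of as many generators as [xs] contains either repeats one, and vanishes, or is a
    permutation of [xs], and is a multiple of the product of [xs]: a top exterior power is at most a
    line. *)
Lemma wedge_seq_line (xs us : seq vec) : (forall u, u \in us -> u \in <<xs>>%VS) ->
  size us = size xs -> wedge_seq us \in <[wedge_seq xs]>%VS.
Proof.
move=> H E; apply: (wedge_seq_span H) => t st tx.
case ut: (uniq t); last by rewrite wedge_seq_dup ?ut ?mem0v.
have xt : (size xs <= size t)%N by rewrite st E.
have [_ tX] := uniq_min_size ut tx xt.
have ux := leq_size_uniq ut tx xt.
have [a ->] := wedge_seq_perm (uniq_perm ut ux tX).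
by rewrite memvZ ?memv_line.
Qed.

End Exterior.

(** * The alcove and the spectral projections *)

Section Alcove.
Variables (R : realType) (n : nat).
Implicit Types (lam : 'rV[R]_n) (i j k l : 'I_n).

Lemma alcove_le lam k l : alcove lam -> (k <= l)%N -> lam 0 l <= lam 0 k.
Proof.
case=> _ H; move: k; case: l => l; elim: l => [|l IH] ln k; rewrite /= leq_eqVlt.
  by rewrite ltn0 orbF => /eqP E; rewrite le_eqVlt; apply/orP; left; apply/eqP;
     congr (lam 0 _); apply: val_inj.
case/orP => [/eqP E|kl].
  by rewrite le_eqVlt; apply/orP; left; apply/eqP; congr (lam 0 _); apply: val_inj.
have ln' : (l < n)%N by apply: ltn_trans ln.
apply: le_trans (IH ln' k _) => //; have := H (Ordinal ln').
rewrite /lam_next /= ltn_eqF// subr0 (_ : ordS _ = Ordinal ln)//.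
by apply: val_inj; rewrite /= modn_small.
Qed.

Lemma alcove_width lam k l : alcove lam -> lam 0 k - 1 <= lam 0 l.
Proof.
move=> al; have n0 : (0 < n)%N by apply: leq_ltn_trans (ltn_ord k).
pose z := Ordinal n0; have ln : (n.-1 < n)%N by rewrite prednK.
apply: le_trans (_ : lam 0 z - 1 <= _); first by rewrite lerD2r alcove_le.
apply: le_trans (_ : lam 0 (Ordinal ln) <= _).
  have [_ /(_ (Ordinal ln))] := al; rewrite /lam_next /= prednK// eqxx.
  by rewrite (_ : ordS _ = z)//; apply: val_inj; rewrite /= prednK// modnn.
by apply: alcove_le => //=; rewrite -ltnS prednK.
Qed.

Definition level lam (c : R) : int := \sum_k Num.floor (lam 0 k - c).

(* Extended by lam_(k+n) = lam_k - 1, an element of the alcove is a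
   non-increasing sequence, and [level lam c] locates [c] in it. *)
Lemma level_alcove lam c k : alcove lam ->
  (c <= lam 0 k) = ((k.+1)%:Z - n%:Z <= level lam c).
Proof.
move=> al.
(* The floors dominate [F k.+1] when [c <= lam 0 k] and are dominated by [F k] otherwise, because
   the entries are non-increasing and spread over a width of at most 1. *)
pose F m l : int := (if (l < m)%N then 0 else - 1).
have SF m : (m <= n)%N -> \sum_(l < n) F m l = m%:Z - n%:Z.
  move=> mn.
  have -> : \sum_(l < n) F m l = \sum_(l < n | (l < m)%N) 1 - \sum_(l < n) 1.
    rewrite [X in X - _]big_mkcond -sumrB; apply: eq_bigr => l _; rewrite /F.
    by case: ifP => _; rewrite ?subrr ?sub0r.
  by rewrite -(big_ord_widen n (fun=> 1) mn) !sumr_const !card_ord !natz.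
case: (lerP c (lam 0 k)) => ck.
  apply/esym; rewrite -(SF _ (ltn_ord k)); apply: ler_sum => l _; rewrite /F ltnS.
  case: leqP => lk; first by rewrite floor_ge0 subr_ge0 (le_trans ck)// alcove_le.
  rewrite floor_ge_int lerBrDr addrC; apply: le_trans (alcove_width k l al).
  by rewrite lerD2r.
apply/esym/negbTE; rewrite -ltNge; apply: le_lt_trans (_ : k%:Z - n%:Z < _); last first.
  by rewrite ltrD2r ltz_nat.
rewrite -(SF _ (ltnW (ltn_ord k))); apply: ler_sum => l _; rewrite /F.
case: ltnP => lk.
  rewrite floor_le0 ltrBlDr; apply: le_lt_trans (_ : lam 0 k + 1 < _).
    by rewrite -lerBlDr alcove_width.
  by rewrite [1 + _]addrC ltrD2r.
by rewrite -ltzD1 addNr floor_lt_int subr_lt0 (le_lt_trans _ ck)// alcove_le.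
Qed.

(** [level] is unchanged by permuting the entries and by integer shifts of total 0, and it is
    monotone in the entries. An inequality holding after such a rearrangement therefore passes to
    levels, and by [level_alcove] back to entries of equal index. *)
Lemma alcove_close lam lam' (s : 'I_n -> 'I_n) (m : 'I_n -> int) (e : R) :
  alcove lam -> alcove lam' -> injective s -> \sum_k m k = 0 ->
  (forall k, lam 0 (s k) + (m k)%:~R <= lam' 0 k + e) ->
  forall k, lam 0 k <= lam' 0 k + e.
Proof.
move=> al al' si m0 H k; rewrite -lerBlDr (level_alcove _ _ al').
have : lam 0 k <= lam 0 k by [].
rewrite {1}(level_alcove _ _ al) => /le_trans; apply.
rewrite /level (reindex_inj si) /=.
apply: le_trans (_ : \sum_l (Num.floor (lam 0 (s l) - lam 0 k) + m l) <= _).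
  by rewrite big_split /= m0 addr0.
apply: ler_sum => l _; have -> : m l = Num.floor ((m l)%:~R : R) by rewrite intrKfloor.
rewrite -floorDrz ?intr_int//.
by apply: le_floor; have := H l; lra.
Qed.

(** An orbit of the affine Weyl group meets the alcove at most once. [alcove_close] with e = 0 gives
    one inequality in each entry, and both sides have sum 0. *)
Lemma alcove_unique lam lam' (s : 'I_n -> 'I_n) (m : 'I_n -> int) :
  alcove lam -> alcove lam' -> injective s ->
  (forall k, lam 0 (s k) + (m k)%:~R = lam' 0 k) -> lam = lam'.
Proof.
move=> al al' si H.
have m0 : \sum_k m k = 0.
  apply: (@intr_inj R); rewrite mulr0z raddf_sum /=.
  rewrite (eq_bigr (fun k => lam' 0 k - lam 0 (s k))) => [|k _]; last first.
    by rewrite -H addrC addKr.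
  rewrite sumrB; have [c' _] := al'; have [c _] := al.
  have -> : \sum_(i < n) lam 0 (s i) = 0 by rewrite -[RHS]c [RHS](reindex_inj si).
  by rewrite c' subr0.
have le1 k : lam 0 k <= lam' 0 k.
  by rewrite -[lam' 0 k]addr0; apply: (alcove_close al al' si m0) => l; rewrite H addr0.
have [c _] := al; have [c' _] := al'.
apply/rowP => k; apply/eqP; rewrite -subr_eq0 -oppr_eq0 opprB.
have : \sum_k (lam' 0 k - lam 0 k) = 0 by rewrite sumrB c c' subrr.
by move/eqP; rewrite psumr_eq0 => [/allP/(_ k)|l _]; [apply; exact: mem_index_enum|rewrite subr_ge0].
Qed.

End Alcove.

(** * The map t |-> exp(2 pi sqrt(-1) t) onto the unit circle *)

Section CircleMap.
Variable R : realType.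
Local Notation C := (R[i]).
Implicit Types (x y : R).

Lemma expiD x y : expi (x + y) = expi x * expi y.
Proof.
rewrite /expi mulrDr cosD sinD; apply/eqP; rewrite eq_complex /= eqxx /=.
by rewrite addrC.
Qed.

Lemma expi0 : expi (0 : R) = 1.
Proof. by rewrite /expi mulr0 cos0 sin0. Qed.

Lemma expi1 : expi (1 : R) = 1.
Proof. by rewrite /expi mulr1 mulr_natl cos2pi sin2pi. Qed.

Lemma normr_expi x : `|expi x| = 1.
Proof. by rewrite normc_def /= cos2Dsin2 sqrtr1. Qed.

Lemma expiN x : expi (- x) = (expi x)^*.
Proof.
by rewrite /expi mulrN cosN sinN.
Qed.

Lemma expi_int (m : int) : expi (m%:~R : R) = 1.
Proof.
have nat_case (p : nat) : expi (p%:R : R) = 1.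
  by elim: p => [|p IH]; rewrite ?expi0// -natr1 expiD IH expi1 mulr1.
case: m => p; first exact: nat_case.
by rewrite NegzE mulrNz expiN nat_case rmorph1.
Qed.

Lemma expi_sum (I : Type) (r : seq I) (P : pred I) (F : I -> R) :
  expi (\sum_(i <- r | P i) F i) = \prod_(i <- r | P i) expi (F i).
Proof.
elim: r => [|a r IH]; first by rewrite !big_nil expi0.
by rewrite !big_cons; case: (P a); rewrite ?expiD IH.
Qed.

Lemma expi_near_int e : 0 < e -> e <= 2^-1 -> exists2 d : R, 0 < d &
  forall x, cabs (expi x - 1) < d -> exists m : int, `|x - m%:~R| < e.
Proof.
move=> e0 e1; have pi0 : 0 < (pi : R) := pi_gt0 _.
have eI : 2 * pi * e \in `[0, (pi : R)].
  rewrite in_itv /= !mulr_ge0 ?(ltW pi0) ?(ltW e0)//=.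
  by rewrite mulrAC ler_piMl ?(ltW pi0)// -ler_pdivlMl// mulr1.
(* The distance of [expi x] to 1 is at least 1 - cos(2 pi x), and the cosine decreases on half a
   turn; [e <= 2^-1] keeps the angle in that range. *)
exists (1 - cos (2 * pi * e)).
  rewrite subr_gt0 -[X in _ < X]cos0 ltr_cos ?in_itv /= ?lexx ?(ltW pi0)//.
  by rewrite !mulr_gt0.
(* The integer nearest to [x]. *)
move=> x H; exists (Num.floor (x + 2^-1)).
set y := x - _.
have ey : expi x = expi y by rewrite /y expiD -mulrNz expi_int mulr1.
have y1 : `|y| <= 2^-1.
  have /andP[h1 h2] := floor_itv (x + 2^-1); rewrite ler_norml /y; apply/andP; split.
    by rewrite lerBrDr addrC lerBlDr.
  by move: h2; rewrite intrD1 => h2; rewrite lerBlDr; lra.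
have yI : 2 * pi * `|y| \in `[0, (pi : R)].
  rewrite in_itv /= !mulr_ge0 ?(ltW pi0)//=.
  by rewrite mulrAC ler_piMl ?(ltW pi0)// -ler_pdivlMl// mulr1.
rewrite ltNge; apply/negP => ye; move: H; rewrite ltNge => /negP; apply.
apply: le_trans (_ : 1 - cos (2 * pi * `|y|) <= _).
  rewrite lerD2l lerN2 leNgt ltr_cos// -leNgt ler_wpM2l//.
  by rewrite mulr_ge0// ltW.
have -> : cos (2 * pi * `|y|) = cos (2 * pi * y).
  rewrite -[LHS]cos_norm -[RHS]cos_norm !normrM normr_id //.
apply: le_trans (normr_Re _); rewrite ey /= -normrN opprB.
by rewrite ler_norm.
Qed.

(** The fractional part z of x - y satisfies expi z = 1, so by [expi_near_int] it lies arbitrarily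
    close to integers; as z lies in [0, 1), the integer is 0 and z = 0. *)
Lemma expi_inj x y : expi x = expi y -> exists m : int, x = y + m%:~R.
Proof.
move=> E; have E1 : expi (x - y) = 1 by rewrite expiD E -expiD subrr expi0.
pose z := x - y - (Num.floor (x - y))%:~R.
have z0 : 0 <= z < 1.
  have /andP[] := floor_itv (x - y); rewrite intrD1 /z; move: (Num.floor _) => m h1 h2.
  by apply/andP; split; lra.
exists (Num.floor (x - y)); suff : z = 0 by rewrite /z => /eqP; rewrite subr_eq0 => /eqP <-; rewrite addrC subrK.
have ez : expi z = 1 by rewrite /z expiD E1 -mulrNz expi_int mulr1.
apply/eqP; rewrite -normr_le0; apply/ler_addgt0Pl => e e0.
(* The last bound excludes the integer 1, the bound by 1/2 the integer -1. *)
pose e' := Num.min e (Num.min (2^-1) (2^-1 * (1 - z))).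
have e'0 : 0 < e'.
  case/andP: z0 => _ z1; rewrite !lt_min e0 /= invr_gt0 ltr0n mulr_gt0 ?invr_gt0//.
  by rewrite subr_gt0.
have [d d0 H] := @expi_near_int e' e'0 ltac:(by rewrite /e' !ge_min lexx orbT).
have /H[m Hm] : cabs (expi z - 1) < d by rewrite ez subrr /cabs ComplexField.Normc.normc0.
have he1 : e' <= e by rewrite /e' ge_min lexx.
have he2 : e' <= 2^-1 * (1 - z) by rewrite /e' !ge_min lexx !orbT.
have he3 : e' <= 2^-1 by rewrite /e' !ge_min lexx orbT.
have mz : m = 0.
  have : (`|m%:~R|%R : R) < 1.
    move: Hm z0; rewrite ltr_norml ltr_norml => /andP[h1 h2] /andP[h3 h4].
    by apply/andP; split; lra.
  by rewrite -intr_norm -(ltr_int R) ltz1 || (rewrite -intr_norm; rewrite ltrz1 => ?; lia).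
by move: Hm; rewrite mz subr0 addr0 => Hm; apply: ltW; apply: lt_le_trans he1.
Qed.

Lemma expi_surj (z : C) : `|z| = 1 -> exists x, z = expi x.
Proof.
case: z => a b; rewrite normc_def /= => /eqP; rewrite eq_complex /= eqxx andbT => /eqP H.
have ab : a ^+ 2 + b ^+ 2 = 1.
  by rewrite -[LHS]sqr_sqrtr ?addr_ge0 ?sqr_ge0// H expr1n.
have a1 : -1 <= a <= 1.
  by rewrite -ler_norml -sqr_norm_le1 || (rewrite -ler_norml -(@expr_le1 _ 2)// real_normK ?num_real// -ab lerDl sqr_ge0).
have pi0 : (2 * pi : R) != 0 by rewrite mulf_neq0 ?pnatr_eq0// gt_eqF// pi_gt0.
have sb : sin (acos a) = `|b|.
  by rewrite sin_acos// -ab addrAC subrr add0r sqrtr_sqr.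
have aI : a \in `[(-1), 1] by rewrite in_itv.
have [b0|b0] := lerP 0 b.
  exists (acos a / (2 * pi)); rewrite /expi mulrCA mulfV// mulr1 acosK// sb.
  by rewrite ger0_norm.
exists (- acos a / (2 * pi)); rewrite /expi mulrCA mulfV// mulr1 cosN sinN acosK// sb.
by rewrite ltr0_norm// opprK.
Qed.

End CircleMap.

(** * Diagonalization in SU(n) and the map to the alcove *)

Section SpecialUnitary.
Variables (R : realType) (n : nat).
Hypothesis n0 : (0 < n)%N.
Local Notation C := (R[i]).
Local Notation Mat := ('M[C]_n).
Implicit Types (A g h X : Mat) (lam v : 'rV[R]_n) (i j k l : 'I_n).

Lemma SU_unitary g : SU g -> g \is unitarymx. Proof. by case. Qed.

Lemma SU_mulVmx g : SU g -> g^t* *m g = 1%:M.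
Proof. by move/SU_unitary/unitary_mulVmx. Qed.

Lemma SU_mulmxV g : SU g -> g *m g^t* = 1%:M.
Proof. by move/SU_unitary/unitary_mulmxV. Qed.

Lemma SU_mul g h : SU g -> SU h -> SU (g *m h).
Proof.
move=> [ug dg] [uh dh]; split; first exact: (mul_unitarymx ug uh).
by rewrite det_mulmx dg dh mulr1.
Qed.

Lemma SU_adj g : SU g -> SU (g^t*).
Proof.
move=> [ug dg]; split; first by rewrite trmxC_unitary.
by rewrite det_adj dg rmorph1.
Qed.

Lemma SU1 : SU (1%:M : Mat).
Proof.
by split; [apply/unitarymxP; rewrite adj1 mulmx1|exact: det1].
Qed.

Lemma AdM g h X : Ad (g *m h) X = Ad g (Ad h X).
Proof. by rewrite /Ad adjM !mulmxA. Qed.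

Lemma Ad_mul g X Y : SU g -> Ad g (X *m Y) = Ad g X *m Ad g Y.
Proof.
move=> sg; rewrite /Ad -!mulmxA; congr (_ *m (_ *m _)).
by rewrite !mulmxA (SU_mulVmx sg) mul1mx.
Qed.

Lemma AdD g X Y : Ad g (X + Y) = Ad g X + Ad g Y.
Proof. by rewrite /Ad mulmxDr mulmxDl. Qed.

Lemma AdB g X Y : Ad g (X - Y) = Ad g X - Ad g Y.
Proof. by rewrite /Ad mulmxBr mulmxBl. Qed.

Lemma AdZ g a X : Ad g (a *: X) = a *: Ad g X.
Proof. by rewrite /Ad -scalemxAr -scalemxAl. Qed.

Lemma Ad_scalar g a : SU g -> Ad g a%:M = a%:M.
Proof. by move=> sg; rewrite /Ad mul_mx_scalar -scalemxAl (SU_mulmxV sg) scalemx1. Qed.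

Lemma Ad1 X : Ad 1%:M X = X.
Proof. by rewrite /Ad mul1mx adj1 mulmx1. Qed.

Lemma Ad_adj g X : (Ad g X)^t* = Ad g (X^t*).
Proof. by rewrite /Ad !adjM trmxCK mulmxA. Qed.

Lemma AdK g X : SU g -> Ad g (Ad (g^t*) X) = X.
Proof. by move=> sg; rewrite -AdM (SU_mulmxV sg) Ad1. Qed.

Lemma AdKV g X : SU g -> Ad (g^t*) (Ad g X) = X.
Proof. by move=> sg; rewrite -AdM (SU_mulVmx sg) Ad1. Qed.

Lemma Ad_fix_comm h X : SU h -> Ad h X = X <-> h *m X = X *m h.
Proof.
move=> sh; split=> [E|E].
  by rewrite -[X in _ = X *m _]E /Ad -mulmxA (SU_mulVmx sh) mulmx1.
by rewrite /Ad E -mulmxA (SU_mulmxV sh) mulmx1.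
Qed.

Lemma texp_unitary v : texp v \is unitarymx.
Proof.
apply/unitarymxP; rewrite /texp adj_diag mulmx_diag.
rewrite (_ : (\row__ _) = const_mx 1) ?diag_const_mx//.
by apply/rowP => k; rewrite !mxE -normCK normr_expi expr1n.
Qed.

Lemma det_texp v : cartan v -> \det (texp v) = 1.
Proof.
move=> cv; rewrite det_diag (eq_bigr (fun k => expi (v 0 k))) => [|k _]; last by rewrite mxE.
by rewrite -expi_sum cv expi0.
Qed.

Lemma texp_SU v : cartan v -> SU (texp v).
Proof. by move=> cv; split; [exact: texp_unitary|exact: det_texp]. Qed.

(** The columns are permuted by [p], and the determinant is then corrected by a phase on one column;
    this phase commutes with diagonal matrices and does not affect the conjugation. *)
Lemma unitary_reorder (U : Mat) (p : 'I_n -> 'I_n) :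
  U \is unitarymx -> injective p ->
  exists2 g, SU g &
    forall d : 'rV[C]_n, Ad U (diag_mx d) = Ad g (diag_mx (\row_k d 0 (p k))).
Proof.
move=> uU pI.
pose W : Mat := \matrix_(a, b) U a (p b).
have uW : W \is unitarymx.
  apply/unitarymxP; rewrite -(unitary_mulmxV uU); apply/matrixP => a b.
  rewrite !mxE [RHS](reindex_inj pI); apply: eq_bigr => l _.
  by rewrite !mxE.
have nd : `|\det W| = 1.
  have := congr1 (fun M : Mat => \det M) (unitary_mulmxV uW).
  rewrite det_mulmx det_adj det1 -normCK => /eqP.
  by rewrite sqrp_eq1// => /eqP.
pose z := Ordinal n0.
pose f : 'rV[C]_n := \row_k (if k == z then (\det W)^* else 1).
have uf : diag_mx f \is unitarymx.
  apply/unitarymxP; rewrite adj_diag mulmx_diag.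
  rewrite (_ : (\row__ _) = const_mx 1) ?diag_const_mx//.
  apply/rowP => k; rewrite !mxE -normCK; case: ifP => _; last by rewrite normr1 expr1n.
  by rewrite norm_conjC nd expr1n.
exists (W *m diag_mx f).
  split; first exact: (mul_unitarymx uW uf).
  rewrite det_mulmx det_diag (bigD1 z)//= big1 => [|k kz]; last by rewrite mxE (negbTE kz).
  by rewrite mxE eqxx mulr1 -normCK nd expr1n.
move=> d.
have -> : Ad (W *m diag_mx f) (diag_mx (\row_k d 0 (p k))) =
          Ad W (diag_mx (\row_k d 0 (p k))).
  rewrite AdM; congr (Ad W _); rewrite /Ad diag_mxC -mulmxA.
  by rewrite (unitary_mulmxV uf) mulmx1.
rewrite /Ad; apply/matrixP => a b; rewrite !mxE [LHS](reindex_inj pI).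
by apply: eq_bigr => k _; rewrite !mul_mx_diag !mxE.
Qed.

Lemma unitary_diagonal A : A \is unitarymx ->
  exists U (t : 'rV[R]_n), U \is unitarymx /\ A = Ad U (texp t).
Proof.
move=> uA; have nA : A \is normalmx.
  by apply/normalmxP; rewrite unitary_mulmxV// unitary_mulVmx.
have /orthomx_spectralP := nA; rewrite invmx_unitary ?spectral_unitarymx// => E.
set P := spectralmx A in E; set d := spectral_diag A in E.
have uP : P \is unitarymx by exact: spectral_unitarymx.
have dE : diag_mx d = P *m A *m P^t*.
  by rewrite E !mulmxA (unitary_mulmxV uP) mul1mx -mulmxA (unitary_mulmxV uP) mulmx1.
have ud : diag_mx d \is unitarymx.
  rewrite dE; apply: mul_unitarymx; last by rewrite trmxC_unitary.
  exact: (mul_unitarymx uP uA).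
have d1 k : `|d 0 k| = 1.
  have /matrixP/(_ k k) := unitary_mulmxV ud.
  rewrite adj_diag mulmx_diag !mxE eqxx !mulr1n -normCK => /eqP.
  by rewrite sqrp_eq1// => /eqP.
have /choice[t Ht] : forall k, exists x, d 0 k = expi x by move=> k; apply: expi_surj.
exists (P^t*), (\row_k t k); split; first by rewrite trmxC_unitary.
rewrite /Ad trmxCK {1}E; congr (_ *m diag_mx _ *m _).
by apply/rowP => k; rewrite !mxE.
Qed.

(** The sorted fractional parts, continued by e(a + n) = e(a) - 1, form a non-increasing sequence,
    and any n consecutive terms satisfy the inequalities of the alcove. Moving this window by one
    lowers its sum by 1; the sum of the fractional parts is an integer, so some window has sum 0. *)
Lemma alcove_representative (t : 'rV[R]_n) : expi (\sum_k t 0 k) = 1 ->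
  exists (p : 'I_n -> 'I_n) lam, [/\ injective p, alcove lam &
    forall k, expi (lam 0 k) = expi (t 0 (p k))].
Proof.
move=> t1.
pose fr k := t 0 k - (Num.floor (t 0 k))%:~R.
have fr01 k : 0 <= fr k < 1.
  have /andP[] := floor_itv (t 0 k); rewrite intrD1 /fr; move: (Num.floor _) => m h1 h2.
  by apply/andP; split; lra.
have efr k : expi (fr k) = expi (t 0 k) by rewrite /fr expiD -mulrNz expi_int mulr1.
have [p sp] : exists p : 'S_n, forall k l, (k <= l)%N -> fr (p l) <= fr (p k).
  pose s := sort (fun a b => fr b <= fr a) (enum 'I_n).
  have sz : size s == n by rewrite size_sort size_enum_ord.
  have ps : perm_eq (Tuple sz) (ord_tuple n).
    have -> : (ord_tuple n : seq _) = enum 'I_n by exact: val_ord_tuple.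
    by rewrite /= perm_sort.
  have /tuple_permP[p Ep] := ps.
  exists p => k l kl.
  have tot : total (fun a b => fr b <= fr a) by move=> a b; exact: le_total.
  have tr : transitive (fun a b => fr b <= fr a) by move=> a b c h1 h2; apply: le_trans h1.
  have := sort_sorted tot (enum 'I_n) => ss.
  have sE (m : 'I_n) : nth k s m = p m.
    have -> : nth k s m = tnth (Tuple sz) m by rewrite (tnth_nth k).
    rewrite (_ : Tuple sz = [tuple tnth (ord_tuple n) (p a) | a < n]); last exact: val_inj.
    by rewrite tnth_mktuple tnth_ord_tuple.
  move: kl; rewrite leq_eqVlt => /orP[/eqP kl|kl].
    by rewrite (val_inj kl).
  have := sorted_ltn_nth tr k ss; move/(_ k l); rewrite !inE (eqP sz) !ltn_ord => /(_ isT isT kl).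
  by rewrite !sE.
have [N SN] : exists N : nat, \sum_k fr k = N%:R.
  have e1 : expi (\sum_k fr k) = 1.
    by rewrite expi_sum (eq_bigr (fun k => expi (t 0 k))) -?expi_sum.
  have [m] := expi_inj (etrans e1 (esym (@expi0 R))); rewrite add0r => Em.
  have : 0 <= (m%:~R : R) by rewrite -Em sumr_ge0// => k _; case/andP: (fr01 k).
  rewrite ler0z; case: m Em => // m -> _; by exists m.
pose z := Ordinal n0.
pose md (a : nat) : 'I_n := Ordinal (ltn_pmod a n0).
pose e (a : nat) : R := fr (p (md a)) - (a %/ n)%:R.
have eS a : e a.+1 <= e a.
  rewrite /e; have [an|an] := eqVneq ((a %% n).+1) n.
    have m0 : (a.+1 %% n = 0)%N by rewrite -addn1 -modnDml addn1 an modnn.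
    have d1 : (a.+1 %/ n = (a %/ n).+1)%N.
      by rewrite {1}(divn_eq a n) -addnS an -mulSnr mulnK.
    rewrite d1 -natr1; case/andP: (fr01 (p (md a))) => h1 _.
    by case/andP: (fr01 (p (md a.+1))) => _ h2; lra.
  have lt : ((a %% n).+1 < n)%N by rewrite ltn_neqAle an ltn_pmod.
  have m1 : (a.+1 %% n = (a %% n).+1)%N by rewrite -addn1 -modnDml addn1 modn_small.
  have d1 : (a.+1 %/ n = a %/ n)%N.
    by rewrite {1}(divn_eq a n) -addnS divnMDl// (divn_small lt) addn0.
  by rewrite d1 lerD2r sp//= m1.
have en a : e (a + n)%N = e a - 1.
  rewrite /e divnDr ?dvdnn// divnn n0 /= addn1 -natr1 opprD addrA; congr (fr (p _) - _ - _).
  by apply: val_inj; rewrite /= modnDr.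
have Se M : \sum_(k < n) e (k + M)%N = \sum_(k < n) fr k - M%:R.
  elim: M => [|M IH].
    rewrite subr0 [RHS](reindex_inj (@perm_inj _ p)); apply: eq_bigr => k _.
    rewrite addn0 /e divn_small// subr0; congr (fr (p _)).
    by apply: val_inj; rewrite /= modn_small.
  rewrite -natr1 opprD addrA -IH.
  have E1 : \sum_(k < n.+1) e (k + M)%N = \sum_(k < n) e (k + M)%N + e (n + M)%N.
    by rewrite big_ord_recr.
  have E2 : \sum_(k < n.+1) e (k + M)%N = e M + \sum_(k < n) e (bump 0 k + M)%N.
    by rewrite big_ord_recl.
  move: E2; rewrite E1 [(n + M)%N]addnC en => E.
  have -> : \sum_(k < n) e (k + M.+1)%N = \sum_(k < n) e (bump 0 k + M)%N.
    by apply: eq_bigr => k _; rewrite /bump /= add1n addSnnS.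
  by move: E; lra.
(* The window starting at [N], the sum of the fractional parts. *)
pose lam : 'rV[R]_n := \row_k e (k + N)%N.
exists (fun k => p (md (k + N)%N)), lam; split.
- move=> k l /perm_inj [] /eqP; rewrite eqn_modDr !modn_small// => /eqP E.
  exact: val_inj.
- split.
    by rewrite /cartan (eq_bigr (fun k : 'I_n => e (k + N)%N)) ?Se ?SN ?subrr// => k _; rewrite mxE.
  move=> k; rewrite /lam_next !mxE; apply: le_trans (eS _).
  rewrite -addSn; have [kn|kn] := eqVneq k.+1 n.
    have -> : (ordS k : nat) = 0%N by rewrite /= kn modnn.
    by rewrite kn add0n addnC en.
  rewrite subr0; have -> // : (ordS k : nat) = k.+1.
  by rewrite /= modn_small// ltn_neqAle kn ltn_ord.
by move=> k; rewrite mxE /e expiD -efr -[- _]/(- (Posz _)%:~R) -mulrNz expi_int mulr1.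
Qed.

Lemma diagonalizes_exists A : SU A -> exists g lam, diagonalizes A g lam.
Proof.
move=> [uA dA]; have [U [t [uU E]]] := unitary_diagonal uA.
have dt : expi (\sum_k t 0 k) = 1.
  have : \det A = \det (texp t).
    by rewrite E /Ad !det_mulmx mulrAC -det_mulmx (unitary_mulmxV uU) det1 mul1r.
  rewrite dA det_diag => ->; rewrite expi_sum; apply: eq_bigr => k _; by rewrite mxE.
have [p [lam [pI al Hl]]] := alcove_representative dt.
have [g sg Eg] := unitary_reorder uU pI.
exists g, lam; split=> //; rewrite E /texp Eg; congr (Ad g (diag_mx _)).
by apply/rowP => k; rewrite !mxE Hl.
Qed.

(** The entries of A0 - A between two eigenbases: where the transition matrix has a large entry, a
    small A0 - A forces the eigenvalues to be close. *)
Lemma eigen_difference A A0 g g0 lam lam0 k l :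
  diagonalizes A g lam -> diagonalizes A0 g0 lam0 ->
  (g0^t* *m (A0 - A) *m g) k l =
  (expi (lam0 0 k) - expi (lam 0 l)) * (g0^t* *m g) k l.
Proof.
move=> [sg _ EA] [sg0 _ EA0].
have -> : g0^t* *m (A0 - A) *m g = texp lam0 *m (g0^t* *m g) - (g0^t* *m g) *m texp lam.
  rewrite EA EA0 /Ad mulmxBr mulmxBl; congr (_ - _).
    by rewrite !mulmxA (SU_mulVmx sg0) mul1mx.
  by rewrite -[LHS]mulmxA -[g *m _ *m _ *m _]mulmxA (SU_mulVmx sg) mulmx1 mulmxA.
by rewrite mul_diag_mx mul_mx_diag !mxE; ring.
Qed.

Lemma unitary_entry (U : Mat) k l : U \is unitarymx -> `|U k l| <= 1.
Proof.
move=> uU; rewrite -(@expr_le1 _ 2)//.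
have /matrixP/(_ k k) := unitary_mulmxV uU; rewrite !mxE eqxx mulr1n => <-.
rewrite (bigD1 l)//= !mxE -normCK lerDl; apply: sumr_ge0 => m _.
by rewrite !mxE -normCK exprn_ge0.
Qed.

(** The Leibniz expansion writes 1 as a sum of n! signed products, so one of them has modulus at
    least 1/n!; all entries have modulus at most 1, hence each factor of it is at least 1/n!. *)
Lemma unitary_det_perm (U : Mat) : SU U -> exists s : 'S_n,
  forall k, 1 <= (n`!)%:R * `|U k (s k)|.
Proof.
move=> [uU dU]; have nf : 0 < ((n`!)%:R : C) by rewrite ltr0n fact_gt0.
have [s Hs] : exists s : 'S_n, (n`!)%:R^-1 <= `|\prod_k U k (s k)|.
  apply: contrapT => /forallNP H.
  have : 1 < 1 :> C.
    rewrite -[X in X < _]normr1 -[X in `|X|]dU /determinant.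
    apply: le_lt_trans (ler_norm_sum _ _ _) _.
    apply: lt_le_trans (_ : \sum_(s : 'S_n) (n`!)%:R^-1 <= _).
      apply: ltr_sum.
        by apply/hasP; exists 1%g => //; rewrite mem_index_enum.
      move=> s _; rewrite normrM normrX normrN1 expr1n mul1r.
      by rewrite real_ltNge ?ger0_real ?invr_ge0//; apply/negP; exact: H.
    by rewrite sumr_const card_Sn -[_^-1 *+ _]mulr_natr mulVf ?gt_eqF.
  by rewrite ltxx.
exists s => k; move: Hs; rewrite (bigD1 k)//= normrM => Hs.
rewrite -ler_pdivrMl// mulr1; apply: le_trans Hs _.
rewrite ler_piMr// normr_prod; apply: prodr_ile1 => l _.
by rewrite normr_ge0 unitary_entry.
Qed.

(** A crude eigenvalue perturbation bound: one permutation pairs all eigenvalues along large entries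
    of the transition matrix. The exact constant is immaterial; the case A = A0 gives uniqueness of
    lambda, the general case continuity. *)
Lemma eigen_close A A0 g g0 lam lam0 :
  diagonalizes A g lam -> diagonalizes A0 g0 lam0 ->
  exists s : 'S_n, forall k, `|expi (lam0 0 k) - expi (lam 0 (s k))| <=
    (n`! * (n * n) * (n * n))%:R * norm1 (A0 - A).
Proof.
move=> dA dA0; have [sg _ _] := dA; have [sg0 _ _] := dA0.
have [s Hs] := unitary_det_perm (SU_mul (SU_adj sg0) sg).
exists s => k; have E := eigen_difference k (s k) dA dA0.
have n1 (U : Mat) : U \is unitarymx -> norm1 U <= (n * n)%:R.
  move=> uU; apply: le_trans (_ : \sum_(i < n) \sum_(j < n) (1 : C) <= _).
    by apply: ler_sum => i _; apply: ler_sum => j _; apply: unitary_entry.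
  by rewrite sumr_const card_ord sumr_const card_ord -mulrnA.
apply: le_trans (_ : (n`!)%:R * (`|expi (lam0 0 k) - expi (lam 0 (s k))| *
    `|(g0^t* *m g) k (s k)|) <= _).
  by rewrite mulrCA ler_peMr.
set N := (n * n)%N in n1 *; rewrite -normrM -E 2!natrM -!mulrA ler_wpM2l//.
apply: le_trans (norm1_entry _ _ _) _; apply: le_trans (norm1M _ _) _.
rewrite mulrCA [leRHS]mulrC; apply: ler_pM; rewrite ?norm1_ge0 ?n1 ?SU_unitary//.
apply: le_trans (norm1M _ _) _; apply: ler_wpM2r; rewrite ?norm1_ge0//.
by apply: n1; apply: SU_unitary; apply: SU_adj.
Qed.

Lemma diagonalizes_unique A g g' lam lam' :
  diagonalizes A g lam -> diagonalizes A g' lam' -> lam = lam'.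
Proof.
move=> dA dA'; have [_ al _] := dA; have [_ al' _] := dA'.
have [s Hs] := eigen_close dA dA'.
have E k : expi (lam' 0 k) = expi (lam 0 (s k)).
  apply/eqP; rewrite -subr_eq0 -normr_le0; apply: le_trans (Hs k) _.
  rewrite subrr (_ : norm1 0 = 0) ?mulr0//.
  by rewrite /norm1 big1// => i _; rewrite big1// => j _; rewrite mxE normr0.
have /choice[m Hm] : forall k, exists m : int, lam' 0 k = lam 0 (s k) + m%:~R.
  by move=> k; apply: expi_inj.
by apply: (@alcove_unique _ _ _ _ s m) => //; exact: perm_inj.
Qed.

Lemma diagonalizes_q A g lam : diagonalizes A g lam -> q A = lam.
Proof.
move=> dA; have [g' dA'] : exists g, diagonalizes A g (q A).
  by rewrite /q; apply: (@xgetI _ 0 [set lam | exists g, diagonalizes A g lam] lam); exists g.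
exact: diagonalizes_unique dA' dA.
Qed.

Lemma q_diagonalizes A : SU A -> exists g, diagonalizes A g (q A).
Proof.
by move=> /diagonalizes_exists[g [lam dA]]; exists g; rewrite (diagonalizes_q dA).
Qed.

Lemma q_alcove A : SU A -> alcove (q A).
Proof. by move=> /q_diagonalizes[g []]. Qed.

End SpecialUnitary.

(** * Continuity of [q], the open cover, and smooth spectral projections *)

Section SpectralProjections.
Variables (R : realType) (n : nat).
Hypothesis n0 : (0 < n)%N.
Local Notation C := (R[i]).
Local Notation Mat := ('M[C]_n).
Local Notation VV := ('M[R]_n * 'M[R]_n)%type.
Implicit Types (A g h X : Mat) (lam v : 'rV[R]_n) (i j k l : 'I_n).

Lemma alcove_at_gap j lam : alcove_at j lam -> [/\ lam_next lam j < lam 0 j,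
  forall k, (k <= j)%N -> lam 0 j <= lam 0 k,
  forall k, (j < k)%N -> lam 0 k <= lam_next lam j,
  forall k, lam 0 k - 1 <= lam_next lam j &
  forall k, lam 0 j - 1 <= lam 0 k].
Proof.
move=> [al gap]; split=> //.
- by move=> k kj; apply: alcove_le.
- move=> k jk; have jn : (j.+1 < n)%N by apply: leq_ltn_trans (ltn_ord k).
  rewrite /lam_next ltn_eqF// subr0; apply: alcove_le => //.
  by rewrite /= modn_small.
- move=> k; rewrite /lam_next; have [jn|jn] := eqVneq j.+1 n.
    by rewrite lerD2r; apply: alcove_le => //=; rewrite jn modnn.
  by rewrite subr0; apply: alcove_width.
by move=> k; apply: alcove_width.
Qed.

Lemma expi_eq_alcove lam k l : alcove lam -> expi (lam 0 k) = expi (lam 0 l) ->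
  [\/ lam 0 k = lam 0 l, lam 0 k = lam 0 l + 1 | lam 0 l = lam 0 k + 1].
Proof.
move=> al /expi_inj[m Em]; have h1 := alcove_width k l al; have h2 := alcove_width l k al.
have m1 : (m%:~R : R) <= 1%:~R by rewrite mulr1z; lra.
have m2 : ((- 1)%:~R : R) <= m%:~R by rewrite mulrN1z; lra.
move: m1 m2; rewrite !ler_int => m1 m2.
have : m = 0 \/ m = 1 \/ m = -1 by lia.
case=> [m0|[m0|m0]]; rewrite m0 ?mulr0z ?mulr1z ?mulrN1z in Em.
- by apply: Or31; lra.
- by apply: Or32; lra.
by apply: Or33; lra.
Qed.

Lemma muE j k : mu R j 0 k = (k <= j)%:R - j.+1%:R / n%:R.
Proof.
rewrite /mu !mxE mulr1 summxE; congr (_ - _).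
rewrite (eq_bigr (fun l => if l == k then 1 else 0)) => [|l _]; last first.
  by rewrite mxE eqxx /= [k == l]eq_sym; case: eqP.
rewrite -big_mkcondr; case kj: (k <= j)%N.
  rewrite (big_pred1 k) // => l.
  by case: (eqVneq l k) => [->|/negbTE h]; rewrite /= ?eqxx ?h ?kj ?andbF.
by rewrite big_pred0// => l; case: (eqVneq l k) => [->|_]; rewrite ?kj ?andbF.
Qed.

(** Indices with equal lambda lie on the same side of the gap after j. If the lambdas differ by 1,
    the indices lie on opposite sides, where mu_j jumps by 1 as well. This is why theta_j is well
    defined where eigenvalues coincide. *)
Lemma alcove_at_level_set j lam k l : alcove_at j lam ->
  expi (lam 0 k) = expi (lam 0 l) -> (lam - mu R j) 0 k = (lam - mu R j) 0 l.
Proof.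
move=> aj E; have [al _] := aj; have [g0 G1 G2 G3 G4] := alcove_at_gap aj.
rewrite [LHS]mxE [RHS]mxE [in LHS]mxE [in RHS]mxE !muE.
have K1 := G1 k; have K2 := G2 k; have K3 := G3 k; have K4 := G4 k.
have L1 := G1 l; have L2 := G2 l; have L3 := G3 l; have L4 := G4 l.
have [kj|kj] := leqP k j; have [lj|lj] := leqP l j; case: (expi_eq_alcove al E) => H;
  rewrite ?(K1 kj) ?(K2 kj) ?(L1 lj) ?(L2 lj) //=;
  try (have := K1 kj); try (have := K2 kj); try (have := L1 lj); try (have := L2 lj); lra.
Qed.

(** Two diagonalizing matrices differ by some h commuting with exp(lambda). The entries of h between
    distinct eigenvalues vanish, so h also commutes with every diagonal matrix that is constant on
    equal eigenvalues. *)
Lemma diagonalizes_Ad A g g' lam lam' (T : 'rV[C]_n) :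
  diagonalizes A g lam -> diagonalizes A g' lam' ->
  (forall k l, expi (lam 0 k) = expi (lam 0 l) -> T 0 k = T 0 l) ->
  Ad g (diag_mx T) = Ad g' (diag_mx T).
Proof.
move=> dA dA' HT; have E := diagonalizes_unique dA dA'; subst lam'.
have [sg al EA] := dA; have [sg' _ EA'] := dA'.
have [h [sh hg hT]] : exists h, [/\ SU h, g' = g *m h & h *m texp lam = texp lam *m h].
  have sh : SU (g^t* *m g') by apply: SU_mul => //; apply: SU_adj.
  exists (g^t* *m g'); split=> //; first by rewrite mulmxA (SU_mulmxV sg) mul1mx.
  by apply/(Ad_fix_comm _ sh); rewrite AdM -EA' EA AdKV.
have hD : h *m diag_mx T = diag_mx T *m h.
  rewrite mul_mx_diag mul_diag_mx; apply/matrixP => k l; rewrite !mxE.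
  move/matrixP/(_ k l): hT; rewrite mul_mx_diag mul_diag_mx !mxE => hT.
  have [E|E] := eqVneq (expi (lam 0 k)) (expi (lam 0 l)); first by rewrite (HT _ _ E) mulrC.
  suff -> : h k l = 0 by rewrite mul0r mulr0.
  have : h k l * (expi (lam 0 l) - expi (lam 0 k)) = 0.
    by rewrite mulrBr hT [_ * h k l]mulrC subrr.
  by move/eqP; rewrite mulf_eq0 subr_eq0 [_ == expi (lam 0 k)]eq_sym (negbTE E) orbF => /eqP.
by rewrite hg AdM; congr (Ad g _); apply/esym/(Ad_fix_comm _ sh).
Qed.

Lemma Vcover_diag j A g lam : Vcover j A -> diagonalizes A g lam -> alcove_at j lam.
Proof. by move=> [_ H] dA; rewrite -(diagonalizes_q dA). Qed.

Lemma theta1E j A g lam : Vcover j A -> diagonalizes A g lam ->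
  theta1 j A = Ad g (tdiag (lam - mu R j)).
Proof.
move=> VA dA; have aj := Vcover_diag VA dA; rewrite /theta1.
set P := [set X | _]; have P0 : P (Ad g (tdiag (lam - mu R j))) by exists g, lam.
have [g' [lam' [dA' ->]]] := xgetI 0 P0.
have E := diagonalizes_unique dA dA'; subst lam'.
apply: (diagonalizes_Ad dA' dA) => k l E.
by rewrite !mxE; congr (_%:C%C); have := alcove_at_level_set aj E; rewrite !mxE.
Qed.

Definition coord_proj i j : Mat := diag_mx (\row_k (i < k <= j)%:R).

(** Written with [theta] instead of eigenvectors: no diagonalization is chosen, and smoothness of
    the projection and of [theta] are the same statement. *)
Definition spec_proj i j A : Mat :=
  theta i j A + ((j - i)%:R / n%:R)%:M.

Lemma muBE i j k : (i < j)%N ->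
  (mu R j - mu R i) 0 k = (i < k <= j)%:R - (j - i)%:R / n%:R.
Proof.
move=> ij; rewrite mxE [X in _ + X]mxE !muE.
have -> : (j - i)%:R = j.+1%:R - i.+1%:R :> R by rewrite -natrB ?subSS// ltnS ltnW.
rewrite mulrBl; have [ki|ki] := leqP k i; have [kj|kj] := leqP k j => /=; try lra.
by have := leq_ltn_trans ki ij; rewrite ltnNge (ltnW kj).
Qed.

Lemma tdiag_muB i j : (i < j)%N ->
  tdiag (mu R j - mu R i) = coord_proj i j - ((j - i)%:R / n%:R)%:M.
Proof.
move=> ij; apply/matrixP => k l; rewrite mxE [X in X *+ _]mxE muBE// !mxE.
case: eqP => _; last by rewrite !mulr0n subr0.
by rewrite !mulr1n raddfB /= rmorphM /= fmorphV !rmorph_nat.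
Qed.

Lemma thetaE i j A g lam : Vcover i A -> Vcover j A -> diagonalizes A g lam ->
  theta i j A = Ad g (tdiag (mu R j - mu R i)).
Proof.
move=> Vi Vj dA; rewrite /theta (theta1E Vi dA) (theta1E Vj dA) -AdB; congr (Ad g _).
apply/matrixP => k l; rewrite !mxE; case: eqP => _; last by rewrite !mulr0n subrr.
rewrite !mulr1n -raddfB /=; congr (_%:C%C); ring.
Qed.

Lemma spec_projE i j A g lam : (i < j)%N -> Vcover i A -> Vcover j A ->
  diagonalizes A g lam -> spec_proj i j A = Ad g (coord_proj i j).
Proof.
move=> ij Vi Vj dA; have [sg _ _] := dA.
rewrite /spec_proj (thetaE Vi Vj dA) tdiag_muB// AdB (Ad_scalar _ sg).
by rewrite subrK.
Qed.

(** Close eigenvalues mean close exponents up to a permutation and integers. Once these integers sum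
    to 0, [alcove_close] applies in both directions. *)
Lemma q_close A0 e : SU A0 -> 0 < e -> exists2 d : R, 0 < d & forall A, SU A ->
  norm1 (A0 - A) < d%:C%C -> forall k, `|q A 0 k - q A0 0 k| <= e.
Proof.
move=> sA0 e0; have nR : 0 < (n%:R : R) by rewrite ltr0n.
(* With n errors of at most 1/(2n), the integers [m k] have a sum of absolute value at most 1/2,
   which is therefore 0. *)
pose e' := Num.min e (2 * n%:R)^-1.
have e'0 : 0 < e' by rewrite lt_min e0 invr_gt0 mulr_gt0.
have e'e : e' <= e by rewrite ge_min lexx.
have e'n : n%:R * e' <= 2^-1.
  rewrite -ler_pdivlMl// mulrC -invfM ge_min lexx orbT //.
have e'2 : e' <= 2^-1.
  by apply: le_trans e'n; rewrite ler_peMl ?(ltW e'0)// ler1n.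
have [d d0 Hd] := expi_near_int e'0 e'2.
have N0 : 0 < ((n`! * (n * n) * (n * n))%:R : R).
  by rewrite ltr0n !muln_gt0 fact_gt0 n0.
exists (d / (n`! * (n * n) * (n * n))%:R); first exact: divr_gt0.
move=> A sA HA; have [g dA] := q_diagonalizes n0 sA; have [g0 dA0] := q_diagonalizes n0 sA0.
have [s Hs] := eigen_close dA dA0.
have al := q_alcove n0 sA; have al0 := q_alcove n0 sA0.
have /choice[m Hm] : forall k, exists m : int,
    `|q A0 0 k - q A 0 (s k) - m%:~R| < e'.
  move=> k; apply: Hd; rewrite -ltcR cabs_normr.
  have -> : expi (q A0 0 k - q A 0 (s k)) - 1 =
      (expi (q A0 0 k) - expi (q A 0 (s k))) * expi (- q A 0 (s k)).
    by rewrite mulrBl -!expiD subrr expi0.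
  rewrite normrM normr_expi mulr1; apply: le_lt_trans (Hs k) _.
  move: HA; rewrite rmorphM /= fmorphV /= rmorph_nat => HA.
  by rewrite mulrC -ltr_pdivlMr// ltr0n !muln_gt0 fact_gt0 n0.
have m0 : \sum_k m k = 0.
  have : `|\sum_k (q A0 0 k - q A 0 (s k) - (m k)%:~R)| <= 2^-1.
    apply: le_trans (ler_norm_sum _ _ _) _; apply: le_trans (_ : \sum_(k < n) e' <= _).
      by apply: ler_sum => k _; exact: ltW.
    by rewrite sumr_const card_ord -[e' *+ n]mulr_natl; exact: e'n.
  rewrite !sumrB; have [c _] := al; have [c0 _] := al0.
  have -> : \sum_(i < n) q A 0 (s i) = 0.
    by rewrite -[RHS]c [RHS](reindex_inj (@perm_inj _ s)).
  rewrite c0 subr0 sub0r normrN -raddf_sum /= -intr_norm => H.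
  have : (`|\sum_k m k|%:~R : R) < 1%:~R by rewrite mulr1z; lra.
  by rewrite ltr_int -(add0r 1) ltzD1 normr_le0 => /eqP.
have up k : q A 0 k <= q A0 0 k + e'.
  apply: (alcove_close al al0 (@perm_inj _ s) m0) => l.
  by have := Hm l; rewrite ltr_norml => /andP[h1 h2]; lra.
have dn : forall k, q A0 0 k <= q A 0 k + e'.
  have m0' : \sum_k (- m (s^-1%g k)) = 0.
    rewrite sumrN (reindex_inj (@perm_inj _ s)) /= (eq_bigr m) ?m0 ?oppr0// => k _.
    by rewrite permK.
  apply: (alcove_close al0 al (@perm_inj _ s^-1%g) m0') => k.
  have := Hm (s^-1%g k); rewrite permKV mulrNz ltr_norml => /andP[h1 h2]; lra.
move=> k; rewrite ler_norml; have := dn k; have := up k => h1 h2.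
by apply/andP; split; lra.
Qed.

Lemma norm1_near A0 (d : R) : 0 < d -> exists D : set VV,
  [/\ open D, D (reim A0) & forall A, D (reim A) -> norm1 (A0 - A) < d%:C%C].
Proof.
move=> d0; pose N : R := (n * n)%:R * 2 + 1.
have N0 : 0 < N by rewrite ltr_wpDl.
exists (ball (reim A0) (d / N)); split.
- exact: ball_open.
- by apply: ballxx; exact: divr_gt0.
move=> A; rewrite -ball_normE /= => H.
have -> : A0 - A = cmx (reim A0 - reim A).
  by apply/matrixP => k l; rewrite !mxE; case: (A0 k l) => ? ?; case: (A k l).
apply: le_lt_trans (norm1_cmx _) _; rewrite ltcR.
move: H; rewrite ltr_pdivlMr// => H; apply: le_lt_trans H.
rewrite /N; set x := `|_|; set M := (n * n)%:R.
by have -> : x * (M * 2 + 1) = M * (x *+ 2) + x; [ring|rewrite lerDl normr_ge0].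
Qed.

Lemma q_continuous A0 e : SU A0 -> 0 < e -> exists D : set VV,
  [/\ open D, D (reim A0) & forall A, SU A -> D (reim A) ->
    forall k, `|q A 0 k - q A0 0 k| <= e].
Proof.
move=> sA0 e0; have [d d0 H] := q_close sA0 e0.
have [D [oD DA HD]] := norm1_near A0 d0.
by exists D; split=> // A sA DA'; apply: H => //; apply: HD.
Qed.

Lemma lam_next_close lam lam' e i : (forall k, `|lam 0 k - lam' 0 k| <= e) ->
  `|lam_next lam i - lam_next lam' i| <= e.
Proof. by move=> H; rewrite /lam_next opprB addrA subrK. Qed.

Lemma Vcover_open i : open_in (@SU R n) (Vcover i).
Proof.
apply/open_inP; split=> [A []//|A [sA [al gap]]].
pose e := (q A 0 i - lam_next (q A) i) / 4.
have e0 : 0 < e by rewrite divr_gt0// subr_gt0.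
have [D [oD DA H]] := q_continuous sA e0.
exists D; split=> // B sB DB; split=> //; split; first exact: q_alcove.
have h1 := H B sB DB i; have h2 := lam_next_close i (H B sB DB).
move: h1 h2 e0; rewrite /e !ler_norml => /andP[h1 h2] /andP[h3 h4] e0; lra.
Qed.

(** The n gaps between consecutive lambdas, closed up by lambda_(n+1) = lambda_1 - 1, have sum 1, so
    they cannot all vanish. *)
Lemma Vcover_cover : @SU R n = \bigcup_i Vcover i.
Proof.
apply/seteqP; split=> [A sA|A [i _ []]//].
have al := q_alcove n0 sA; apply: contrapT => H.
have Hi i : q A 0 i <= lam_next (q A) i.
  rewrite leNgt; apply/negP => gap; apply: H; exists i => //; split=> //.
have : \sum_i q A 0 i <= \sum_i lam_next (q A) i by apply: ler_sum => i _; exact: Hi.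
have -> : \sum_i lam_next (q A) i = \sum_i q A 0 i - 1.
  rewrite /lam_next sumrB; congr (_ - _).
    by rewrite [RHS](reindex_inj (@ordS_inj n)).
  have ln : (n.-1 < n)%N by rewrite prednK.
  rewrite (bigD1 (Ordinal ln))//= big1 ?addr0 => [|k kn]; first by rewrite prednK// eqxx.
  case: eqP => // E; case/eqP: kn; apply: val_inj => /=; by have := congr1 predn E.
by rewrite lerBrDr gerDl ler10.
Qed.

Lemma cos_arc_out (d x : R) : 0 < d -> d < `|x| -> `|x| < 1 - d ->
  cos (2 * pi * x) < cos (2 * pi * d).
Proof.
move=> d0 dx xd; have pi0 : 0 < (pi : R) := pi_gt0 _.
have -> : cos (2 * pi * x) = cos (2 * pi * `|x|).
  by rewrite -[LHS]cos_norm !normrM [ `|2| ]ger0_norm// [ `|pi| ]ger0_norm// ltW.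
move: (`|x|) dx xd => y dy yd.
have I (t : R) : 0 <= t -> t <= 2^-1 -> 2 * pi * t \in `[0, (pi : R)].
  move=> t0 t1; rewrite in_itv /= !mulr_ge0 ?(ltW pi0)//=.
  by rewrite mulrAC ler_piMl ?(ltW pi0)// -ler_pdivlMl// mulr1.
have [y1|y1] := lerP y 2^-1.
  rewrite ltr_cos ?I//; try lra.
  by rewrite ltr_pM2l// mulr_gt0.
have -> : cos (2 * pi * y) = cos (2 * pi * (1 - y)).
  rewrite -[RHS]cosN -mulrN opprB mulrBr mulr1.
  by rewrite -[RHS](cosD2pi (2 * pi * y - 2 * pi)) -[pi *+ 2]mulr_natl subrK.
rewrite ltr_cos ?I//; try lra.
by rewrite ltr_pM2l ?mulr_gt0//; lra.
Qed.

Lemma cos_arc_in (d x : R) : `|x| < d -> d <= 2^-1 ->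
  cos (2 * pi * d) < cos (2 * pi * x).
Proof.
move=> xd d1; have pi0 : 0 < (pi : R) := pi_gt0 _.
have -> : cos (2 * pi * x) = cos (2 * pi * `|x|).
  by rewrite -[LHS]cos_norm !normrM [ `|2| ]ger0_norm// [ `|pi| ]ger0_norm// ltW.
have I (t : R) : 0 <= t -> t <= 2^-1 -> 2 * pi * t \in `[0, (pi : R)].
  move=> t0 t1; rewrite in_itv /= !mulr_ge0 ?(ltW pi0)//=.
  by rewrite mulrAC ler_piMl ?(ltW pi0)// -ler_pdivlMl// mulr1.
rewrite ltr_cos ?I//; have := normr_ge0 x; try lra.
by rewrite ltr_pM2l ?mulr_gt0.
Qed.

(** [f] is the centre and [d] the half-width of an arc, measured in turns: an eigenvalue expi x of A
    gives the eigenvalue 2 cos(2 pi (x - f)) - 2 cos(2 pi d). *)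
Definition chord (f d : R) A : Mat :=
  (expi f)^* *: A + expi f *: A^t* - ((2 * cos (2 * pi * d))%:C%C)%:M.

Lemma chordE f d A g lam : diagonalizes A g lam ->
  chord f d A = Ad g (diag_mx (\row_k
    (2 * cos (2 * pi * (lam 0 k - f)) - 2 * cos (2 * pi * d))%:C%C)).
Proof.
move=> [sg _ ->]; rewrite /chord Ad_adj -!AdZ -AdD.
rewrite -[X in _ - X](Ad_scalar _ sg) -AdB; congr (Ad g _).
rewrite /texp adj_diag; apply/matrixP => k l; rewrite !mxE.
case: eqP => _; last by rewrite !mulr0n !mulr0 addr0 subr0.
rewrite !mulr1n -expiN -expiN -!expiD [- f + _]addrC.
have -> : f + - lam 0 k = - (lam 0 k - f) by rewrite opprB.
rewrite expiN raddfB /=; congr (_ - _).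
rewrite /expi; apply/eqP; rewrite eq_complex /= subrr eqxx andbT.
by apply/eqP; set c := cos _; ring.
Qed.

(* A half plane cuts an arc out of the circle: near a given point of
   V_i and V_j, the eigenvalues with index in ]i, j] are those where the
   hermitian matrix [chord f d A] is positive. *)
Lemma spec_proj_smooth i j : (i < j)%N ->
  smooth_mx (Vcover i `&` Vcover j) (fun A => spec_proj i j A).
Proof.
move=> ij a b; apply: smooth_on_local => A0 [V0i V0j].
have [sA0 ai] := V0i; have [_ aj] := V0j; have [al _] := ai.
have [gi I1 I2 I3 I4] := alcove_at_gap ai; have [gj J1 J2 J3 J4] := alcove_at_gap aj.
set li := q A0 0 i in gi I1 I2 I3 I4; set ni := lam_next (q A0) i in gi I2 I3.
set lj := q A0 0 j in gj J1 J2 J3 J4; set nj := lam_next (q A0) j in gj J2 J3.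
have ji : lj <= ni by exact: I2.
have ij1 : li - 1 <= nj by exact: J3.
(* The ends of the arc are the midpoints of the gaps after i and after j at [A0]. A perturbation by
   at most a quarter of each gap leaves them inside the gaps, so the same arc serves near [A0]. *)
pose c1 := (li + ni) / 2; pose c2 := (lj + nj) / 2.
pose e := Num.min ((li - ni) / 4) ((lj - nj) / 4).
have e0 : 0 < e by rewrite lt_min !divr_gt0// subr_gt0.
have ei : e <= (li - ni) / 4 by rewrite ge_min lexx.
have ej : e <= (lj - nj) / 4 by rewrite ge_min lexx orbT.
have [D [oD DA H]] := q_continuous sA0 e0.
exists D; split=> //.
set f := (c1 + c2) / 2; set d := (c1 - c2) / 2.
have c1E : c1 = f + d by rewrite /f /d; lra.
have c2E : c2 = f - d by rewrite /f /d; lra.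
have d0 : 0 < d by rewrite /d /c1 /c2; lra.
have d1 : d < 2^-1 by rewrite /d /c1 /c2; lra.
pose S := (Vcover i `&` Vcover j) `&` (@reim R n @^-1` D).
have key A : S A -> [/\ (chord f d A)^t* = chord f d A, chord f d A \in unitmx &
    spec_proj i j A = 2^-1 *: (signmx (chord f d A) + 1%:M)].
  move=> [[Vi Vj] DA']; have [sA Ai] := Vi; have [_ Aj] := Vj; have [alA _] := Ai.
  have [g dA] := q_diagonalizes n0 sA; have [sg _ _] := dA.
  have Hq := H A sA DA'.
  have [_ I1' I2' I3' I4'] := alcove_at_gap Ai; have [_ J1' J2' J3' J4'] := alcove_at_gap Aj.
  have hi := Hq i; have hj := Hq j.
  have hni := lam_next_close i Hq; have hnj := lam_next_close j Hq.
  move: hi hj hni hnj; rewrite -/li -/lj -/ni -/nj !ler_norml.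
  move=> /andP[hi1 hi2] /andP[hj1 hj2] /andP[hni1 hni2] /andP[hnj1 hnj2].
  pose w : 'rV[R]_n := \row_k (2 * cos (2 * pi * (q A 0 k - f)) - 2 * cos (2 * pi * d)).
  have wP k : if (i < k <= j)%N then 0 < w 0 k else w 0 k < 0.
    rewrite mxE; case: ifP => kij.
      case/andP: kij => ik kj; have := I2' k ik; have := J1' k kj => k1 k2.
      rewrite subr_gt0 ltr_pM2l// cos_arc_in ?(ltW d1)//.
      rewrite ltr_norml; apply/andP; split; move: c1E c2E; rewrite /c1 /c2; lra.
    rewrite subr_lt0 ltr_pM2l//.
    have [ki|ik] := leqP k i.
      have k1 := I1' k ki; have k2 := J3' k.
      have x0 : 0 < q A 0 k - f by move: c1E c2E; rewrite /c1 /c2; lra.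
      by apply: cos_arc_out => //; rewrite ger0_norm ?(ltW x0)//; move: c1E c2E; rewrite /c1 /c2; lra.
    have jk : (j < k)%N by rewrite ltnNge; move: kij; rewrite ik /= => ->.
    have k1 := J2' k jk; have k2 := I4' k.
    have x0 : q A 0 k - f < 0 by move: c1E c2E; rewrite /c1 /c2; lra.
    by apply: cos_arc_out => //; rewrite ltr0_norm//; move: c1E c2E; rewrite /c1 /c2; lra.
  have cE : chord f d A = Ad g (diag_mx (map_mx (real_complex R) w)).
    rewrite (chordE f d dA); congr (Ad g (diag_mx _)); apply/rowP => k; by rewrite !mxE.
  have ug' : g^t* \is unitarymx by rewrite trmxC_unitary; exact: SU_unitary.
  have wr k : (map_mx (real_complex R) w) 0 k \is Num.real by rewrite mxE complex_real.
  have hH : (chord f d A)^t* = chord f d A.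
    by rewrite cE; have := unitary_diag_hermitian ug' wr; rewrite trmxCK.
  have uH : chord f d A \in unitmx.
    rewrite unitmxE unitfE cE /Ad !det_mulmx mulrAC -det_mulmx (SU_mulmxV sg) det1 mul1r.
    rewrite det_diag prodf_seq_neq0; apply/allP => k _ /=.
    rewrite mxE eq_complex /= eqxx andbT; have := wP k; case: ifP => _ h.
      by rewrite gt_eqF.
    by rewrite lt_eqF.
  split=> //.
  pose s : 'rV[C]_n := \row_k (if (i < k <= j)%N then 1 else -1).
  have sE : signmx (chord f d A) = Ad g (diag_mx s).
    apply: (signmxE hH uH); rewrite cE /Ad.
    have := sign_diag ug' wr (s := s); rewrite trmxCK; apply=> k.
    rewrite [s 0 k]mxE [(map_mx _ _) 0 k]mxE lecR; have := wP k; case: ifP => _ h.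
      by rewrite (ltW h).
    by rewrite leNgt h.
  rewrite (spec_projE ij Vi Vj dA) sE -(Ad_scalar 1 sg) -AdD -AdZ; congr (Ad g _).
  apply/matrixP => k l; rewrite !mxE; case: eqP => _; last by rewrite !mulr0n addr0 mulr0.
  rewrite !mulr1n; case: ifP => _; last by rewrite addNr mulr0.
  by rewrite -mulr2n mulVf// pnatr_eq0.
apply: (@smooth_on_eq _ _ _ (fun A => (2^-1 *: (signmx (chord f d A) + 1%:M)) a b)).
  by move=> A SA; have [_ _ ->] := key A SA.
move: a b; change (smooth_mx S (fun A => 2^-1 *: (signmx (chord f d A) + 1%:M))).
have sign_chord : smooth_mx S (fun A => signmx (chord f d A)).
  move=> a b; apply: (@smooth_on_comp _ _ _ _ (fun X => signmx X a b) (chord f d) _ (@smooth_signmx R n a b)).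
    by move=> A SA; have [hH uH _] := key A SA.
  apply: smooth_submx; last exact: smooth_mx_cst.
  by apply: smooth_addmx; apply: smooth_scalemx; [|apply: smooth_adjmx]; exact: smooth_mx_id.
apply: smooth_scalemx; apply: smooth_addmx => //; exact: smooth_mx_cst.
Qed.

End SpectralProjections.

(** * Hermitian lines *)

Section HermitianLines.
Variable R : realType.
Local Notation C := (R[i]).
Implicit Types L : hline R.

Lemma cabsM (a b : C) : cabs (a * b) = cabs a * cabs b.
Proof. exact: ComplexField.Normc.normcM. Qed.

Lemma cabs0 : cabs (0 : C) = 0. Proof. exact: ComplexField.Normc.normc0. Qed.

Lemma cabs1 : cabs (1 : C) = 1. Proof. exact: ComplexField.Normc.normc1. Qed.

Lemma cabs_ge0 (z : C) : 0 <= cabs z.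
Proof. by case: z => a b; rewrite /cabs /= sqrtr_ge0. Qed.

Lemma cabs_eq0 (z : C) : (cabs z == 0) = (z == 0).
Proof.
apply/eqP/eqP => [|->]; last exact: cabs0.
exact: ComplexField.Normc.eq0_normc.
Qed.

Lemma cabs_gt0 (z : C) : (0 < cabs z) = (z != 0).
Proof. by rewrite lt_neqAle cabs_ge0 andbT eq_sym cabs_eq0. Qed.

Lemma cabsV (z : C) : z != 0 -> cabs z^-1 = (cabs z)^-1.
Proof.
move=> z0; apply: (@mulfI _ (cabs z)); first by rewrite cabs_eq0.
by rewrite -cabsM !mulfV ?cabs1// cabs_eq0.
Qed.

Lemma cabs_real (r : R) : cabs (r%:C%C) = `|r|.
Proof. by rewrite /cabs /= expr0n /= addr0 sqrtr_sqr. Qed.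

Lemma linmapP (U V : lmodType C) (f : linmap U V) : linear f.
Proof. by have /asboolP := linmap_lin f. Qed.

Lemma linmapZ (U V : lmodType C) (f : linmap U V) a u : f (a *: u) = a *: f u.
Proof.
have f0 : f 0 = 0.
  by have := linmapP f (-1) 0 0; rewrite scaler0 addr0 scaleN1r addNr.
by have := linmapP f a u 0; rewrite !addr0 f0 addr0.
Qed.

Lemma linmap_eqP (U V : lmodType C) (f g : linmap U V) : (forall u, f u = g u) -> f = g.
Proof. by move=> E; apply: val_inj; apply/funext. Qed.

Lemma linmap_scaleE (U V : lmodType C) (f : linmap U V) a u :
  (a *: f : linmap U V) u = a *: f u.
Proof. by []. Qed.

Lemma linmap_addE (U V : lmodType C) (f g : linmap U V) u :
  (f + g : linmap U V) u = f u + g u.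
Proof. by []. Qed.

Section OneLine.
Variable L : hline R.
Hypothesis hL : is_hline L.

Lemma hnormZ c (u : L) : hnorm (c *: u) = cabs c * hnorm u.
Proof. by case: hL. Qed.

Lemma hnorm_gt0 (u : L) : u != 0 -> 0 < hnorm u.
Proof. by case: hL => _ _; apply. Qed.

Lemma hnorm0 : hnorm (0 : L) = 0.
Proof. by rewrite -(scale0r (0 : L)) hnormZ cabs0 mul0r. Qed.

Lemma line_coord (u v : L) : u != 0 -> exists c, v = c *: u.
Proof.
case: hL => -[w w0 Hw] _ _ u0; have [a ua] := Hw u; have [b ->] := Hw v.
have a0 : a != 0 by apply: contraNneq u0 => a0; rewrite ua a0 scale0r.
by exists (b / a); rewrite ua scalerA divfK.
Qed.

Lemma line_coord_inj (u : L) a b : u != 0 -> a *: u = b *: u -> a = b.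
Proof.
move=> u0 E; apply/eqP; rewrite -subr_eq0; apply: contraT => ab.
have : (a - b) *: u = 0 by rewrite scalerBl E subrr.
move/(congr1 (fun v => (a - b)^-1 *: v)).
by rewrite scalerA mulVf// scale1r scaler0 => E0; rewrite E0 eqxx in u0.
Qed.

Lemma line_nonzero : exists u : L, u != 0.
Proof. by case: hL => -[u u0 _] _ _; exists u. Qed.

Lemma scale_line_neq0 a (u : L) : a != 0 -> u != 0 -> a *: u != 0.
Proof.
move=> a0 u0; apply: contraNneq u0 => E; rewrite -[u]scale1r -(mulVf a0) -scalerA E.
by rewrite scaler0.
Qed.

End OneLine.

Lemma line_hom_exists L L' (u : L) (u' : L') : is_hline L -> u != 0 ->
  exists f : linmap L L', f u = u'.
Proof.
move=> hL u0; have /choice[c Hc] : forall v : L, exists c, v = c *: u.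
  by move=> v; apply: line_coord.
have lf : (fun v => c v *: u') \in @linear_pred C L L'.
  apply/asboolP => a v w /=; rewrite scalerA -scalerDl; congr (_ *: _).
  by apply: (line_coord_inj u0); rewrite -Hc scalerDl -scalerA -!Hc.
exists (Linmap lf) => /=; have -> : c u = 1.
  by apply: (line_coord_inj u0); rewrite -Hc scale1r.
by rewrite scale1r.
Qed.

(** Unit vectors of a line differ by phases, so the supremum defining the operator norm runs over a
    single value. *)
Lemma hom_lineE L L' (f : hom_line L L') (u : L) : is_hline L -> is_hline L' ->
  u != 0 -> hnorm f = hnorm ((f : linmap L L') u) / hnorm u.
Proof.
move=> hL hL' u0; have nu := hnorm_gt0 hL u0; rewrite /hnorm /=.
set r := (X in _ = X); rewrite (_ : [set _ | _ in _] = [set r]) ?sup1//.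
have u1 : hnorm (((hnorm u)^-1)%:C%C *: u) = 1.
  by rewrite (hnormZ hL) cabs_real gtr0_norm ?invr_gt0// mulVf ?gt_eqF.
apply/seteqP; split=> [x [v /= v1 <-]|x ->].
  have [c Ec] := line_coord hL v u0; rewrite Ec linmapZ (hnormZ hL') /r.
  have : cabs c * hnorm u = 1 by rewrite -(hnormZ hL) -Ec.
  by move/(canRL (mulfK (lt0r_neq0 nu))); rewrite mul1r => ->; rewrite mulrC.
exists (((hnorm u)^-1)%:C%C *: u) => //.
by rewrite linmapZ (hnormZ hL') cabs_real gtr0_norm ?invr_gt0// mulrC.
Qed.

Lemma hom_line_hline L L' : is_hline L -> is_hline L' -> is_hline (hom_line L L').
Proof.
move=> hL hL'; have [u u0] := line_nonzero hL; have [u' u0'] := line_nonzero hL'.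
have [f fu] := line_hom_exists u' hL u0.
have nu := hnorm_gt0 hL u0.
split.
- exists f => [|g].
    by apply: contraNneq u0' => f0; rewrite -fu f0.
  have [c Ec] := line_coord hL' ((g : linmap L L') u) u0'; exists c.
  apply: linmap_eqP => v; have [b ->] := line_coord hL v u0.
  by rewrite linmap_scaleE !linmapZ fu Ec scalerA mulrC -scalerA.
- move=> c g; rewrite !(hom_lineE _ hL hL' u0) linmap_scaleE (hnormZ hL') mulrA //.
move=> g g0; rewrite (hom_lineE _ hL hL' u0) divr_gt0// hnorm_gt0//.
apply: contraNneq g0 => E; apply/eqP; apply: linmap_eqP => v.
by have [b ->] := line_coord hL v u0; rewrite linmapZ E scaler0.
Qed.

Lemma unit_line_hline : is_hline (unit_line R).
Proof.
split.
- exists (1 : C^o) => [|v]; first exact: oner_neq0.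
  by exists v; rewrite /GRing.scale /= mulr1.
- by move=> c u; rewrite -cabsM.
by move=> u; rewrite -cabs_gt0.
Qed.

Lemma dual_line_hline L : is_hline L -> is_hline (dual_line L).
Proof. by move=> hL; apply: hom_line_hline => //; apply: unit_line_hline. Qed.

Lemma tens_line_hline L L' : is_hline L -> is_hline L' -> is_hline (tens_line L L').
Proof. by move=> hL hL'; apply: hom_line_hline => //; apply: dual_line_hline. Qed.

Lemma line_invE L (u : L) : is_hline L -> u != 0 ->
  (line_inv u : linmap L (unit_line R)) u = (1 : C).
Proof.
move=> hL u0; rewrite /line_inv.
have [f fu] := line_hom_exists (L' := unit_line R) (1 : C^o) hL u0.
by apply: (@xgetI _ 0 [set f : dual_line L | (f : linmap L (unit_line R)) u = (1 : C)] f).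
Qed.

Lemma line_inv_neq0 L (u : L) : is_hline L -> u != 0 -> line_inv u != 0.
Proof.
move=> hL u0; have := line_invE hL u0; case: eqVneq => // -> /= E.
by have := oner_neq0 C; rewrite -E eqxx.
Qed.

Lemma line_invZ L (u : L) a : is_hline L -> u != 0 -> a != 0 ->
  line_inv (a *: u) = a^-1 *: line_inv u.
Proof.
move=> hL u0 a0; have au0 : a *: u != 0 by exact: scale_line_neq0.
apply: linmap_eqP => v; have [b ->] := line_coord hL v au0.
rewrite linmap_scaleE [LHS]linmapZ (line_invE hL au0) !linmapZ (line_invE hL u0).
by rewrite /GRing.scale /= !mulr1 mulrCA mulVf// mulr1.
Qed.

Lemma hnorm_line_inv L (u : L) : is_hline L -> u != 0 ->
  hnorm (line_inv u) = (hnorm u)^-1.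
Proof.
move=> hL u0; rewrite (hom_lineE _ hL unit_line_hline u0) line_invE//.
by rewrite [X in X / _](_ : _ = 1) ?mul1r//; exact: cabs1.
Qed.

Lemma ptensE L L' (u : L) (u' : L') (f : dual_line L) :
  (ptens u u' : linmap (dual_line L) L') f = ((f : linmap L (unit_line R)) u : C) *: u'.
Proof. by []. Qed.

Lemma ptensZl L L' (u : L) (u' : L') a : ptens (a *: u) u' = a *: ptens u u'.
Proof.
by apply: linmap_eqP => f; rewrite linmap_scaleE !ptensE linmapZ scalerA.
Qed.

Lemma ptensZr L L' (u : L) (u' : L') a : ptens u (a *: u') = a *: ptens u u'.
Proof.
by apply: linmap_eqP => f; rewrite linmap_scaleE !ptensE !scalerA mulrC.
Qed.

(** The functional [line_inv u] spans the dual line, so its image determines s; any nonzero u can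
    serve as the left factor. *)
Lemma tens_line_pure L L' (s : tens_line L L') (u : L) : is_hline L -> u != 0 ->
  s = ptens u ((s : linmap (dual_line L) L') (line_inv u)).
Proof.
move=> hL u0; apply: linmap_eqP => f.
have [c ->] := line_coord (dual_line_hline hL) f (line_inv_neq0 hL u0).
by rewrite !linmapZ ptensE (line_invE hL u0) scale1r.
Qed.

Lemma ptens_neq0 L L' (u : L) (u' : L') : is_hline L -> u != 0 -> u' != 0 ->
  ptens u u' != 0.
Proof.
move=> hL u0; apply: contraNneq => E.
have := ptensE u u' (line_inv u); rewrite E (line_invE hL u0) scale1r => <-.
by [].
Qed.

Lemma hnorm_ptens L L' (u : L) (u' : L') : is_hline L -> is_hline L' ->
  hnorm (ptens u u') = hnorm u * hnorm u'.
Proof.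
move=> hL hL'; have [->|u0] := eqVneq u 0.
  rewrite -(scale0r (0 : L)) ptensZl scale0r (hnorm0 (tens_line_hline hL hL')).
  by rewrite scale0r (hnorm0 hL) mul0r.
rewrite (hom_lineE _ (dual_line_hline hL) hL' (line_inv_neq0 hL u0)).
by rewrite ptensE line_invE// scale1r hnorm_line_inv// invrK mulrC.
Qed.

End HermitianLines.

(** * Local sections of SU(n) over an orbit *)

Section LocalSections.
Variables (R : realType) (n : nat).
Hypothesis n0 : (0 < n)%N.
Local Notation C := (R[i]).
Local Notation Mat := ('M[C]_n).
Variables (S : set Mat) (P : Mat -> Mat) (w : 'rV[C]_n).
Local Notation W := (diag_mx w).

(** The state of a Gram-Schmidt process carried out smoothly in A: the columns of M are eigenvectors
    of P A, and the first k are orthonormal. *)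
Definition partial_frame (k : nat) (M : Mat -> Mat) : Prop :=
  smooth_mx S M /\ forall A, S A -> [/\ \det (M A) != 0, P A *m M A = M A *m W &
    forall a b : 'I_n, (a < k)%N -> (b < k)%N -> ((M A)^t* *m M A) a b = (a == b)%:R].

Lemma gram_schmidt_step k M : (forall A, S A -> (P A)^t* = P A) ->
  (forall a, (w 0 a)^* = w 0 a) -> (k < n)%N ->
  partial_frame k M -> exists M', partial_frame k.+1 M'.
Proof.
move=> hP hw kn [sM HM]; pose K := Ordinal kn.
pose G A := (M A)^t* *m M A.
have sG : smooth_mx S G by apply: smooth_mulmx => //; apply: smooth_adjmx.
(* The coordinates, in the columns of [M A], of the column [K] minus its projection onto the
   orthonormal columns before it. *)
pose t A : 'cV[C]_n := \col_a (if a == K then 1 else if (a < k)%N then - G A a K else 0).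
have st : smooth_mx S t.
  move=> a b; apply: (@smooth_on_eq _ _ _ (fun A => if a == K then 1 else if (a < k)%N then - G A a K else 0)).
    by move=> A _; rewrite [RHS]mxE.
  case: (a == K); first exact: smooth_on_cst.
  by case: (a < k)%N; [apply: smooth_onN|exact: smooth_on_cst].
pose c A := M A *m t A.
have sc : smooth_mx S c by exact: smooth_mulmx.
pose N A : C := ((c A)^t* *m c A) 0 0.
have sN : smooth_on S N by apply: (smooth_mulmx (smooth_adjmx sc) sc).
have NE A : N A = \sum_r `|c A r 0| ^+ 2.
  by rewrite /N mxE; apply: eq_bigr => r _; rewrite adjE normCK mulrC.
have N0 A : S A -> 0 < N A.
  move=> SA; have [d _ _] := HM A SA.
  rewrite lt_neqAle NE sumr_ge0 ?andbT => [|r _]; last by rewrite exprn_ge0.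
  apply: (contra_neqN _ (oner_neq0 C)); rewrite eq_sym.
  rewrite psumr_eq0 => [/allP H|r _]; last by rewrite exprn_ge0.
  have c0 : c A = 0.
    apply/colP => r; rewrite [RHS]mxE; apply/eqP; rewrite -normr_eq0 -sqrf_eq0.
    by apply: H; rewrite mem_index_enum.
  have uM : M A \in unitmx by rewrite unitmxE unitfE.
  have t0 : t A = 0 by rewrite -(mulKmx uM (t A)) -/(c A) c0 mulmx0.
  by have := congr1 (fun v : 'cV_n => v K 0) t0; rewrite !mxE eqxx.
pose s A : C := ((Num.sqrt (complex.Re (N A)))%:C%C)^-1.
have NR A : S A -> N A = (complex.Re (N A))%:C%C.
  by move=> SA; have /ger0_real/RRe_real <- := ltW (N0 A SA).
have ReN A : S A -> 0 < complex.Re (N A).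
  by move=> SA; have := N0 A SA; rewrite {1}(NR A SA) ltcR.
have ss : smooth_on S s.
  apply: smooth_onV => [A SA|]; last exact: smooth_on_sqrt.
  by rewrite eq_complex /= eqxx andbT gt_eqF// sqrtr_gt0 ReN.
have s0 A : S A -> 0 < s A by move=> SA; rewrite invr_gt0 ltcR sqrtr_gt0 ReN.
have sN1 A : S A -> s A * s A * N A = 1.
  move=> SA; rewrite (NR A SA) /s -invfM -rmorphM /= -expr2 sqr_sqrtr ?(ltW (ReN A SA))//.
  by rewrite mulVf// eq_complex /= eqxx andbT gt_eqF// ReN.
pose T A : Mat := \matrix_(a, b) (if b == K then s A * t A a 0 else (a == b)%:R).
have sT : smooth_mx S T.
  move=> a b; apply: (@smooth_on_eq _ _ _ (fun A => if b == K then s A * t A a 0 else (a == b)%:R)).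
    by move=> A _; rewrite [RHS]mxE.
  by case: (b == K); [apply: smooth_onM|exact: smooth_on_cst].
exists (fun A => M A *m T A); split; first exact: smooth_mulmx.
move=> A SA; have [d PM ort] := HM A SA.
have colK a : (M A *m T A) a K = s A * c A a 0.
  rewrite mxE [in RHS]mxE mulr_sumr; apply: eq_bigr => b _.
  by rewrite [T A b K]mxE eqxx mulrCA.
have coln a b : b != K -> (M A *m T A) a b = M A a b.
  move=> bK; rewrite mxE (bigD1 b)//= [T A b b]mxE (negbTE bK) eqxx mulr1.
  rewrite big1 ?addr0// => l lb; rewrite [T A l b]mxE (negbTE bK) (negbTE lb) mulr0.
  by [].
have GK (a : 'I_n) : (a < k)%N -> \sum_r (M A r a)^* * c A r 0 = 0.
  move=> ak; have -> : \sum_r (M A r a)^* * c A r 0 = (G A *m t A) a 0.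
    by rewrite /G -mulmxA [RHS]mxE; apply: eq_bigr => r _; rewrite adjE.
  rewrite mxE (bigD1 K)//= [t A K 0]mxE eqxx mulr1.
  have aK : a != K by rewrite -val_eqE /= ltn_eqF.
  rewrite (bigD1 a)//= [t A a 0]mxE (negbTE aK) ak [G A a a]ort// eqxx mul1r.
  rewrite big1 ?addr0 ?subrr// => b /andP[bK ba]; rewrite [t A b 0]mxE (negbTE bK).
  case: ifP => [bk|_]; last by rewrite mulr0.
  by rewrite [G A a b]ort// eq_sym (negbTE ba) mul0r.
have gram a b : ((M A *m T A)^t* *m (M A *m T A)) a b =
    \sum_r ((M A *m T A) r a)^* * (M A *m T A) r b.
  by rewrite mxE; apply: eq_bigr => r _; rewrite adjE.
have ltk (a : 'I_n) : (a < k.+1)%N -> a != K -> (a < k)%N.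
  by rewrite ltnS leq_eqVlt -val_eqE /= => /orP[->|].
have orK (a : 'I_n) : (a < k)%N -> \sum_r ((M A *m T A) r a)^* * (M A *m T A) r K = 0.
  move=> ak; have aK : a != K by rewrite -val_eqE /= ltn_eqF.
  rewrite (eq_bigr (fun r => s A * ((M A r a)^* * c A r 0))) => [|r _].
    by rewrite -mulr_sumr GK// mulr0.
  by rewrite coln// colK mulrCA.
split.
- rewrite det_mulmx mulf_neq0//.
  have -> : \det (T A) = s A.
    rewrite -det_tr det_trig.
      rewrite (bigD1 K)//= big1 => [|a aK].
        by rewrite mulr1 !mxE !eqxx mulr1.
      by rewrite mxE mxE (negbTE aK) eqxx.
    apply/is_trig_mxP => a b ab; rewrite mxE mxE.
    have [aK|aK] := eqVneq a K.
      have kb : (k < b)%N by move: ab; rewrite aK.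
      have bK : b != K by rewrite -val_eqE /= gtn_eqF.
      by rewrite [t A b 0]mxE (negbTE bK) ltnNge (ltnW kb) mulr0.
    by rewrite -val_eqE gtn_eqF.
  by rewrite gt_eqF// s0.
(* Eigenvectors of the hermitian [P A] for different eigenvalues are orthogonal, so the correction
   mixes only columns of one eigenvalue and [T A] commutes with the diagonal matrix. *)
- have GW a : G A a K * w 0 K = w 0 a * G A a K.
    have : (M A)^t* *m (P A *m M A) = ((P A *m M A)^t*) *m M A by rewrite adjM hP// mulmxA.
    rewrite PM adjM adj_diag mulmxA -[RHS]mulmxA => /matrixP/(_ a K).
    by rewrite mul_mx_diag mul_diag_mx mxE [RHS]mxE [in RHS]mxE hw.
  have TW : T A *m W = W *m T A.
    rewrite mul_mx_diag mul_diag_mx; apply/matrixP => a b; rewrite [LHS]mxE [RHS]mxE [T A a b]mxE.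
    case: eqP => [->|_]; last first.
      by case: eqP => [->|_]; rewrite ?mul0r ?mulr0// mulrC.
    rewrite [t A a 0]mxE; case: eqP => [->|_]; first by rewrite mulrC.
    case: ifP => _; last by rewrite !mulr0 mul0r.
    by rewrite !mulrN mulNr -mulrA GW; congr (- _); ring.
  by rewrite mulmxA PM -mulmxA -TW mulmxA.
move=> a b ak bk; rewrite gram.
have [aK|aK] := eqVneq a K; have [bK|bK] := eqVneq b K.
- rewrite aK bK eqxx; rewrite (eq_bigr (fun r => s A * s A * `|c A r 0| ^+ 2)) => [|r _].
    by rewrite -mulr_sumr -NE sN1.
  rewrite colK rmorphM /= (CrealP (gtr0_real (s0 _ SA))) normCK; ring.
- rewrite aK (eq_bigr (fun r => (((M A *m T A) r b)^* * (M A *m T A) r K)^*)) => [|r _].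
    by rewrite -rmorph_sum /= orK ?rmorph0 ?[K == b]eq_sym ?(negbTE bK)//; apply: ltk.
  by rewrite rmorphM /= conjCK mulrC.
- by rewrite bK orK ?(negbTE aK)//; apply: ltk.
rewrite (eq_bigr (fun r => (M A r a)^* * M A r b)) => [|r _]; last by rewrite !coln.
rewrite -(ort a b (ltk _ ak aK) (ltk _ bk bK)) [RHS]mxE.
by apply: eq_bigr => r _; rewrite adjE.
Qed.

Lemma frame_complete M : (forall A, S A -> (P A)^t* = P A) ->
  (forall a, (w 0 a)^* = w 0 a) -> partial_frame 0 M ->
  exists g, smooth_mx S g /\ forall A, S A -> SU (g A) /\ P A = Ad (g A) W.
Proof.
move=> hP hw pM.
have [M' [sM' HM']] : exists M', partial_frame n M'.
  suff: forall k, (k <= n)%N -> exists M', partial_frame k M' by apply.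
  elim=> [|k IH] kn; first by exists M.
  by have [M1 /(gram_schmidt_step hP hw kn)] := IH (ltnW kn).
have uM A : S A -> M' A \is unitarymx.
  move=> SA; have [_ _ H] := HM' A SA; apply/unitarymxP; apply: mulmx1C.
  by apply/matrixP => a b; rewrite H// mxE.
pose z := Ordinal n0.
(* A phase on the first column brings the determinant to 1; it depends smoothly on [A] and commutes
   with diagonal matrices. *)
pose f A : 'rV[C]_n := \row_k (if k == z then (\det (M' A))^* else 1).
have nd A : S A -> `|\det (M' A)| = 1.
  move=> SA; have := congr1 (fun X : Mat => \det X) (unitary_mulmxV (uM A SA)).
  by rewrite det_mulmx det_adj det1 -normCK => /eqP; rewrite sqrp_eq1// => /eqP.
have uf A : S A -> diag_mx (f A) \is unitarymx.
  move=> SA; apply/unitarymxP; rewrite adj_diag mulmx_diag.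
  rewrite (_ : (\row__ _) = const_mx 1) ?diag_const_mx//.
  apply/rowP => k; rewrite !mxE -normCK; case: ifP => _; last by rewrite normr1 expr1n.
  by rewrite norm_conjC nd// expr1n.
exists (fun A => M' A *m diag_mx (f A)); split.
  apply: smooth_mulmx => // a b.
  apply: (@smooth_on_eq _ _ _ (fun A => if a == b then f A 0 a else 0)) => [A _|].
    by rewrite [RHS]mxE; case: eqP => // ->.
  case: (a == b); last exact: smooth_on_cst.
  apply: (@smooth_on_eq _ _ _ (fun A => if a == z then (\det (M' A))^* else 1)) => [A _|].
    by rewrite mxE.
  case: (a == z); last exact: smooth_on_cst.
  by apply: smooth_on_conj; apply: smooth_det.
move=> A SA; have [_ PM _] := HM' A SA; split.
  split; first exact: (mul_unitarymx (uM A SA) (uf A SA)).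
  rewrite det_mulmx det_diag (bigD1 z)//= big1 => [|k kz]; last by rewrite mxE (negbTE kz).
  by rewrite mxE eqxx mulr1 -normCK nd// expr1n.
rewrite AdM; have -> : Ad (diag_mx (f A)) W = W.
  by rewrite /Ad diag_mxC -mulmxA (unitary_mulmxV (uf A SA)) mulmx1.
by rewrite /Ad -PM -mulmxA (unitary_mulmxV (uM A SA)) mulmx1.
Qed.

End LocalSections.

(** * Smooth local lifts of a family of projections to SU(n) *)

Section ProjectionSections.
Variables (R : realType) (n : nat).
Hypothesis n0 : (0 < n)%N.
Local Notation C := (R[i]).
Local Notation Mat := ('M[C]_n).
Local Notation VV := ('M[R]_n * 'M[R]_n)%type.

Lemma coord_proj_idem (i j : 'I_n) :
  coord_proj R i j *m coord_proj R i j = coord_proj R i j.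
Proof.
rewrite mulmx_diag; congr diag_mx; apply/rowP => k; rewrite !mxE.
by case: (_ && _); rewrite ?mulr1 ?mulr0.
Qed.

Lemma coord_proj_adj (i j : 'I_n) : (coord_proj R i j)^t* = coord_proj R i j.
Proof.
rewrite adj_diag; congr diag_mx; apply/rowP => k; rewrite !mxE.
by rewrite rmorph_nat.
Qed.

Lemma local_section (S : set Mat) (P : Mat -> Mat) (i j : 'I_n) A0 :
  smooth_mx S P -> (forall A, S A -> exists2 g, SU g & P A = Ad g (coord_proj R i j)) ->
  S A0 -> exists (D : set VV) g, [/\ open D, D (reim A0),
    smooth_mx (S `&` (@reim R n @^-1` D)) g &
    forall A, S A -> D (reim A) -> SU (g A) /\ P A = Ad (g A) (coord_proj R i j)].
Proof.
move=> sP HP SA0; set W := coord_proj R i j in HP *.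
have hP A : S A -> (P A)^t* = P A.
  by move=> /HP[g _ ->]; rewrite Ad_adj coord_proj_adj.
have PP A : S A -> P A *m P A = P A.
  by move=> /HP[g sg ->]; rewrite -(Ad_mul _ _ sg) coord_proj_idem.
have [g0 sg0 P0] := HP _ SA0.
(* P g0 W + (1 - P) g0 (1 - W): it intertwines [P A] with [W], equals [g0] at [A0] and is therefore
   invertible nearby; Gram-Schmidt makes it special unitary. *)
pose B A := P A *m (g0 *m W) + (g0 *m (1%:M - W) - P A *m (g0 *m (1%:M - W))).
have sB : smooth_mx S B.
  apply: smooth_addmx; first by apply: smooth_mulmx => //; exact: smooth_mx_cst.
  apply: smooth_submx; first exact: smooth_mx_cst.
  by apply: smooth_mulmx => //; exact: smooth_mx_cst.
have [D oD ED] := open_in_neq0 (smooth_det sB).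
have B0 : B A0 = g0.
  have E : P A0 *m (g0 *m W) = g0 *m W.
    by rewrite P0 /Ad -mulmxA [_^t* *m _]mulmxA (SU_mulVmx sg0) mul1mx -mulmxA coord_proj_idem.
  have E' : P A0 *m (g0 *m (1%:M - W)) = 0.
    rewrite P0 /Ad -mulmxA [_^t* *m _]mulmxA (SU_mulVmx sg0) mul1mx -mulmxA.
    by rewrite mulmxBr mulmx1 coord_proj_idem subrr mulmx0.
  by rewrite /B E E' subr0 -mulmxDr addrC subrK mulmx1.
have detS A : S A -> D (reim A) -> \det (B A) != 0.
  by move=> SA DA; have : (S `&` (@reim R n @^-1` D)) A by []; rewrite -ED => -[].
have D0 : D (reim A0).
  have : (S `&` [set A | \det (B A) != 0]) A0.
    by split=> //=; rewrite B0; have [_ ->] := sg0; exact: oner_neq0.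
  by rewrite ED => -[].
have PB A : S A -> P A *m B A = B A *m W.
  move=> SA; rewrite /B mulmxDr mulmxBr !mulmxA PP// subrr addr0.
  rewrite mulmxDl -!mulmxA coord_proj_idem mulmxBl -!mulmxA mulmxBl mul1mx coord_proj_idem.
  by rewrite subrr !mulmx0 subrr addr0.
pose S' := S `&` (@reim R n @^-1` D).
have pf : partial_frame S' P (\row_k (i < k <= j)%:R) 0 B.
  split; first by apply: smooth_mx_sub sB => A [].
  move=> A [SA DA]; split=> //; [exact: detS|exact: PB].
have [||g [sg Hg]] := frame_complete n0 _ _ pf.
- by move=> A [SA _]; apply: hP.
- by move=> a; rewrite mxE rmorph_nat.
by exists D, g; split=> // A SA DA; apply: Hg.
Qed.

End ProjectionSections.

(** * The character of weight mu_j - mu_i *)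

Section Codiagonalization.
Variables (F : numClosedFieldType) (n : nat).
Local Notation Mat := ('M[F]_n).

(** A, its adjoint and P commute and are made triangular by one unitary matrix; a triangular matrix
    whose adjoint is triangular in the same sense is diagonal. *)
Lemma codiagonalization (A P : Mat) : A *m A^t* = A^t* *m A -> P^t* = P ->
  A *m P = P *m A -> exists (U : Mat) d p, [/\ U \is unitarymx,
    A = U *m diag_mx d *m (U^t*) & P = U *m diag_mx p *m (U^t*)].
Proof.
move=> cAA hP cAP.
have cAP' : A^t* *m P = P *m A^t*.
  by have := congr1 (fun X : Mat => X^t*) cAP; rewrite !adjM hP => ->.
have [|V uV /allP VP] := @cotrigonalization _ n [:: A; A^t*; P].
  by move=> X Y; rewrite !inE => /or3P[]/eqP-> /or3P[]/eqP->; rewrite /comm_mx.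
have trig X : X \in [:: A; A^t*; P] -> is_trig_mx (V *m X *m V^t*).
  by move=> /VP; rewrite /= /similar_to/= conjumx ?unitarymx_unit// invmx_unitary.
have diagX X : X \in [:: A; A^t*; P] -> X^t* \in [:: A; A^t*; P] ->
    exists d, X = V^t* *m (diag_mx d) *m V^t*^t*.
  move=> /trig/is_trig_mxP tX /trig/is_trig_mxP tX'.
  have : is_diag_mx (V *m X *m V^t*).
    apply/is_diag_mxP => a b; rewrite neq_ltn => /orP[/tX//|ba].
    have := tX' b a ba; have -> : V *m X^t* *m V^t* = (V *m X *m V^t*)^t*.
      by rewrite !adjM trmxCK mulmxA.
    by rewrite adjE => /eqP; rewrite conjC_eq0 => /eqP.
  move=> /diag_mxP[d E]; exists d; rewrite -E trmxCK !mulmxA (unitary_mulVmx uV) mul1mx.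
  by rewrite -mulmxA (unitary_mulVmx uV) mulmx1.
have [|//|d hd] := diagX A; first by rewrite !inE eqxx ?orbT.
  by rewrite !inE eqxx ?orbT.
have [|//|p Pp] := diagX P; first by rewrite !inE eqxx ?orbT.
  by rewrite ?hP !inE eqxx ?orbT.
by exists (V^t*), d, p; split=> //; rewrite trmxC_unitary.
Qed.

End Codiagonalization.

(** * The element omega_ij(g) and the character of the stabilizer *)

Section FrameWedge.
Variables (R : realType) (n : nat).
Hypothesis n0 : (0 < n)%N.
Local Notation C := (R[i]).
Local Notation Mat := ('M[C]_n).
Local Notation vec := {ffun 'I_n -> C^o}.
Local Notation ext := {ffun {set 'I_n} -> C^o}.
Implicit Types (g h : Mat) (i j k l : 'I_n).

Definition colvec g k : vec := [ffun a => g a k].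

Definition block i j : seq 'I_n := [seq k : 'I_n <- enum 'I_n | (i < k <= j)%N].

Lemma mem_block i j k : (k \in block i j) = (i < k <= j)%N.
Proof. by rewrite mem_filter mem_enum andbT. Qed.

Lemma block_uniq i j : uniq (block i j).
Proof. by rewrite filter_uniq// enum_uniq. Qed.

Definition frame_wedge i j g : ext := wedge_seq [seq colvec g k | k <- block i j].

Lemma vdot_colvec g h k l : vdot (colvec g k) (colvec h l) = (g^t* *m h) k l.
Proof. by rewrite mxE; apply: eq_bigr => a _; rewrite adjE !ffunE. Qed.

Lemma edot_frame_wedge1 i j g : SU g -> edot (frame_wedge i j g) (frame_wedge i j g) = 1.
Proof.
move=> sg; apply: edot_wedge_orthonormal; first exact: block_uniq.
by move=> k l _ _; rewrite vdot_colvec (SU_mulVmx sg) mxE.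
Qed.

Lemma frame_wedge_neq0 i j g : SU g -> frame_wedge i j g != 0.
Proof.
by move=> sg; rewrite -edot_eq0 edot_frame_wedge1// oner_eq0.
Qed.

Lemma stab_comm i j h : (i < j)%N -> stab (mu R j - mu R i) h <->
  SU h /\ h *m coord_proj R i j = coord_proj R i j *m h.
Proof.
move=> ij; rewrite /stab /= tdiag_muB//; split=> -[sh H]; split=> //.
  apply/Ad_fix_comm => //; move: H; rewrite AdB Ad_scalar//.
  by move/(congr1 (fun X => X + ((j - i)%:R / n%:R)%:M)); rewrite !subrK.
by rewrite AdB Ad_scalar//; congr (_ - _); apply/Ad_fix_comm.
Qed.

Lemma stab_mul i j g h : (i < j)%N -> stab (mu R j - mu R i) g ->
  stab (mu R j - mu R i) h -> stab (mu R j - mu R i) (g *m h).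
Proof.
move=> ij /(stab_comm _ ij)[sg cg] /(stab_comm _ ij)[sh ch]; apply/stab_comm => //.
by split; [exact: SU_mul|rewrite -mulmxA ch !mulmxA cg].
Qed.

Lemma stab_adj i j g : (i < j)%N -> stab (mu R j - mu R i) g ->
  stab (mu R j - mu R i) (g^t*).
Proof.
move=> ij /(stab_comm _ ij)[sg cg]; apply/stab_comm => //; split; first exact: SU_adj.
have := congr1 (fun X : Mat => X^t*) cg.
by rewrite !adjM coord_proj_adj => ->.
Qed.

Lemma comm_coord_proj_entry i j h k l : h *m coord_proj R i j = coord_proj R i j *m h ->
  (i < k <= j)%N != (i < l <= j)%N -> h k l = 0.
Proof.
move=> /matrixP/(_ k l); rewrite mul_mx_diag mul_diag_mx !mxE.
by case: (i < k <= j)%N; case: (i < l <= j)%N => //= + _;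
  rewrite ?mulr1 ?mulr0 ?mul1r ?mul0r => ->.
Qed.

(** The determinant of the block of h with rows and columns in ]i, j], written as a matrix
    coefficient. *)
Definition block_char i j h : C := edot (frame_wedge i j 1%:M) (frame_wedge i j h).

(** h preserves the block, so the columns of g h in the block are combinations of those of g, and
    the product stays on the line of omega(g). The coefficient is an inner product, which depends on
    the Gram matrix only and hence not on g. *)
Lemma frame_wedge_mul i j g h : (i < j)%N -> SU g -> stab (mu R j - mu R i) h ->
  frame_wedge i j (g *m h) = block_char i j h *: frame_wedge i j g.
Proof.
move=> ij sg /(stab_comm _ ij)[sh ch].
have [a E] : exists a, wedge_seq [seq colvec (g *m h) k | k <- block i j] =
    a *: wedge_seq [seq colvec g k | k <- block i j].
  apply/vlineP; apply: wedge_seq_line; last by rewrite !size_map.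
  move=> u /mapP[k kb ->].
  have -> : colvec (g *m h) k = \sum_(l <- block i j) h l k *: colvec g l.
    apply/ffunP => a; rewrite ffunE mxE sum_ffunE [RHS]big_filter big_enum_cond /=.
    rewrite (bigID (fun l : 'I_n => (i < l <= j)%N))/= [X in _ + X]big1 ?addr0.
      by apply: eq_bigr => l _; rewrite !ffunE mulrC.
    move=> l lb; rewrite (comm_coord_proj_entry ch) ?mulr0//.
    by move: kb lb; rewrite mem_block => -> /negbTE->.
  rewrite big_seq; apply: rpred_sum => l lb; apply: rpredZ; apply: memv_span.
  exact: map_f.
rewrite -[LHS]/(wedge_seq _) E; congr (_ *: _).
have := congr1 (edot (frame_wedge i j g)) E.
rewrite edotZr -/(frame_wedge i j g) edot_frame_wedge1// mulr1 => <-.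
apply: edot_wedge_gram => k l _ _.
by rewrite !vdot_colvec mulmxA (SU_mulVmx sg) adj1.
Qed.

Lemma block_char_norm i j h : (i < j)%N -> stab (mu R j - mu R i) h ->
  `|block_char i j h| = 1.
Proof.
move=> ij sh; have [SUh _] := (stab_comm h ij).1 sh.
have := edot_frame_wedge1 i j SUh.
rewrite -[h in frame_wedge i j h]mul1mx (frame_wedge_mul ij (SU1 _ _) sh).
rewrite edotZr edotC edotZr (edot_frame_wedge1 i j (SU1 _ _)) mulr1 -normCK.
by move=> /eqP; rewrite sqrp_eq1// => /eqP.
Qed.

Lemma block_charM i j g h : (i < j)%N -> stab (mu R j - mu R i) g ->
  stab (mu R j - mu R i) h -> block_char i j (g *m h) = block_char i j g * block_char i j h.
Proof.
move=> ij sg sh; have [SUg _] := (stab_comm g ij).1 sg.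
rewrite {1}/block_char (frame_wedge_mul ij SUg sh) edotZr mulrC; congr (_ * _).
Qed.

Lemma wedge_seq_scale (r : seq 'I_n) (c : 'I_n -> C) (f : 'I_n -> vec) :
  wedge_seq [seq c k *: f k | k <- r] = (\prod_(k <- r) c k) *: wedge_seq (map f r).
Proof.
elim: r => [|k r IH]; first by rewrite big_nil scale1r.
rewrite big_cons /= IH -[_ *: f k]addr0 ext_vec_linear.
have -> : @ext_vec R n 0 = 0.
  by apply/ffunP => T; rewrite !ffunE big1// => l _; rewrite ffunE.
by rewrite addr0 wedgeZl wedgeZr scalerA.
Qed.

Lemma block_char_texp i j xi : (i < j)%N -> cartan xi ->
  block_char i j (texp xi) = expi (inner (mu R j - mu R i) xi).
Proof.
move=> ij cx; rewrite /block_char /frame_wedge.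
rewrite (_ : [seq colvec (texp xi) k | k <- block i j] =
    [seq expi (xi 0 k) *: colvec 1%:M k | k <- block i j]); last first.
  apply: eq_map => k; apply/ffunP => a; rewrite !ffunE !mxE /=.
  by have [->|_] := eqVneq a k; [rewrite mulr1n /GRing.scale /= mulr1|rewrite mulr0n scaler0].
rewrite wedge_seq_scale edotZr -/(frame_wedge i j 1%:M) (edot_frame_wedge1 i j (SU1 _ _)).
rewrite mulr1 -expi_sum; congr expi.
rewrite big_filter big_enum_cond /= /inner.
rewrite [RHS](eq_bigr (fun k => (i < k <= j)%:R * xi 0 k - (j - i)%:R / n%:R * xi 0 k)).
  rewrite sumrB -mulr_sumr cx mulr0 subr0 big_mkcond /=.
  by apply: eq_bigr => k _; case: (_ && _); rewrite ?mul1r ?mul0r.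
by move=> k _; rewrite muBE// mulrBl.
Qed.

Lemma block_char_weight i j : (i < j)%N ->
  has_weight (mu R j - mu R i) (block_char i j).
Proof.
move=> ij; split.
- by move=> h sh; apply: (fmorph_inj (real_complex R)); rewrite /= cabs_normr block_char_norm.
- by move=> g h sg sh; apply: block_charM.
- by move=> xi cx; apply: block_char_texp.
Qed.

(** h and the coordinate projection are diagonalized together. The eigenvectors are then reordered
    so that the conjugating matrix itself commutes with the projection, that is, lies in the
    stabilizer. *)
Lemma stab_conj_torus i j h : (i < j)%N -> stab (mu R j - mu R i) h ->
  exists g xi, [/\ stab (mu R j - mu R i) g, cartan xi & h = Ad g (texp xi)].
Proof.
move=> ij /(stab_comm _ ij)[sh ch]; set P := coord_proj R i j in ch *.
have [||//|U [d [p [uU hd Pp]]]] := @codiagonalization _ n h P.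
- by rewrite (SU_mulVmx sh) (SU_mulmxV sh).
- exact: coord_proj_adj.
have [g sg gE] := unitary_reorder n0 uU (@inj_id 'I_n).
have gd (x : 'rV[C]_n) : Ad U (diag_mx x) = Ad g (diag_mx x).
  by rewrite gE; congr (Ad g (diag_mx _)); apply/rowP => k; rewrite mxE.
have {}hd : h = Ad g (diag_mx d) by rewrite hd; exact: gd.
have {}Pp : P = Ad g (diag_mx p) by rewrite Pp; exact: gd.
(* A nonzero entry [g k (s k)] forces the eigenvalue of the projection on column [s k] to be its
   k-th diagonal entry, so [s] is the required reordering. *)
have [s Hs] := unitary_det_perm sg.
have gs k : g k (s k) != 0.
  apply: contraTN (Hs k) => /eqP->; rewrite normr0 mulr0.
  by rewrite lt_geF// ltr01.
have ps k : p 0 (s k) = (i < k <= j)%:R.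
  have : P *m g = g *m diag_mx p.
    by rewrite Pp /Ad -mulmxA (SU_mulVmx sg) mulmx1.
  move=> /matrixP/(_ k (s k)); rewrite mul_mx_diag mul_diag_mx !mxE mulrC => E.
  by apply/esym; apply: (mulfI (gs k)).
have [g' sg' E'] := unitary_reorder n0 (SU_unitary sg) (@perm_inj _ s).
have Pg' : Ad g' P = P.
  rewrite [RHS]Pp E'; congr (Ad _ (diag_mx _)).
  by apply/rowP => k; rewrite !mxE ps.
have hd' : Ad (g'^t* ) h = diag_mx (\row_k d 0 (s k)) by rewrite hd E' AdKV.
pose d' := \row_k d 0 (s k).
have d1 k : `|d' 0 k| = 1.
  have ud : diag_mx d' \is unitarymx.
    by rewrite -hd'; apply: SU_unitary; apply: (SU_mul (SU_mul (SU_adj sg') sh)); rewrite trmxCK.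
  have /matrixP/(_ k k) := unitary_mulmxV ud.
  rewrite adj_diag mulmx_diag !mxE eqxx !mulr1n -normCK => /eqP.
  by rewrite sqrp_eq1// => /eqP.
have [t Ht] : exists t, forall k, d' 0 k = expi (t k).
  have /choice : forall k, exists x, d' 0 k = expi x by move=> k; apply: expi_surj.
  by move=> [t Ht]; exists t.
have /expi_inj[m Hm] : expi (\sum_k t k) = expi 0.
  rewrite expi0 expi_sum -(eq_bigr _ (fun k _ => Ht k)) -det_diag -hd'.
  by rewrite /Ad !det_mulmx trmxCK mulrAC -det_mulmx (SU_mulVmx sg') det1 mul1r; case: sh.
(* The logarithms of the eigenvalues sum to an integer [m] since det h = 1; subtracting it from one
   of them gives a vector of the Cartan subalgebra with the same exponential. *)
rewrite add0r in Hm; pose z := Ordinal n0.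
pose xi : 'rV[R]_n := \row_k (t k - (k == z)%:R * m%:~R).
have xE : texp xi = diag_mx d'.
  congr diag_mx; apply/rowP => k; rewrite [LHS]mxE Ht [xi 0 k]mxE.
  case: (k == z); rewrite ?mul0r ?subr0// mul1r.
  by rewrite expiD expiN expi_int rmorph1 mulr1.
exists g', xi; split.
- by apply/stab_comm => //; split=> //; apply/Ad_fix_comm.
- rewrite /cartan (eq_bigr (fun k => t k - (k == z)%:R * m%:~R)) => [|k _]; last by rewrite mxE.
  rewrite sumrB Hm; apply/eqP; rewrite subr_eq0; apply/eqP/esym.
  rewrite [LHS](bigD1 z)//= [X in _ + X]big1 => [|k /negbTE->]; last by rewrite mul0r.
  by rewrite mul1r addr0.
by rewrite xE -hd' AdK.
Qed.

(** [wchar] is some character of the given weight. Any such character is invariant under conjugation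
    within the stabilizer and prescribed on the torus, hence determined by [stab_conj_torus]. *)
Lemma wchar_block i j h : (i < j)%N -> stab (mu R j - mu R i) h ->
  wchar (mu R j - mu R i) h = block_char i j h.
Proof.
move=> ij sh; set w := mu R j - mu R i in sh *.
have : has_weight w (wchar w) by apply: xgetPex; exists (block_char i j); exact: block_char_weight.
have U chi : has_weight w chi -> forall g xi, stab w g -> cartan xi ->
    chi (Ad g (texp xi)) = expi (inner w xi).
  move=> [n1 m1 t1] g xi sg cx.
  have sg' := stab_adj ij sg; have [SUg _] := (stab_comm g ij).1 sg.
  have st : stab w (texp xi).
    apply/stab_comm => //; split; first exact: texp_SU.
    exact: diag_mxC.
  have sgt : stab w (g *m texp xi) by exact: stab_mul.
  rewrite /Ad m1// m1// t1// mulrAC -m1// (SU_mulmxV SUg).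
  have <- : texp 0 = 1%:M :> Mat.
    rewrite -diag_const_mx; congr diag_mx; apply/rowP => k; rewrite !mxE.
    exact: expi0.
  have c0 : cartan (0 : 'rV[R]_n) by apply: big1 => k _; rewrite mxE.
  rewrite t1// (_ : inner w 0 = 0) ?expi0 ?mul1r//.
  by apply: big1 => k _; rewrite [X in _ * X]mxE mulr0.
have [g [xi [sg cx ->]]] := stab_conj_torus ij sh => Hw.
by rewrite (U _ Hw)// (U _ (block_char_weight ij)).
Qed.

End FrameWedge.

(** * Bundles and gerbes embedded in the exterior algebra *)

Section Realizations.
Variables (R : realType) (n : nat).
Local Notation C := (R[i]).
Local Notation Mat := ('M[C]_n).
Local Notation V I := {ffun I -> C^o}.

Section Norms.
Variable I : finType.
Implicit Types x y : V I.

Definition fdot x y : C := \sum_i (x i)^* * y i.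

Definition l2norm x : R := Num.sqrt (\sum_i cabs (x i) ^+ 2).

Lemma fdotZr a x y : fdot x (a *: y) = a * fdot x y.
Proof. by rewrite mulr_sumr; apply: eq_bigr => i _; rewrite ffunE mulrCA. Qed.

Lemma fdotE x : fdot x x = (l2norm x ^+ 2)%:C%C.
Proof.
rewrite sqr_sqrtr ?sumr_ge0// => [|i _]; last exact: sqr_ge0.
by rewrite rmorph_sum; apply: eq_bigr => i _; rewrite mulrC -normCK rmorphXn /= cabs_normr.
Qed.

Lemma l2norm_eq0 x : (l2norm x == 0) = (x == 0).
Proof.
rewrite sqrtr_eq0 le_eqVlt ltNge sumr_ge0 ?orbF => [|i _]; last exact: sqr_ge0.
rewrite psumr_eq0 => [|i _]; last exact: sqr_ge0.
apply/allP/eqP => [H|-> i _]; last by rewrite ffunE cabs0 expr0n eqxx.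
apply/ffunP => i; rewrite ffunE; apply/eqP; rewrite -cabs_eq0 -sqrf_eq0.
by apply: H; rewrite mem_index_enum.
Qed.

Lemma l2norm_ge0 x : 0 <= l2norm x. Proof. exact: sqrtr_ge0. Qed.

Lemma l2normZ a x : l2norm (a *: x) = cabs a * l2norm x.
Proof.
rewrite /l2norm -[cabs a in RHS]ger0_norm ?cabs_ge0// -sqrtr_sqr -sqrtrM ?sqr_ge0//.
by rewrite mulr_sumr; congr Num.sqrt; apply: eq_bigr => i _; rewrite ffunE cabsM exprMn.
Qed.

Lemma fdot_neq0 x : x != 0 -> fdot x x != 0.
Proof.
by move=> x0; rewrite fdotE eq_complex /= eqxx andbT sqrf_eq0 l2norm_eq0.
Qed.

Lemma smooth_fdot S (f g : Mat -> V I) : (forall i, smooth_on S (fun A => f A i)) ->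
  (forall i, smooth_on S (fun A => g A i)) -> smooth_on S (fun A => fdot (f A) (g A)).
Proof.
by move=> sf sg; apply: smooth_on_sum => i _; apply: smooth_onM => //; exact: smooth_on_conj.
Qed.

Lemma smooth_l2norm S (f : Mat -> V I) : (forall i, smooth_on S (fun A => f A i)) ->
  (forall A, S A -> f A != 0) -> smooth_on S (fun A => (l2norm (f A))%:C%C).
Proof.
move=> sf f0; have H A : complex.Re (fdot (f A) (f A)) = l2norm (f A) ^+ 2.
  by rewrite fdotE.
apply: (@smooth_on_eq _ _ _ (fun A => (Num.sqrt (complex.Re (fdot (f A) (f A))))%:C%C)).
  by move=> A _; rewrite H sqrtr_sqr ger0_norm// l2norm_ge0.
apply: smooth_on_sqrt; last exact: smooth_fdot.
by move=> A SA; rewrite H exprn_gt0// lt_neqAle l2norm_ge0 eq_sym l2norm_eq0 f0.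
Qed.

(** The quotient of inner products (f, g)/(f, f) is the coefficient, which makes it smooth; all
    transition functions below are obtained in this way. *)
Lemma smooth_ratio S (f g : Mat -> V I) : (forall i, smooth_on S (fun A => f A i)) ->
  (forall i, smooth_on S (fun A => g A i)) -> (forall A, S A -> f A != 0) ->
  (forall A, S A -> exists c, g A = c *: f A) ->
  exists2 c, smooth_on S c & forall A, S A -> g A = c A *: f A.
Proof.
move=> sf sg f0 fg; exists (fun A => fdot (f A) (g A) * (fdot (f A) (f A))^-1).
  apply: smooth_onM; first exact: smooth_fdot.
  by apply: smooth_onV; [move=> A SA; apply: fdot_neq0; exact: f0|exact: smooth_fdot].
move=> A SA; have [c ->] := fg A SA.
by rewrite fdotZr mulfK// fdot_neq0// f0.
Qed.

End Norms.

(* Frames of an abstract atlas become vector-valued functions, so that all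
   smoothness questions concern coordinates. *)
Record realization (I : finType) (L : lbundle R n) (r : forall A, L A -> V I) : Prop :=
  Realization {
  rz_line : forall A, lb_base L A -> exists x, forall u, exists c, r A u = c *: x;
  rz_linear : forall A, lb_base L A -> linear (r A);
  rz_inj : forall A u, lb_base L A -> r A u = 0 -> u = 0;
  rz_norm : forall A u, lb_base L A -> hnorm u = l2norm (r A u);
  rz_frame : forall W e, lb_frame W e -> [/\ open_in (lb_base L) W,
    forall A, W A -> (e A : L A) != 0 & forall i, smooth_on W (fun A => r A (e A) i)];
  rz_cover : forall A, lb_base L A ->
    exists W, exists2 e : forall B, L B, lb_frame W e & W A }.

Section OneRealization.
Variables (I : finType) (L : lbundle R n) (r : forall A, L A -> V I).
Hypothesis rL : realization r.
Implicit Types A : Mat.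

Lemma rzZ A c (u : L A) : lb_base L A -> r (c *: u) = c *: r u.
Proof.
move=> bA; have /= l := rz_linear rL bA.
have r0 : r (0 : L A) = 0.
  by have := l (-1) 0 0; rewrite scaler0 addr0 scaleN1r addNr.
by rewrite -[c *: u]addr0 l r0 addr0.
Qed.

Lemma rz_injective A (u v : L A) : lb_base L A -> r u = r v -> u = v.
Proof.
move=> bA E; apply/eqP; rewrite -subr_eq0 -[u - v]addrC -scaleN1r; apply/eqP.
by apply: (rz_inj rL bA); rewrite (rz_linear rL bA) E scaleN1r addNr.
Qed.

Lemma rz_neq0 A (u : L A) : lb_base L A -> u != 0 -> r u != 0.
Proof. by move=> bA; apply: contra_neq => /(rz_inj rL bA). Qed.

Lemma rz_nonzero A : lb_base L A -> exists u : L A, u != 0.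
Proof.
move=> bA; have [W [e fe WA]] := rz_cover rL bA.
by have [_ e0 _] := rz_frame rL fe; exists (e A); exact: e0.
Qed.

Lemma rz_base W e A : lb_frame (l := L) W e -> W A -> lb_base L A.
Proof. by move=> /(rz_frame rL)[/open_inP[+ _] _ _]; apply. Qed.

Lemma rz_hline A : lb_base L A -> is_hline (L A).
Proof.
move=> bA; have [u u0] := rz_nonzero bA; split.
- exists u => // v; have [x Hx] := rz_line rL bA; have [c Ec] := Hx u; have [d Ed] := Hx v.
  have c0 : c != 0 by apply: contraTneq (rz_neq0 bA u0) => c0; rewrite Ec c0 scale0r negbK.
  exists (d / c); apply: rz_injective => //.
  by rewrite rzZ// Ec scalerA mulfVK.
- by move=> c v; rewrite !(rz_norm rL)// rzZ// l2normZ.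
- by move=> v v0; rewrite (rz_norm rL)// lt_neqAle l2norm_ge0 eq_sym l2norm_eq0 rz_neq0.
Qed.

Lemma realization_lbundle : is_lbundle L.
Proof.
split; first exact: rz_hline.
- by move=> W e /(rz_frame rL)[oW e0 _].
- move=> W e fe; have [oW e0 se] := rz_frame rL fe.
  apply: (@smooth_on_eq _ _ _ (fun A => (l2norm (r (e A)))%:C%C)).
    by move=> A WA; rewrite (rz_norm rL _ (rz_base fe WA)).
  by apply: smooth_l2norm => // A WA; apply: rz_neq0; [exact: rz_base fe WA|exact: e0].
- exact: (rz_cover rL).
move=> W e W' e' fe fe'; have [oW e0 se] := rz_frame rL fe.
have [oW' e0' se'] := rz_frame rL fe'.
have [||A [WA _]|A [WA _]|c sc H] := @smooth_ratio _ (W `&` W') (fun A => r (e A)) (fun A => r (e' A)).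
- by move=> i; apply: smooth_on_sub (se i) => A [].
- by move=> i; apply: smooth_on_sub (se' i) => A [].
- by apply: rz_neq0; [exact: rz_base fe WA|exact: e0].
- have bA := rz_base fe WA.
  have [c Ec] := line_coord (rz_hline bA) (e' A) (e0 A WA).
  by exists c; rewrite Ec rzZ.
exists c => // A WA WA'; have bA := rz_base fe WA.
by apply: rz_injective => //; rewrite rzZ// -H.
Qed.

End OneRealization.

(** In coordinates such a fibre map is the identity, whence linearity, isometry and smoothness; it
    is onto because it is nonzero between lines. *)
Lemma realization_iso (I : finType) (L L' : lbundle R n) (r : forall A, L A -> V I)
    (r' : forall A, L' A -> V I) (X : set Mat) (phi : forall A, L A -> L' A) :
  realization r -> realization r' -> X `<=` lb_base L `&` lb_base L' ->
  (forall A (u : L A), X A -> r' A (phi A u) = r A u) -> bundle_iso X phi.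
Proof.
move=> rL rL' XB H; have lphi A : X A -> linear (phi A).
  move=> XA c u v; have [bA bA'] := XB A XA.
  apply: (rz_injective rL') => //.
  by rewrite (rz_linear rL' bA') !H// (rz_linear rL bA).
split=> //.
- move=> A XA; split; first exact: lphi.
  have [bA bA'] := XB A XA.
  have [u u0] := rz_nonzero rL bA.
  have p0 : phi A u != 0.
    by apply: contraTneq (rz_neq0 rL bA u0) => E; rewrite -H// E -[0](scale0r 0) (rzZ rL')// scale0r negbK.
  have Hs v : exists w, phi A w = v.
    have [c ->] := line_coord (rz_hline rL' bA') v p0; exists (c *: u).
    by apply: (rz_injective rL') => //; rewrite H// (rzZ rL)// (rzZ rL')// H.
  have [g gP] := choice Hs; exists g => // v.
  by apply: (rz_injective rL) => //; rewrite -H// gP H.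
- by move=> A u XA; have [bA bA'] := XB A XA; rewrite (rz_norm rL')// (rz_norm rL)// H.
move=> W e W' e' fe fe'; have [oW e0 se] := rz_frame rL fe.
have [oW' e0' se'] := rz_frame rL' fe'.
have [||A [XA [WA WA']]|A [XA [WA WA']]|c sc Hc] :=
  @smooth_ratio _ (X `&` (W `&` W')) (fun A => r' A (e' A)) (fun A => r A (e A)).
- by move=> i; apply: smooth_on_sub (se' i) => A [_ []].
- by move=> i; apply: smooth_on_sub (se i) => A [_ []].
- by apply: (rz_neq0 rL'); [case: (XB A XA)|exact: e0'].
- have [bA bA'] := XB A XA.
  have [c Ec] := line_coord (rz_hline rL' bA') (phi A (e A)) (e0' A WA').
  by exists c; rewrite -(rzZ rL')// -Ec H.
exists c => // A XA WA WA'; have [bA bA'] := XB A XA.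
by apply: (rz_injective rL') => //; rewrite (rzZ rL')// -Hc// H.
Qed.

Lemma realization_onto (I : finType) (L : lbundle R n) (r : forall A, L A -> V I) A x :
  realization r -> lb_base L A -> (forall u, exists c, r A u = c *: x) ->
  exists u, r A u = x.
Proof.
move=> rL bA H; have [u u0] := rz_nonzero rL bA; have [c E] := H u.
have c0 : c != 0 by apply: contraTneq (rz_neq0 rL bA u0) => c0; rewrite E c0 scale0r negbK.
by exists (c^-1 *: u); rewrite (rzZ rL)// E scalerA mulVf// scale1r.
Qed.

End Realizations.

(** * Tensor products realized by exterior products *)

Section WedgeRealizations.
Variables (R : realType) (n : nat).
Local Notation C := (R[i]).
Local Notation Mat := ('M[C]_n).
Local Notation ext := {ffun {set 'I_n} -> C^o}.

Lemma smooth_wedge S (f g : Mat -> ext) : (forall T, smooth_on S (fun A => f A T)) ->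
  (forall T, smooth_on S (fun A => g A T)) ->
  forall T, smooth_on S (fun A => wedge (f A) (g A) T).
Proof.
move=> sf sg T; apply: (@smooth_on_eq _ _ _ (fun A =>
    \sum_(U : {set 'I_n} | U \subset T) shuffle_sign R U (T :\: U) * f A U * g A (T :\: U))).
  by move=> A _; rewrite ffunE.
apply: smooth_on_sum => U _; apply: smooth_onM => //; apply: smooth_onM => //.
exact: smooth_on_cst.
Qed.

Lemma open_in_setI (S T W W' : set Mat) : open_in S W -> open_in T W' ->
  open_in (S `&` T) (W `&` W').
Proof.
move=> [D oD ->] [D' oD' ->]; exists (D `&` D'); first exact: openI.
by apply/seteqP; split=> A /=; tauto.
Qed.

Section TensorProduct.
Variables (L L' : lbundle R n) (r : forall A, L A -> ext) (r' : forall A, L' A -> ext).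

(** An element of the tensor product is u (x) s(u^-1) for any nonzero u, and is sent to the exterior
    product of the factors; [tens_realE] shows that the choice of u is immaterial. *)
Definition tens_real A (s : tens_bundle L L' A) : ext :=
  let u := xget 0 [set u : L A | u != 0] in
  wedge (r u) (r' ((s : linmap (dual_line (L A)) (L' A)) (line_inv u))).

Hypotheses (rL : realization r) (rL' : realization r').
Hypothesis wedge_norm : forall A (u : L A) (u' : L' A), lb_base L A -> lb_base L' A ->
  l2norm (wedge (r u) (r' u')) = l2norm (r u) * l2norm (r' u').

Lemma tens_realE A (u : L A) (u' : L' A) : lb_base L A -> lb_base L' A ->
  tens_real (ptens u u' : tens_bundle L L' A) = wedge (r u) (r' u').
Proof.
move=> bA bA'; rewrite /tens_real; set v := xget 0 _.
have v0 : v != 0 by have [u1 u1P] := rz_nonzero rL bA; apply: (@xgetPex _ 0 [set u : L A | u != 0]); exists u1.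
have hA := rz_hline rL bA; have [c ->] := line_coord hA u v0.
by rewrite ptensE linmapZ (line_invE hA v0) (rzZ rL)// [c *: 1]mulr1 (rzZ rL')// wedgeZl wedgeZr.
Qed.

(** Exterior multiplication may have a kernel on tensors; [wedge_norm] excludes this on the lines at
    hand and supplies both injectivity and the metric. *)
Lemma tens_realization : @realization R n _ (tens_bundle L L') tens_real.
Proof.
have pure A (s : tens_bundle L L' A) : lb_base L A -> exists u u', s = ptens u u' /\ u != 0.
  move=> bA; have [u u0] := rz_nonzero rL bA.
  by exists u, ((s : linmap (dual_line (L A)) (L' A)) (line_inv u)); rewrite -(tens_line_pure s (rz_hline rL bA) u0).
split.
- move=> A [bA bA']; have [x Hx] := rz_line rL bA; have [x' Hx'] := rz_line rL' bA'.
  exists (wedge x x') => s; have [u [u' [-> _]]] := pure A s bA.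
  have [c Ec] := Hx u; have [d Ed] := Hx' u'; exists (c * d).
  by rewrite tens_realE// Ec Ed wedgeZl wedgeZr scalerA.
- move=> A [bA bA'] c s t; rewrite /tens_real linmap_addE linmap_scaleE.
  by rewrite (rz_linear rL' bA') wedge_linearr.
- move=> A s [bA bA']; have [u [u' [-> u0]]] := pure A s bA.
  rewrite tens_realE// => /eqP; rewrite -l2norm_eq0 wedge_norm// mulf_eq0 !l2norm_eq0.
  rewrite (negbTE (rz_neq0 rL bA u0)) /= => /eqP /(rz_inj rL' bA')->.
  by have := ptensZr u (0 : L' A) 0; rewrite !scale0r.
- move=> A s [bA bA']; have [u [u' [-> u0]]] := pure A s bA.
  rewrite tens_realE// wedge_norm// hnorm_ptens ?(rz_norm rL)// ?(rz_norm rL')//.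
    exact: (rz_hline rL bA).
  exact: (rz_hline rL' bA').
- move=> W0 e0 [W [e [W' [e' [fe fe' -> ->]]]]].
  have [oW e0P se] := rz_frame rL fe; have [oW' e0P' se'] := rz_frame rL' fe'.
  split; first exact: open_in_setI.
    move=> A [WA WA']; apply: ptens_neq0; [|exact: e0P|exact: e0P'].
    exact: (rz_hline rL (rz_base rL fe WA)).
  move=> T; apply: (@smooth_on_eq _ _ _ (fun A => wedge (r (e A)) (r' (e' A)) T)).
    by move=> A [WA WA']; rewrite (tens_realE _ _ (rz_base rL fe WA) (rz_base rL' fe' WA')).
  by apply: smooth_wedge => U; [apply: smooth_on_sub (se U)|apply: smooth_on_sub (se' U)] => A [].
move=> A [bA bA']; have [W [e fe WA]] := rz_cover rL bA.
have [W' [e' fe' WA']] := rz_cover rL' bA'.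
exists (W `&` W'), (fun A => ptens (e A) (e' A)); last by [].
by exists W, e, W', e'.
Qed.

End TensorProduct.

End WedgeRealizations.

(** * Gerbes whose product is the exterior product *)

Section GerbeRealizations.
Variables (R : realType) (n p : nat).
Local Notation C := (R[i]).
Local Notation Mat := ('M[C]_n).
Local Notation ext := {ffun {set 'I_n} -> C^o}.
Variable V : 'I_p -> set Mat.

(* [gr_section]: the section of delta L is the one corresponding to the product
   L_ij (x) L_jk -> L_ik induced by the exterior product. *)
Record gerbe_realization (D : gerbe_data R n p)
    (r : forall i j A, gb_bundle D i j A -> ext) : Prop := GerbeRealization {
  gr_real : forall i j : 'I_p, (i < j)%N -> realization (@r i j);
  gr_base : forall i j : 'I_p, (i < j)%N -> lb_base (gb_bundle D i j) = V i `&` V j;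
  gr_norm : forall i j k : 'I_p, (i < j)%N -> (j < k)%N ->
    forall A (u : gb_bundle D i j A) (v : gb_bundle D j k A), V i A -> V j A -> V k A ->
    l2norm (wedge (r _ _ _ u) (r _ _ _ v)) = l2norm (r _ _ _ u) * l2norm (r _ _ _ v);
  gr_section : forall i j k : 'I_p, (i < j)%N -> (j < k)%N ->
    forall A, V i A -> V j A -> V k A -> exists u v w,
    [/\ u != 0, v != 0, w != 0, r i k A w = wedge (r i j A u) (r j k A v) &
        @gb_section _ _ _ D i j k A = ptens (ptens v (line_inv w)) u] }.

Section OneGerbe.
Variables (D : gerbe_data R n p) (r : forall i j A, gb_bundle D i j A -> ext).
Hypothesis rD : gerbe_realization r.
Arguments r {i j A}.

Section Triple.
Variables (i j k : 'I_p) (ij : (i < j)%N) (jk : (j < k)%N) (A : Mat).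
Hypotheses (ViA : V i A) (VjA : V j A) (VkA : V k A).
Let ik : (i < k)%N := ltn_trans ij jk.

Let bij : lb_base (gb_bundle D i j) A. Proof. by rewrite (gr_base rD). Qed.
Let bjk : lb_base (gb_bundle D j k) A. Proof. by rewrite (gr_base rD). Qed.
Let bik : lb_base (gb_bundle D i k) A. Proof. by rewrite (gr_base rD). Qed.
Let rij := gr_real rD ij.
Let rjk := gr_real rD jk.
Let rik := gr_real rD ik.
Let hij := rz_hline rij bij.
Let hjk := rz_hline rjk bjk.
Let hik := rz_hline rik bik.
Implicit Types (u : gb_bundle D i j A) (v : gb_bundle D j k A) (w : gb_bundle D i k A).

(** In arbitrary bases, the coefficient of the section is the inverse of the structure constant of
    the exterior product; rescaling the bases of [gr_section] changes both consistently. *)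
Lemma gr_triple u v w : u != 0 -> v != 0 -> w != 0 -> exists c, [/\ c != 0,
  wedge (r u) (r v) = c *: r w &
  @gb_section _ _ _ D i j k A = c^-1 *: ptens (ptens v (line_inv w)) u].
Proof.
move=> u0 v0 w0.
have [u1 [v1 [w1 [u10 v10 w10 E ->]]]] := gr_section rD ij jk ViA VjA VkA.
have [a Ea] := line_coord hij u1 u0; have [b Eb] := line_coord hjk v1 v0.
have [d Ed] := line_coord hik w1 w0.
have a0 : a != 0 by apply: contraNneq u10 => a0; rewrite Ea a0 scale0r.
have b0 : b != 0 by apply: contraNneq v10 => b0; rewrite Eb b0 scale0r.
have d0 : d != 0 by apply: contraNneq w10 => d0; rewrite Ed d0 scale0r.
exists (d / (a * b)); split; first by rewrite mulf_neq0// invr_eq0 mulf_neq0.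
  apply: (scalerI (mulf_neq0 a0 b0)); rewrite [RHS]scalerA [X in _ = X *: _]mulrC divfK ?mulf_neq0//.
  by rewrite -(rzZ rik)// -Ed E Ea Eb (rzZ rij)// (rzZ rjk)// wedgeZl wedgeZr scalerA.
rewrite Ea Eb Ed (line_invZ hik w0 d0) !(ptensZl, ptensZr) !scalerA.
by congr (_ *: _); rewrite invf_div; ring.
Qed.

Lemma delta_pure_hline u v w : u != 0 -> v != 0 -> w != 0 ->
  is_hline (tens_line (tens_line (gb_bundle D j k A) (dual_line (gb_bundle D i k A)))
     (gb_bundle D i j A)) /\ ptens (ptens v (line_inv w)) u != 0.
Proof.
move=> u0 v0 w0; split.
  exact: (tens_line_hline (tens_line_hline hjk (dual_line_hline hik)) hij).
apply: ptens_neq0 => //; first exact: (tens_line_hline hjk (dual_line_hline hik)).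
by apply: ptens_neq0 => //; exact: line_inv_neq0.
Qed.

Lemma gr_section_coeff u v w c : u != 0 -> v != 0 -> w != 0 ->
  @gb_section _ _ _ D i j k A = c *: ptens (ptens v (line_inv w)) u ->
  c != 0 /\ wedge (r u) (r v) = c^-1 *: r w.
Proof.
move=> u0 v0 w0 E; have [d [d0 Ew Es]] := gr_triple u0 v0 w0.
have [hd pn] := delta_pure_hline u0 v0 w0.
have -> : c = d^-1 by apply: (line_coord_inj pn); rewrite -E.
by rewrite invrK invr_eq0.
Qed.

Lemma gr_section_wedge u v w c : u != 0 -> v != 0 -> w != 0 ->
  wedge (r u) (r v) = c *: r w ->
  @gb_section _ _ _ D i j k A = c^-1 *: ptens (ptens v (line_inv w)) u.
Proof.
move=> u0 v0 w0 E; have [d [d0 Ew ->]] := gr_triple u0 v0 w0.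
congr (_^-1 *: _); apply: (line_coord_inj w0); apply: (rz_injective rik bik).
by rewrite !(rzZ rik)// -E -Ew.
Qed.

Lemma gr_section_norm : hnorm (@gb_section _ _ _ D i j k A) = 1.
Proof.
have [u [v [w [u0 v0 w0 E ->]]]] := gr_section rD ij jk ViA VjA VkA.
rewrite hnorm_ptens//; last exact: (tens_line_hline hjk (dual_line_hline hik)).
rewrite hnorm_ptens//; last exact: dual_line_hline.
rewrite (hnorm_line_inv hik w0) (rz_norm rij)// (rz_norm rjk)// (rz_norm rik)// E.
rewrite (gr_norm rD ij jk)// mulrAC [_ * l2norm (r u)]mulrC mulfV// mulf_neq0//.
  by rewrite l2norm_eq0 (rz_neq0 rij).
by rewrite l2norm_eq0 (rz_neq0 rjk).
Qed.

End Triple.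

Lemma gerbe_realization_gerbe (M : set Mat) : (forall i, open_in M (V i)) -> M = \bigcup_i V i ->
  is_gerbe M V D.
Proof.
move=> oV MV; split=> //.
- by move=> i j ij; split; [exact: realization_lbundle (gr_real rD ij)|exact: (gr_base rD)].
- move=> i j k ij jk; have ik := ltn_trans ij jk.
  split; last by move=> A [[ViA VjA] VkA]; exact: gr_section_norm.
  split; first by move=> A [[ViA VjA] VkA] /=; rewrite !(gr_base rD).
  move=> W3 e3 [W2 [e2 [Wij [eij [[Wjk [ejk [Wik' [eik' [fjk [eik fik ->] -> ->]]]]] fij -> ->]]]]].
  have [oij nij sij] := rz_frame (gr_real rD ij) fij.
  have [ojk njk sjk] := rz_frame (gr_real rD jk) fjk.
  have [oik nik sik] := rz_frame (gr_real rD ik) fik.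
  set X := _ `&` (_ `&` _).
  have [||A|A [[[ViA VjA] VkA] [[WjkA WikA] WijA]]|c sc Hc] := @smooth_ratio R n _ X
    (fun A => r (eik A)) (fun A => wedge (r (eij A)) (r (ejk A))).
  + by move=> T; apply: smooth_on_sub (sik T) => A [_ [[]]].
  + apply: smooth_wedge => T; [apply: smooth_on_sub (sij T)|apply: smooth_on_sub (sjk T)] => A;
      by [move=> [_ []]|move=> [_ [[]]]].
  + move=> [_ [[_ WikA] _]]; apply: (rz_neq0 (gr_real rD ik)); last exact: nik.
    exact: (rz_base (gr_real rD ik) fik).
  + have [c [_ Ec _]] := gr_triple ij jk ViA VjA VkA (nij A WijA) (njk A WjkA) (nik A WikA).
    by exists c.
  (* The section has coefficient 1/c in the frames, where c is a smooth ratio of realized frames. *)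
  have H A : X A -> c A != 0 /\
      @gb_section _ _ _ D i j k A = (c A)^-1 *: ptens (ptens (ejk A) (line_inv (eik A))) (eij A).
    move=> XA; have := Hc A XA; case: XA => [[[ViA VjA] VkA] [[WjkA WikA] WijA]] E.
    have Es := gr_section_wedge ij jk ViA VjA VkA (nij A WijA) (njk A WjkA) (nik A WikA) E.
    have [] := gr_section_coeff ij jk ViA VjA VkA (nij A WijA) (njk A WjkA) (nik A WikA) Es.
    by rewrite invr_eq0.
  exists (fun A => (c A)^-1); last by move=> A VA WA; have [] := H A.
  by apply: smooth_onV => // A /H[].
move=> i j k l ij jk kl A ViA VjA VkA VlA x c x0 xc.
have ik := ltn_trans ij jk; have jl := ltn_trans jk kl; have il := ltn_trans ij jl.
have I : [/\ i \in [:: i; j; k; l], j \in [:: i; j; k; l],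
  k \in [:: i; j; k; l] & l \in [:: i; j; k; l]] by rewrite !inE !eqxx !orbT.
have [Ii Ij Ik Il] := I.
have nx a b : a \in [:: i; j; k; l] -> b \in [:: i; j; k; l] -> (a < b)%N -> x a b != 0 by exact: x0.
have [c1 E1] := gr_section_coeff ij jk ViA VjA VkA (nx _ _ Ii Ij ij) (nx _ _ Ij Ik jk) (nx _ _ Ii Ik ik)
  (xc _ _ _ Ii Ij Ik ij jk).
have [c2 E2] := gr_section_coeff ik kl ViA VkA VlA (nx _ _ Ii Ik ik) (nx _ _ Ik Il kl) (nx _ _ Ii Il il)
  (xc _ _ _ Ii Ik Il ik kl).
have [c3 E3] := gr_section_coeff ij jl ViA VjA VlA (nx _ _ Ii Ij ij) (nx _ _ Ij Il jl) (nx _ _ Ii Il il)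
  (xc _ _ _ Ii Ij Il ij jl).
have [c4 E4] := gr_section_coeff jk kl VjA VkA VlA (nx _ _ Ij Ik jk) (nx _ _ Ik Il kl) (nx _ _ Ij Il jl)
  (xc _ _ _ Ij Ik Il jk kl).
(* The inverses of the [c] are the structure constants of the exterior product; computing a triple
   product in both orders yields the cocycle identity. *)
have := wedgeA (r (x i j)) (r (x j k)) (r (x k l)).
rewrite E1 E4 wedgeZl wedgeZr E2 E3 !scalerA.
have ril := gr_real rD il; have bil : lb_base (gb_bundle D i l) A by rewrite (gr_base rD).
rewrite -!(rzZ ril)// => /(rz_injective ril bil)/(line_coord_inj (nx _ _ Ii Il il)).
move=> E; have {}E : c j k l * c i j l = c i j k * c i k l by apply: invr_inj; rewrite !invfM.
have -> : c j k l / c i k l * c i j l / c i j k = (c j k l * c i j l) / (c i j k * c i k l).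
  by rewrite invfM; ring.
by rewrite E mulfV// mulf_neq0.
Qed.

End OneGerbe.

(** Fibre maps compatible with the realizations preserve the structure constants of the exterior
    product, and these determine the sections on both sides. *)
Lemma gerbe_realization_equiv (D D' : gerbe_data R n p)
    (r : forall i j A, gb_bundle D i j A -> ext) (r' : forall i j A, gb_bundle D' i j A -> ext)
    (phi : forall i j A, gb_bundle D i j A -> gb_bundle D' i j A) :
  gerbe_realization r -> gerbe_realization r' ->
  (forall i j : 'I_p, (i < j)%N -> forall A u, V i A -> V j A -> r' i j A (phi i j A u) = r i j A u) ->
  gerbe_equiv V D D'.
Proof.
move=> rD rD' H; exists phi; split.
  move=> i j ij; apply: (realization_iso (gr_real rD ij) (gr_real rD' ij)).
    by move=> A VA; rewrite /= (gr_base rD ij) (gr_base rD' ij).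
  by move=> A u [ViA VjA]; apply: H.
move=> i j k ij jk A ViA VjA VkA x c xij xjk xik E; have ik := ltn_trans ij jk.
have nphi (a b : 'I_p) : (a < b)%N -> V a A -> V b A -> x a b != 0 -> phi a b A (x a b) != 0.
  move=> ab VaA VbA x0; have bA : lb_base (gb_bundle D a b) A by rewrite (gr_base rD).
  have bA' : lb_base (gb_bundle D' a b) A by rewrite (gr_base rD').
  apply: contraNneq (rz_neq0 (gr_real rD ab) bA x0) => E0.
  by rewrite -(H _ _ ab)// E0 -[0](scale0r 0) (rzZ (gr_real rD' ab))// scale0r.
have [c0 Ec] := gr_section_coeff rD ij jk ViA VjA VkA xij xjk xik E.
rewrite -[c]invrK; apply: (gr_section_wedge rD' ij jk ViA VjA VkA);
  by rewrite ?nphi// !H.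
Qed.

End GerbeRealizations.

(** * The bundles of Gawedzki and Reis *)

Section Subbundles.
Variables (R : realType) (n : nat).
Local Notation C := (R[i]).
Local Notation Mat := ('M[C]_n).
Local Notation V I := {ffun I -> C^o}.
Implicit Types (A g : Mat) (i j k l : 'I_n).

Lemma subbundle_realization (I : finType) (X : set Mat) (U : Mat -> {vspace (V I)}) :
  (forall A, X A -> exists x, (U A <= <[x]>)%VS) ->
  (forall A0, X A0 -> exists W (f : Mat -> V I), [/\ open_in X W, W A0,
     forall A, W A -> f A \in U A /\ f A != 0 & forall i : I, smooth_on W (fun A => f A (i : I))]) ->
  @realization R n I (subbundle X U) (fun A => vsval).
Proof.
move=> Ux Uf; split.
- move=> A /Ux[x /subvP Hx]; exists x => u; apply/vlineP/Hx; exact: subvsP.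
- by move=> A _ c u v; rewrite linearP.
- by move=> A u _ u0; apply: val_inj.
- by [].
- by [].
move=> A0 XA0; have [W [f [oW WA0 fU sf]]] := Uf A0 XA0.
exists W, (fun A => vsproj (U A) (f A)); last by [].
split=> //.
  move=> A WA; have [fA f0] := fU A WA.
  by apply: contra_neq f0 => /(congr1 vsval); rewrite vsprojK.
move=> i; apply: smooth_on_eq (sf i) => A WA; have [fA _] := fU A WA.
by rewrite vsprojK.
Qed.

Lemma diagonalizes_col A g lam k : diagonalizes A g lam ->
  A *m col k g = expi (lam 0 k) *: col k g.
Proof.
move=> [sg _ EA]; have Ag : A *m g = g *m texp lam.
  by rewrite EA /Ad -!mulmxA (SU_mulVmx sg) mulmx1.
apply/colP => a; transitivity ((A *m g) a k).
  by rewrite !mxE; apply: eq_bigr => b _; rewrite mxE.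
by rewrite Ag mul_mx_diag !mxE mulrC.
Qed.

(** When [B] is a union of classes of equal eigenvalues, the projection onto the columns of g in [B]
    fixes all the eigenspaces concerned, so that these columns and the rows of the sum of
    eigenspaces span the same space. *)
Lemma eigenmx_rows (B : pred 'I_n) A g lam : diagonalizes A g lam ->
  (forall k l, B k -> expi (lam 0 k) = expi (lam 0 l) -> B l) ->
  let X := (\sum_(k < n | B k) eigenmx k A)%MS in
  let us := [seq colvec g k | k : 'I_n <- enum 'I_n & B k] in
  (forall a, rowvec X a \in <<us>>%VS) /\
  (forall u, u \in us -> u \in <<[seq rowvec X a | a : 'I_n]>>%VS).
Proof.
move=> dA HB X us; have [sg _ EA] := dA; have qA := diagonalizes_q dA.
pose w : 'rV[C]_n := \row_k (B k)%:R.
pose P := Ad g (diag_mx w).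
(* [eigenspace] consists of row vectors, whence the transposes throughout. *)
have gg : g^T *m (g^t*)^T = 1%:M by rewrite -trmx_mul (SU_mulVmx sg) trmx1.
have ATE : A^T = (g^t*)^T *m texp lam *m g^T.
  by rewrite EA /Ad !trmx_mul tr_diag_mx mulmxA.
have PTE : P^T = (g^t*)^T *m diag_mx w *m g^T by rewrite /P /Ad !trmx_mul tr_diag_mx mulmxA.
have XP : X *m P^T = X.
  have : (X <= eigenspace P^T 1)%MS.
    apply/sumsmx_subP => k Bk; apply/eigenspaceP; rewrite scale1r.
    set Y := eigenmx k A.
    have /eigenspaceP : (Y <= eigenspace A^T (expi (q A 0 k)))%MS by [].
    rewrite qA => HY; pose Z := Y *m (g^t*)^T.
    have YZ : Y = Z *m g^T.
      by rewrite /Z -mulmxA -trmx_mul (SU_mulmxV sg) trmx1 mulmx1.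
    have HZ : Z *m texp lam = expi (lam 0 k) *: Z.
      have := congr1 (mulmx^~ (g^t*)^T) HY.
      by rewrite ATE !mulmxA -[_ *m g^T *m _]mulmxA gg mulmx1 -scalemxAl.
    clearbody Z; have ZW : Z *m diag_mx w = Z.
      apply/matrixP => a l; have /matrixP/(_ a l) := HZ.
      rewrite !mul_mx_diag !mxE => E.
      case: (boolP (B l)) => Bl; first by rewrite mulr1.
      rewrite mulr0; apply/esym/eqP; apply: contraNT Bl => Z0; apply: (HB k) => //.
      by apply: (mulfI Z0); rewrite E mulrC.
    by rewrite YZ PTE !mulmxA -[Z *m g^T *m _]mulmxA gg mulmx1 ZW.
  by move/eigenspaceP; rewrite scale1r.
split.
  move=> a; have -> : rowvec X a = \sum_(k <- enum 'I_n | B k) (X *m (g^t*)^T) a k *: colvec g k.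
    apply/ffunP => b; rewrite ffunE -[in LHS]XP PTE mulmxA mxE sum_ffunE.
    rewrite [RHS]big_enum_cond [RHS]big_mkcond /=; apply: eq_bigr => k _.
    rewrite mulmxA mul_mx_diag [in LHS]mxE [w 0 k]mxE [g^T k b]mxE.
    by case: (B k); rewrite ?mulr0 ?mul0r ?mulr1// !ffunE.
  rewrite -big_filter big_seq; apply: rpred_sum => k kB; apply: rpredZ; apply: memv_span.
  exact: map_f.
move=> u /mapP[k]; rewrite mem_filter => /andP[Bk _] ->.
have : ((col k g)^T <= X)%MS.
  apply: (sumsmx_sup k) => //; apply/eigenspaceP.
  by rewrite -trmx_mul qA (diagonalizes_col k dA) linearZ.
move=> /submxP[y Ey].
have -> : colvec g k = \sum_a y 0 a *: rowvec X a.
  apply/ffunP => b; rewrite ffunE sum_ffunE; have /matrixP/(_ 0 b) := Ey.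
  rewrite !mxE => ->; apply: eq_bigr => a _; by rewrite !ffunE.
apply: rpred_sum => a _; apply: rpredZ; apply: memv_span.
by apply/mapP; exists a; rewrite ?mem_enum.
Qed.

End Subbundles.

(** * Blocks of consecutive indices *)

Section Blocks.
Variable n : nat.
Implicit Types i j k : 'I_n.

Lemma val_block i j : map val (block i j) = iota i.+1 (j - i).
Proof.
apply: (irr_sorted_eq ltn_trans ltnn); last first.
- move=> k; rewrite mem_iota; apply/mapP/idP => [[l]|H].
    rewrite mem_block => + ->; rewrite /=; lia.
  have kn : (k < n)%N by have := ltn_ord j; lia.
  by exists (Ordinal kn) => //; rewrite mem_block /=; lia.
- exact: iota_ltn_sorted.
apply: (subseq_sorted ltn_trans (map_subseq val (filter_subseq _ _))).
by rewrite val_enum_ord iota_ltn_sorted.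
Qed.

Lemma size_block i j : size (block i j) = (j - i)%N.
Proof. by rewrite -(size_map val) val_block size_iota. Qed.

Lemma block_cat i j k : (i <= j)%N -> (j <= k)%N -> block i k = block i j ++ block j k.
Proof.
move=> ij jk; apply: (inj_map val_inj); rewrite map_cat !val_block.
have -> : (k - i = (j - i) + (k - j))%N by lia.
by rewrite iotaD; congr (_ ++ iota _ _); lia.
Qed.

End Blocks.

(** * The bundles E_ij *)

Section EigenBundles.
Variables (R : realType) (n : nat).
Hypothesis n1 : (1 < n)%N.
Let n0 : (0 < n)%N := ltnW n1.
Local Notation C := (R[i]).
Local Notation Mat := ('M[C]_n).
Local Notation ext := {ffun {set 'I_n} -> C^o}.
Implicit Types (A g : Mat) (i j k l : 'I_n).

Lemma frame_wedge_cat i j k g : (i <= j)%N -> (j <= k)%N ->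
  wedge (frame_wedge i j g) (frame_wedge j k g) = frame_wedge i k g.
Proof. by move=> ij jk; rewrite /frame_wedge (block_cat ij jk) map_cat wedge_seq_cat. Qed.

(** By [alcove_at_level_set] for i and for j, equal eigenvalues have equal entries in mu_j - mu_i,
    and this vector separates the block from its complement. *)
Lemma diagonalizes_block i j A g lam k l : (i < j)%N -> Vcover i A -> Vcover j A ->
  diagonalizes A g lam -> (i < k <= j)%N -> expi (lam 0 k) = expi (lam 0 l) -> (i < l <= j)%N.
Proof.
move=> ij ViA VjA dA bk E.
have Ei := alcove_at_level_set n0 (Vcover_diag ViA dA) E.
have Ej := alcove_at_level_set n0 (Vcover_diag VjA dA) E.
have : (mu R j - mu R i) 0 k = (mu R j - mu R i) 0 l.
  move: Ei Ej; rewrite !mxE; lra.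
rewrite !muBE// bk; case: (_ && _) => //= /addIr/eqP.
by rewrite oner_eq0.
Qed.

Lemma smooth_frame_wedge S (G : Mat -> Mat) i j : smooth_mx S G ->
  forall T, smooth_on S (fun A => frame_wedge i j (G A) T).
Proof.
move=> sG; rewrite /frame_wedge; elim: (block i j) => [|k s IH] T.
  exact: smooth_on_cst.
apply: smooth_wedge => // U.
apply: (@smooth_on_eq _ _ _ (fun A => \sum_(l | U == [set l]%SET) G A l k)) => [A _|].
  by rewrite ffunE; apply: eq_bigr => l _; rewrite ffunE.
by apply: smooth_on_sum => l _.
Qed.

(** Projecting the columns of h onto the block projects omega(h) orthogonally onto the line of
    omega(g). The left-hand side involves g only through a projection that is smooth in A, which
    makes it a source of smooth frames. *)
Lemma frame_wedge_proj i j g h : (i < j)%N -> SU g ->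
  frame_wedge i j (Ad g (coord_proj R i j) *m h) =
  edot (frame_wedge i j g) (frame_wedge i j h) *: frame_wedge i j g.
Proof.
move=> ij sg; set P := Ad g _.
have [a E] : exists a, frame_wedge i j (P *m h) = a *: frame_wedge i j g.
  apply/vlineP; apply: wedge_seq_line; last by rewrite !size_map.
  move=> u /mapP[k kb ->].
  have -> : colvec (P *m h) k = \sum_(l <- block i j) (g^t* *m h) l k *: colvec g l.
    apply/ffunP => a; rewrite ffunE sum_ffunE /P /Ad -!mulmxA mulmxA mul_mx_diag mxE.
    rewrite [RHS]big_filter big_enum_cond /= [RHS]big_mkcond /=.
    apply: eq_bigr => l _; rewrite [X in X * _]mxE [X in _ * X * _]mxE.
    by case: (_ && _); rewrite ?mulr1 ?mulr0 ?mul0r// !ffunE mulrC.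
  rewrite big_seq; apply: rpred_sum => l lb; apply: rpredZ; apply: memv_span.
  exact: map_f.
rewrite E; congr (_ *: _).
have := congr1 (edot (frame_wedge i j g)) E.
rewrite edotZr (edot_frame_wedge1 i j sg) mulr1 => <-.
apply: edot_wedge_gram => k l; rewrite mem_block => kb _.
rewrite !vdot_colvec /P /Ad !mulmxA (SU_mulVmx sg) mul1mx -mulmxA mul_diag_mx mxE.
by rewrite mxE kb mul1r.
Qed.

(** The rows of [specmx] span the eigenspaces but are not a basis, so all products of j - i rows are
    considered: they lie on the line by [wedge_seq_line] and generate it by [wedge_seq_span]. *)
Lemma Egr_fibre i j A g lam : (i < j)%N -> Vcover i A -> Vcover j A -> diagonalizes A g lam ->
  <<[seq wedge_seq [seq rowvec (specmx i j A) a | a <- s] | s : (j - i).-tuple 'I_n]>>%VS =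
  <[frame_wedge i j g]>%VS.
Proof.
move=> ij ViA VjA dA.
have [HX HU] := @eigenmx_rows R n (fun k => (i < k <= j)%N) A g lam dA
  (fun k l => @diagonalizes_block i j A g lam k l ij ViA VjA dA).
apply/eqP; rewrite eqEsubv; apply/andP; split.
  apply/span_subvP => x /mapP[s _ ->]; apply: wedge_seq_line; last first.
    by rewrite !size_map size_block size_tuple.
  by move=> u /mapP[a _ ->]; exact: HX.
rewrite -memvE; apply: wedge_seq_span HU _ => t.
rewrite size_map size_block => st tX.
have [s tE] : exists s, t = [seq rowvec (specmx i j A) a | a <- s].
  elim: t tX {st} => [|v t IH] tX; first by exists [::].
  have [|s ->] := IH; first by move=> x xt; apply: tX; rewrite inE xt orbT.
  have /mapP[a _ ->] := tX v (mem_head _ _).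
  by exists (a :: s).
rewrite {}tE in st *; apply: memv_span; apply/mapP.
have ss : size s == (j - i)%N by rewrite -st size_map.
by exists (Tuple ss); rewrite ?mem_enum.
Qed.

Lemma Egr_realization i j : (i < j)%N -> @realization R n _ (Egr R i j) (fun A => vsval).
Proof.
move=> ij; apply: subbundle_realization.
  move=> A [ViA VjA]; have [g dA] := q_diagonalizes n0 ViA.1.
  by exists (frame_wedge i j g); rewrite (Egr_fibre ij ViA VjA dA).
move=> A0 [ViA0 VjA0]; have [g0 dA0] := q_diagonalizes n0 ViA0.1.
(* The frame omega(g0) at [A0], projected to the fibre at [A]; it is nonzero where its inner product
   with omega(g0) is. *)
pose f A := frame_wedge i j (spec_proj i j A *m g0).
have sP := @spec_proj_smooth R n n0 i j ij.
have sf : smooth_mx (Vcover i `&` Vcover j) (fun A => spec_proj i j A *m g0).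
  by apply: smooth_mulmx => //; exact: smooth_mx_cst.
pose W := (Vcover i `&` Vcover j) `&` [set A | edot (frame_wedge i j g0) (f A) != 0].
exists W, f; split.
- apply: open_in_neq0; apply: smooth_fdot => [T|]; first exact: smooth_on_cst.
  exact: smooth_frame_wedge.
- split=> //=; have [sg0 _ _] := dA0.
  rewrite /f (spec_projE n0 ij ViA0 VjA0 dA0) frame_wedge_proj// edotZr.
  by rewrite (edot_frame_wedge1 i j sg0) mulr1 oner_eq0.
- move=> A [[ViA VjA] /= fA]; split.
    have [g dA] := q_diagonalizes n0 ViA.1; rewrite (Egr_fibre ij ViA VjA dA).
    have [sg _ _] := dA.
    by rewrite /f (spec_projE n0 ij ViA VjA dA) frame_wedge_proj// memvZ// memv_line.
  by apply: contra_neq fA => ->; rewrite edot0r.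
move=> T; have := @smooth_frame_wedge _ _ i j sf T; apply: smooth_on_sub => A.
by case.
Qed.

End EigenBundles.

(** * Eigenline bundles over the regular set *)

Section Eigenlines.
Variables (R : realType) (n : nat).
Hypothesis n1 : (1 < n)%N.
Let n0 : (0 < n)%N := ltnW n1.
Local Notation C := (R[i]).
Local Notation Mat := ('M[C]_n).
Local Notation ext := {ffun {set 'I_n} -> C^o}.
Implicit Types (A g : Mat) (i j k l : 'I_n).

Lemma diagonalizes_char_poly A g lam : diagonalizes A g lam ->
  char_poly A = \prod_k ('X - (expi (lam 0 k))%:P).
Proof.
move=> [sg _ EA]; rewrite /char_poly /char_poly_mx.
pose f (X : Mat) := map_mx (@polyC C) X.
have gf : f g *m f (g^t*) = 1%:M by rewrite /f -map_mxM (SU_mulmxV sg) map_mx1.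
have -> : 'X%:M - map_mx polyC A = f g *m ('X%:M - f (texp lam)) *m f (g^t*).
  rewrite mulmxBr mulmxBl mul_mx_scalar -scalemxAl gf scalemx1; congr (_ - _).
  by rewrite EA /Ad /f !map_mxM.
rewrite !det_mulmx mulrAC -det_mulmx gf det1 mul1r.
rewrite (_ : 'X%:M - _ = diag_mx (\row_k ('X - (expi (lam 0 k))%:P))).
  by rewrite det_diag; apply: eq_bigr => k _; rewrite mxE.
apply/matrixP => a b; rewrite !mxE; case: eqP => _; rewrite ?mulr1n// !mulr0n.
by rewrite polyC0 subr0.
Qed.

Lemma SUreg_eigen_inj A g lam k l : SUreg A -> diagonalizes A g lam ->
  expi (lam 0 k) = expi (lam 0 l) -> k = l.
Proof.
move=> [_ reg] dA E; apply/eqP; apply: contraT => kl.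
have c0 : char_poly A != 0 by exact: monic_neq0 (char_poly_monic A).
have := reg (expi (lam 0 k)); rewrite leqNgt mup_geq//.
rewrite (diagonalizes_char_poly dA) (bigD1 k)//= (bigD1 l) 1?eq_sym//= -E mulrA -expr2.
by rewrite dvdp_mulr// dvdpp.
Qed.

(** A closed gap makes two cyclically consecutive eigenvalues equal; for n > 1 their indices differ,
    which regularity forbids. *)
Lemma SUreg_Vcover i A : SUreg A -> Vcover i A.
Proof.
move=> rA; have [SA _] := rA; have [g dA] := q_diagonalizes n0 SA; split=> //.
have [_ al _] := dA; split=> //; rewrite lt_neqAle (al.2 i) andbT.
apply/eqP => E; have Ei : expi (q A 0 (ordS i)) = expi (q A 0 i).
  by rewrite -E /lam_next expiD expiN -[(_ == _)%:R]/(((i.+1 == n) : nat)%:Z%:~R) expi_int rmorph1 mulr1.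
have /(congr1 val)/= := SUreg_eigen_inj rA dA Ei.
have [ni|] := ltnP i.+1 n; first by rewrite modn_small//; lia.
move=> ni; have -> : i.+1 = n by have := ltn_ord i; lia.
by rewrite modnn; have := ltn_ord i; lia.
Qed.

(** The projection onto the k-th eigenline. The first index has no predecessor: [ord_pred] wraps to
    the last one, and the line is the complement of the block of all other indices. *)
Definition line_proj k A : Mat :=
  if k == Ordinal n0 then 1%:M - spec_proj k (ord_pred k) A else spec_proj (ord_pred k) k A.

Lemma line_projE k A g lam : SUreg A -> diagonalizes A g lam ->
  line_proj k A = Ad g (diag_mx (\row_l (l == k)%:R)).
Proof.
move=> rA dA; have [sg _ _] := dA; have V i := SUreg_Vcover i rA; rewrite /line_proj.
have [->|k0] := eqVneq k (Ordinal n0).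
  rewrite (spec_projE n0 _ (V _) (V _) dA) /=; last first.
    by rewrite add0n modn_small; lia.
  rewrite -(Ad_scalar 1 sg) -AdB; congr (Ad g _); apply/matrixP => a b; rewrite !mxE.
  have -> : (a == Ordinal n0) = ~~ (0 < a <= (0 + n).-1 %% n)%N.
    by rewrite -val_eqE /= add0n modn_small; have := ltn_ord a; lia.
  by case: (a == b); case: (_ && _); rewrite ?mulr1n ?mulr0n ?subr0 ?subrr.
have kp : ((k + n).-1 %% n)%N = k.-1.
  have k1 : (0 < k)%N by rewrite lt0n -val_eqE in k0 *.
  have -> : ((k + n).-1 = k.-1 + n)%N by lia.
  by rewrite modnDr modn_small//; have := ltn_ord k; lia.
have k1 : (0 < k)%N by rewrite lt0n.
rewrite (spec_projE n0 _ (V _) (V _) dA) /=; last by rewrite kp; lia.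
congr (Ad g (diag_mx _)); apply/rowP => l; rewrite !mxE /= kp -val_eqE /=.
by congr (nat_of_bool _)%:R; lia.
Qed.

Lemma line_proj_smooth k : smooth_mx (@SUreg R n) (line_proj k).
Proof.
have H i j : (i < j)%N -> smooth_mx (@SUreg R n) (spec_proj i j).
  move=> ij; apply: smooth_mx_sub (@spec_proj_smooth R n n0 i j ij) => A rA.
  by split; exact: SUreg_Vcover.
rewrite /line_proj; case: eqVneq => [->|k0].
  apply: smooth_submx; first exact: smooth_mx_cst.
  by apply: H; rewrite /= add0n modn_small; lia.
apply: H; rewrite /=.
have k1 : (0 < k)%N by rewrite lt0n.
have -> : ((k + n).-1 = k.-1 + n)%N by lia.
by rewrite modnDr modn_small; have := ltn_ord k; lia.
Qed.

Lemma eigenline_fibre k A g lam : SUreg A -> diagonalizes A g lam ->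
  <<[seq rowvec (eigenmx k A) a | a : 'I_n]>>%VS = <[colvec g k]>%VS.
Proof.
move=> rA dA; have [|HX HU] := @eigenmx_rows R n (pred1 k) A g lam dA.
  by move=> a b /eqP-> /(SUreg_eigen_inj rA dA)->; rewrite /= eqxx.
have XE : (\sum_(l < n | pred1 k l) eigenmx l A)%MS = eigenmx k A by rewrite big_pred1_eq.
rewrite XE in HX HU; apply/eqP; rewrite eqEsubv; apply/andP; split.
  apply/span_subvP => x /mapP[a _ ->]; have := HX a; apply/subvP.
  apply/span_subvP => u /mapP[l]; rewrite mem_filter => /andP[/eqP-> _] ->.
  exact: memv_line.
rewrite -memvE; apply: HU; apply/mapP; exists k => //.
by rewrite mem_filter mem_enum /= eqxx.
Qed.

Lemma eigenline_realization k : @realization R n _ (eigenline R k) (fun A => vsval).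
Proof.
apply: subbundle_realization.
  move=> A rA; have [g dA] := q_diagonalizes n0 rA.1.
  by exists (colvec g k); rewrite (eigenline_fibre k rA dA).
move=> A0 rA0; have [g0 dA0] := q_diagonalizes n0 rA0.1.
pose f A := colvec (line_proj k A *m g0) k.
have fE A g lam : SUreg A -> diagonalizes A g lam -> f A = (g^t* *m g0) k k *: colvec g k.
  move=> rA dA; apply/ffunP => a; rewrite !ffunE (line_projE k rA dA) /Ad -!mulmxA mulmxA.
  rewrite mul_mx_diag mxE (bigD1 k)//= [X in X * _]mxE [X in _ * X * _]mxE eqxx mulr1.
  rewrite big1 ?addr0; first by rewrite mulrC.
  by move=> l lk; rewrite [X in X * _]mxE [X in _ * X * _]mxE (negbTE lk) mulr0 mul0r.
have sf : smooth_mx (@SUreg R n) (fun A => line_proj k A *m g0).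
  by apply: smooth_mulmx; [exact: line_proj_smooth|exact: smooth_mx_cst].
have sfa a : smooth_on (@SUreg R n) (fun A => f A a).
  by apply: (@smooth_on_eq _ _ _ (fun A => (line_proj k A *m g0) a k)) => [A _|//]; rewrite ffunE.
pose W := @SUreg R n `&` [set A | vdot (colvec g0 k) (f A) != 0].
exists W, f; split.
- apply: open_in_neq0; apply: smooth_fdot => [T|//]; exact: smooth_on_cst.
- split=> //=; have [sg0 _ _] := dA0.
  rewrite (fE _ _ _ rA0 dA0) (SU_mulVmx sg0) mxE eqxx scale1r vdot_colvec (SU_mulVmx sg0).
  by rewrite mxE eqxx oner_eq0.
- move=> A [rA /= fA]; split.
    have [g dA] := q_diagonalizes n0 rA.1; rewrite (eigenline_fibre k rA dA).
    by rewrite (fE _ _ _ rA dA) memvZ// memv_line.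
  by apply: contra_neq fA => ->; rewrite /vdot big1// => a _; rewrite [X in _ * X]ffunE mulr0.
by move=> a; apply: smooth_on_sub (sfa a) => A [].
Qed.

End Eigenlines.

(** * The product of the E_ij and the Gawedzki-Reis gerbe *)

Section GawedzkiReis.
Variables (R : realType) (n : nat).
Hypothesis n1 : (1 < n)%N.
Let n0 : (0 < n)%N := ltnW n1.
Local Notation C := (R[i]).
Local Notation Mat := ('M[C]_n).
Local Notation ext := {ffun {set 'I_n} -> C^o}.
Implicit Types (A g : Mat) (i j k l : 'I_n).

Lemma l2norm_edot1 (x : ext) : edot x x = 1 -> l2norm x = 1.
Proof.
move=> H; have /(congr1 (@complex.Re R)) := fdotE x; rewrite -[fdot x x]/(edot x x) H /=.
by move/esym/eqP; rewrite sqrp_eq1 ?l2norm_ge0// => /eqP.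
Qed.

Lemma l2norm_frame_wedge i j g : SU g -> l2norm (frame_wedge i j g) = 1.
Proof. by move=> sg; apply: l2norm_edot1; exact: edot_frame_wedge1. Qed.

Let Ereal i j (ij : (i < j)%N) := @Egr_realization R n n1 i j ij.

Lemma Egr_line i j A g lam (u : Egr R i j A) : (i < j)%N -> Vcover i A -> Vcover j A ->
  diagonalizes A g lam -> exists c, vsval u = c *: frame_wedge i j g.
Proof.
move=> ij ViA VjA dA; apply/vlineP; rewrite -(Egr_fibre n1 ij ViA VjA dA).
exact: subvsP.
Qed.

Lemma Egr_frame i j A g lam : (i < j)%N -> Vcover i A -> Vcover j A ->
  diagonalizes A g lam -> exists u : Egr R i j A, vsval u = frame_wedge i j g.
Proof.
move=> ij ViA VjA dA; apply: (realization_onto (r := fun A (u : Egr R i j A) => vsval u)).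
- exact: Ereal.
- by [].
- by move=> u; apply: Egr_line dA.
Qed.

Lemma wedge_norm_frames i j k g (x y : ext) c d : (i < j)%N -> (j < k)%N -> SU g ->
  x = c *: frame_wedge i j g -> y = d *: frame_wedge j k g ->
  l2norm (wedge x y) = l2norm x * l2norm y.
Proof.
move=> ij jk sg -> ->; rewrite wedgeZl wedgeZr frame_wedge_cat ?(ltnW ij) ?(ltnW jk)//.
by rewrite !l2normZ !l2norm_frame_wedge// !mulr1.
Qed.

Lemma Egr_wedge_norm i j k A (u : Egr R i j A) (v : Egr R j k A) : (i < j)%N -> (j < k)%N ->
  Vcover i A -> Vcover j A -> Vcover k A ->
  l2norm (wedge (vsval u) (vsval v)) = l2norm (vsval u) * l2norm (vsval v).
Proof.
move=> ij jk ViA VjA VkA; have [g dA] := q_diagonalizes n0 ViA.1; have [sg _ _] := dA.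
have [c Ec] := Egr_line u ij ViA VjA dA; have [d Ed] := Egr_line v jk VjA VkA dA.
exact: wedge_norm_frames Ec Ed.
Qed.

Section Products.
Variables (i j k : 'I_n).
Hypotheses (ij : (i < j)%N) (jk : (j < k)%N).

Definition Egr_tens_real A (s : tens_bundle (Egr R i j) (Egr R j k) A) : ext :=
  tens_real (fun A (u : Egr R i j A) => vsval u) (fun A (u : Egr R j k A) => vsval u) s.

Lemma Egr_tens_realization : realization (@Egr_tens_real).
Proof.
apply: tens_realization; [exact: Ereal|exact: Ereal|].
by move=> A u v [ViA VjA] [_ VkA]; exact: Egr_wedge_norm.
Qed.

Lemma Egr_tens_realE A (x : Egr R i j A) (y : Egr R j k A) :
  Vcover i A -> Vcover j A -> Vcover k A ->
  Egr_tens_real (ptens x y : tens_bundle (Egr R i j) (Egr R j k) A) =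
  wedge (vsval x) (vsval y).
Proof.
by move=> ViA VjA VkA; apply: tens_realE; [exact: Ereal|exact: Ereal| |].
Qed.

Lemma gr_mulE A (s : tens_bundle (Egr R i j) (Egr R j k) A) :
  Vcover i A -> Vcover j A -> Vcover k A ->
  vsval (gr_mul (i := i) (j := j) (k := k) s) = Egr_tens_real s.
Proof.
move=> ViA VjA VkA; have ik := ltn_trans ij jk.
have [g dA] := q_diagonalizes n0 ViA.1; have [sg _ _] := dA.
have rij := Ereal ij; have hij := rz_hline rij (conj ViA VjA : lb_base (Egr R i j) A).
have [u u0] := rz_nonzero rij (conj ViA VjA : lb_base (Egr R i j) A).
have Es := tens_line_pure s hij u0; set v := _ (line_inv u) in Es.
rewrite /gr_mul; set P := (X in xget 0 X).
have : P (xget 0 P).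
  have [c Ec] := Egr_line u ij ViA VjA dA; have [d Ed] := Egr_line v jk VjA VkA dA.
  have [z Ez] := Egr_frame ik ViA VkA dA.
  apply: (@xgetPex _ 0 P); exists ((c * d) *: z), u, v; split=> //.
  by rewrite linearZ /= Ez Ec Ed wedgeZl wedgeZr scalerA frame_wedge_cat ?(ltnW ij) ?(ltnW jk).
by move=> [x [y [-> ->]]]; rewrite Egr_tens_realE.
Qed.

Lemma gr_mul_iso : bundle_iso (Vcover i `&` Vcover j `&` Vcover k)
  (fun A (s : tens_bundle (Egr R i j) (Egr R j k) A) => gr_mul s).
Proof.
apply: (realization_iso Egr_tens_realization (Ereal (ltn_trans ij jk))).
  by move=> A [[ViA VjA] VkA].
by move=> A u [[ViA VjA] VkA]; exact: gr_mulE.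
Qed.

End Products.

Lemma gr_mul_neq0 i j k A (u : Egr R i j A) (v : Egr R j k A) : (i < j)%N -> (j < k)%N ->
  Vcover i A -> Vcover j A -> Vcover k A -> u != 0 -> v != 0 ->
  gr_mul (ptens u v : tens_bundle (Egr R i j) (Egr R j k) A) != 0.
Proof.
move=> ij jk ViA VjA VkA u0 v0.
apply: contraTneq (rz_neq0 (Ereal ij) (conj ViA VjA : lb_base (Egr R i j) A) u0) => E.
have := Egr_wedge_norm u v ij jk ViA VjA VkA.
rewrite -(Egr_tens_realE ij jk u v ViA VjA VkA) -gr_mulE// E linear0.
have v00 := rz_neq0 (Ereal jk) (conj VjA VkA : lb_base (Egr R j k) A) v0.
have -> : l2norm (0 : ext) = 0 by apply/eqP; rewrite l2norm_eq0.
by move/esym/eqP; rewrite mulf_eq0 !l2norm_eq0 (negbTE v00) orbF negbK.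
Qed.

(** One tensor must serve all nonzero u and v for the choice in [section_of_mul] to succeed: scaling
    u and v scales their product by the same factor, which enters inverted and cancels. *)
Lemma section_of_mulE i j k A (u : Egr R i j A) (v : Egr R j k A) : (i < j)%N -> (j < k)%N ->
  Vcover i A -> Vcover j A -> Vcover k A -> u != 0 -> v != 0 ->
  section_of_mul (@gr_mul R n) i j k A =
  ptens (ptens v (line_inv (gr_mul (ptens u v : tens_bundle (Egr R i j) (Egr R j k) A)))) u.
Proof.
move=> ij jk ViA VjA VkA u0 v0; have ik := ltn_trans ij jk.
rewrite /section_of_mul; set P := (X in xget 0 X).
suff : P (xget 0 P) by move/(_ u v u0 v0).
apply: (@xgetPex _ 0 P).
exists (ptens (ptens v (line_inv (gr_mul (ptens u v : tens_bundle (Egr R i j) (Egr R j k) A)))) u).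
move=> u' v' u'0 v'0.
have rij := Ereal ij; have rjk := Ereal jk.
have rik := Ereal ik.
have hij := rz_hline rij (conj ViA VjA : lb_base (Egr R i j) A).
have hjk := rz_hline rjk (conj VjA VkA : lb_base (Egr R j k) A).
have hik := rz_hline rik (conj ViA VkA : lb_base (Egr R i k) A).
have [a Ea] := line_coord hij u' u0; have [b Eb] := line_coord hjk v' v0.
have a0 : a != 0 by apply: contraNneq u'0 => a0; rewrite Ea a0 scale0r.
have b0 : b != 0 by apply: contraNneq v'0 => b0; rewrite Eb b0 scale0r.
have Em : gr_mul (ptens u' v' : tens_bundle (Egr R i j) (Egr R j k) A) = (a * b) *:
    gr_mul (ptens u v : tens_bundle (Egr R i j) (Egr R j k) A).
  apply: val_inj; rewrite [RHS]linearZ /= !gr_mulE// !Egr_tens_realE// Ea Eb.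
  by rewrite !linearZ /= wedgeZl wedgeZr scalerA.
have m0 := gr_mul_neq0 ij jk ViA VjA VkA u0 v0.
rewrite Em line_invZ ?mulf_neq0// Ea Eb !(ptensZl, ptensZr) !scalerA.
by rewrite mulfV ?mulf_neq0// scale1r.
Qed.

Lemma gr_gerbe_realization :
  gerbe_realization (@Vcover R n) (D := @gr_gerbe R n) (fun i j A (u : Egr R i j A) => vsval u).
Proof.
split.
- by move=> i j ij; exact: Ereal.
- by [].
- by move=> i j k ij jk A u v ViA VjA VkA; exact: Egr_wedge_norm.
move=> i j k ij jk A ViA VjA VkA; have ik := ltn_trans ij jk.
have [u u0] := rz_nonzero (Ereal ij) (conj ViA VjA : lb_base (Egr R i j) A).
have [v v0] := rz_nonzero (Ereal jk) (conj VjA VkA : lb_base (Egr R j k) A).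
exists u, v, (gr_mul (ptens u v : tens_bundle (Egr R i j) (Egr R j k) A)); split=> //.
- exact: gr_mul_neq0.
- by rewrite gr_mulE// Egr_tens_realE.
by apply: section_of_mulE.
Qed.

End GawedzkiReis.

(** * Tensor products of eigenlines inside E_ij *)

Section EigenlineProducts.
Variables (R : realType) (n : nat).
Hypothesis n1 : (1 < n)%N.
Let n0 : (0 < n)%N := ltnW n1.
Local Notation C := (R[i]).
Local Notation Mat := ('M[C]_n).
Local Notation ext := {ffun {set 'I_n} -> C^o}.
Implicit Types (A g : Mat) (i j k l m : 'I_n).

Lemma l2norm_wedge_seq1 (v : {ffun 'I_n -> C^o}) : l2norm (wedge_seq [:: v]) = l2norm v.
Proof.
have : edot (wedge_seq [:: v]) (wedge_seq [:: v]) = vdot v v.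
  rewrite /= edot_wedge contract_wedge contract_ext1 wedgex0 subr0 edotZr edot_ext1.
  exact: mulr1.
rewrite -[edot _ _]/(fdot _ _) -[vdot _ _]/(fdot _ _) !fdotE => -[/eqP].
by rewrite eqrXn2 ?l2norm_ge0// => /eqP.
Qed.

(** Eigenvectors placed in degree 1 of the exterior algebra, so that [tens_realization] applies to
    their products. *)
Definition eigenline_real k A (u : eigenline R k A) : ext := wedge_seq [:: vsval u].

Lemma eigenline_real_realization k : realization (@eigenline_real k).
Proof.
have rk := @eigenline_realization R n n1 k; split.
- move=> A rA; have [x Hx] := rz_line rk rA; exists (wedge_seq [:: x]) => u.
  have [c Ec] := Hx u; exists c; rewrite /eigenline_real Ec.
  by rewrite -[c *: x]addr0 /= ext_vec_linear (_ : ext_vec 0 = 0) ?addr0 ?wedgeZl//;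
    apply/ffunP => T; rewrite !ffunE big1// => l _; rewrite ffunE.
- move=> A rA c u v; rewrite /eigenline_real linearP.
  exact: (@wedge_seq_linear R n c (vsval u) (vsval v) [::] [::]).
- move=> A u rA E; apply: (rz_inj rk rA); apply/eqP.
  by rewrite -l2norm_eq0 -l2norm_wedge_seq1 l2norm_eq0; apply/eqP.
- by move=> A u rA; rewrite (rz_norm rk)// l2norm_wedge_seq1.
- move=> W e fe; have [oW e0 se] := rz_frame rk fe; split=> // T.
  apply: smooth_wedge => U; last exact: smooth_on_cst.
  apply: (@smooth_on_eq _ _ _ (fun A => \sum_(l | U == [set l]%SET) vsval (e A) l)) => [A _|].
    by rewrite ffunE.
  by apply: smooth_on_sum => l _.
exact: (rz_cover rk).
Qed.

Fixpoint range_real m d : forall A, tens_range (@eigenline R n) m d A -> ext :=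
  match d return forall A, tens_range (@eigenline R n) m d A -> ext with
  | 0 => @eigenline_real m
  | d'.+1 => tens_real (@eigenline_real m) (@range_real (ordS m) d')
  end.

(** The indices met by [tens_range]. Successors are cyclic, but nothing wraps as long as m + d < n
    ([val_chain]). *)
Fixpoint chain m d : seq 'I_n := m :: if d is d'.+1 then chain (ordS m) d' else [::].

Lemma val_chain m d : (m + d < n)%N -> map val (chain m d) = iota m d.+1.
Proof.
elim: d m => [|d IH] m md //=; congr (_ :: _).
have mS : (m.+1 %% n)%N = m.+1 by rewrite modn_small//; lia.
by rewrite IH /= mS//; lia.
Qed.

Lemma chain_block i j : (i < j)%N -> chain (ordS i) (j - i).-1 = block i j.
Proof.
move=> ij; have iS : (i.+1 %% n)%N = i.+1 by rewrite modn_small//; have := ltn_ord j; lia.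
have md : (ordS i + (j - i).-1 < n)%N by rewrite /= iS; have := ltn_ord j; lia.
apply: (inj_map val_inj); rewrite (val_chain md) val_block.
have -> : nat_of_ord (ordS i) = i.+1 by exact: iS.
by congr iota; lia.
Qed.

Lemma chain_wedge_norm m d g : (m + d < n)%N -> SU g ->
  l2norm (wedge_seq [seq colvec g k | k <- chain m d]) = 1.
Proof.
move=> md sg; apply: l2norm_edot1; apply: edot_wedge_orthonormal.
  by rewrite -(map_inj_uniq val_inj) val_chain// iota_uniq.
by move=> k l _ _; rewrite vdot_colvec (SU_mulVmx sg) mxE.
Qed.

Lemma eigenline_real_line k A g lam (u : eigenline R k A) : SUreg A -> diagonalizes A g lam ->
  exists c, eigenline_real u = c *: wedge_seq [:: colvec g k].
Proof.
move=> rA dA; have : vsval u \in <[colvec g k]>%VS.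
  by rewrite -(eigenline_fibre k rA dA); exact: subvsP.
case/vlineP => c Ec; exists c; rewrite /eigenline_real Ec.
have := @wedge_seq_scale R n [:: k] (fun=> c) (colvec g).
by rewrite /= big_seq1.
Qed.

(** The three clauses are proved together: multiplicativity of the norm, needed for one more factor,
    relies on the line through which the remaining factors are realized. *)
Lemma range_realization m d : (m + d < n)%N ->
  [/\ realization (@range_real m d),
      forall A, lb_base (tens_range (@eigenline R n) m d) A <-> SUreg A &
      forall A g lam (s : tens_range (@eigenline R n) m d A), SUreg A -> diagonalizes A g lam ->
        exists c, range_real s = c *: wedge_seq [seq colvec g k | k <- chain m d]].
Proof.
elim: d m => [|d IH] m md.
  split=> //; first exact: eigenline_real_realization.
  by move=> A g lam s rA dA; exact: eigenline_real_line dA.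
have mS : (m.+1 %% n)%N = m.+1 by rewrite modn_small//; lia.
have [|rS bS lS] := IH (ordS m); first by rewrite /= mS; lia.
have rm := eigenline_real_realization m.
have wE g : wedge (wedge_seq [:: colvec g m]) (wedge_seq [seq colvec g k | k <- chain (ordS m) d]) =
    wedge_seq [seq colvec g k | k <- chain m d.+1].
  by rewrite -wedge_seq_cat.
have wn A (u : eigenline R m A) (s : tens_range (@eigenline R n) (ordS m) d A) :
    lb_base (eigenline R m) A -> lb_base (tens_range (@eigenline R n) (ordS m) d) A ->
    l2norm (wedge (eigenline_real u) (range_real s)) =
    l2norm (eigenline_real u) * l2norm (range_real s).
  move=> rA _; have [g dA] := q_diagonalizes n0 rA.1; have [sg _ _] := dA.
  have [c Ec] := eigenline_real_line u rA dA; have [b Eb] := lS A g _ s rA dA.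
  rewrite Ec Eb wedgeZl wedgeZr wE !l2normZ (chain_wedge_norm md sg) chain_wedge_norm//.
    by rewrite (@chain_wedge_norm m 0)// ?mulr1//; lia.
  by rewrite /= mS; lia.
split.
- exact: (tens_realization rm rS wn).
- by move=> A; split=> [[]//|rA]; split=> //; apply/bS.
move=> A g lam s rA dA; have bA : lb_base (eigenline R m) A by [].
have [u u0] := rz_nonzero rm bA.
rewrite (tens_line_pure s (rz_hline rm bA) u0); set t := _ (line_inv u).
have [c Ec] := eigenline_real_line u rA dA; have [b Eb] := lS A g _ t rA dA.
exists (c * b); rewrite /= (tens_realE rm rS)//; last exact/bS.
by rewrite Ec Eb wedgeZl wedgeZr wE scalerA.
Qed.

Lemma range_real_pure m d A (v : forall k, eigenline R k A) : (m + d < n)%N -> SUreg A ->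
  range_real (pure_range v m d) = wedge_seq [seq vsval (v k) | k <- chain m d].
Proof.
elim: d m => [|d IH] m md rA //.
have mS : (m.+1 %% n)%N = m.+1 by rewrite modn_small//; lia.
have mSd : (ordS m + d < n)%N by rewrite /= mS; lia.
have [rS bS _] := range_realization mSd.
rewrite /= (tens_realE (eigenline_real_realization m) rS)//; last exact/bS.
by rewrite IH// -wedge_seq_cat.
Qed.

Definition range_iso i j A (s : Eprod R i j A) : Egr R i j A :=
  xget 0 [set z : Egr R i j A | vsval z = range_real s].

Lemma range_isoE i j A (s : Eprod R i j A) : (i < j)%N -> SUreg A ->
  vsval (range_iso s) = range_real s.
Proof.
move=> ij rA; have [g dA] := q_diagonalizes n0 rA.1.
rewrite /range_iso; set P := (X in xget 0 X).
suff : P (xget 0 P) by [].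
have iS : (i.+1 %% n)%N = i.+1 by rewrite modn_small//; have := ltn_ord j; lia.
have md : (ordS i + (j - i).-1 < n)%N by rewrite /= iS; have := ltn_ord j; lia.
have [_ _ /(_ A g _ s rA dA)[c Ec]] := range_realization md.
have [z Ez] := Egr_frame n1 ij (SUreg_Vcover n1 i rA) (SUreg_Vcover n1 j rA) dA.
apply: (@xgetPex _ 0 P); exists (c *: z).
by change (vsval (c *: z) = range_real s); rewrite linearZ /= Ez Ec chain_block.
Qed.

Lemma range_iso_iso i j : (i < j)%N -> bundle_iso (@SUreg R n) (range_iso (i := i) (j := j)).
Proof.
move=> ij; have iS : (i.+1 %% n)%N = i.+1 by rewrite modn_small//; have := ltn_ord j; lia.
have md : (ordS i + (j - i).-1 < n)%N by rewrite /= iS; have := ltn_ord j; lia.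
have [rE bE _] := range_realization md.
apply: (realization_iso rE (@Egr_realization R n n1 i j ij)).
  by move=> A rA; split; [apply/bE|split; exact: SUreg_Vcover].
by move=> A u rA; exact: range_isoE.
Qed.

Lemma range_iso_pure i j A (v : forall k, eigenline R k A) : (i < j)%N -> SUreg A ->
  vsval (range_iso (Eprod_pure v i j)) = wedge_seq [seq vsval (v k) | k <- block i j].
Proof.
move=> ij rA; have iS : (i.+1 %% n)%N = i.+1 by rewrite modn_small//; have := ltn_ord j; lia.
rewrite range_isoE// range_real_pure ?chain_block//= iS; have := ltn_ord j; lia.
Qed.

Lemma gr_mul_range i j k A (v : forall m, eigenline R m A) : (i < j)%N -> (j < k)%N -> SUreg A ->
  gr_mul (ptens (range_iso (Eprod_pure v i j)) (range_iso (Eprod_pure v j k))) =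
  range_iso (Eprod_pure v i k).
Proof.
move=> ij jk rA; have V l := SUreg_Vcover n1 l rA.
apply: val_inj; apply: etrans (esym (range_iso_pure v (ltn_trans ij jk) rA)).
rewrite [LHS](gr_mulE n1)// Egr_tens_realE// !range_iso_pure//.
by rewrite -wedge_seq_cat -map_cat -block_cat// ltnW.
Qed.

End EigenlineProducts.

(** * The basic gerbe *)

Section WeightBundles.
Variables (R : realType) (n : nat).
Hypothesis n1 : (1 < n)%N.
Let n0 : (0 < n)%N := ltnW n1.
Local Notation C := (R[i]).
Local Notation Mat := ('M[C]_n).
Local Notation VV := ('M[R]_n * 'M[R]_n)%type.
Local Notation ext := {ffun {set 'I_n} -> C^o}.
Implicit Types (A X g h : Mat).
Variables (i j : 'I_n).
Hypothesis ij : (i < j)%N.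
Local Notation w := (mu R j - mu R i).

Definition over_point X g : Prop := SU g /\ Ad g (tdiag w) = X.

Lemma over_point_stab X g g' : over_point X g -> over_point X g' -> stab w (g^t* *m g').
Proof.
move=> [sg Eg] [sg' Eg']; split; first by apply: SU_mul => //; exact: SU_adj.
by rewrite AdM Eg' -Eg AdKV.
Qed.

Lemma over_pointM X g h : SU g -> stab w h -> over_point X (g *m h) <-> over_point X g.
Proof.
move=> sg [sh Eh]; rewrite /over_point AdM Eh.
by split=> -[_ E]; split=> //; exact: SU_mul.
Qed.

Lemma over_point_diag A g lam : Vcover i A -> Vcover j A -> diagonalizes A g lam ->
  over_point (theta i j A) g.
Proof. by move=> ViA VjA dA; split; [case: dA|rewrite (thetaE n0 ViA VjA dA)]. Qed.

Lemma over_point_proj X g : over_point X g ->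
  X + ((j - i)%:R / n%:R)%:M = Ad g (coord_proj R i j).
Proof.
by move=> [sg <-]; rewrite tdiag_muB// AdB Ad_scalar// subrK.
Qed.

Lemma assoc_fib_out X (f : assoc_fib w X) g : ~ over_point X g -> f g = 0.
Proof. by move=> H; have /asboolP[+ _] := assoc_funP f; apply. Qed.

Lemma assoc_fibM X (f : assoc_fib w X) g h : SU g -> stab w h ->
  f (g *m h) = (wchar w h)^-1 * f g.
Proof. by move=> sg sh; have /asboolP[_ +] := assoc_funP f; apply. Qed.

Lemma wchar_norm h : stab w h -> `|wchar w h| = 1.
Proof. by move=> sh; rewrite (wchar_block n0)// block_char_norm. Qed.

Lemma wchar_frame g h : SU g -> stab w h ->
  frame_wedge i j (g *m h) = wchar w h *: frame_wedge i j g.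
Proof. by move=> sg sh; rewrite (wchar_block n0)// frame_wedge_mul. Qed.

Lemma assoc_fib_frame X (f : assoc_fib w X) g g' : over_point X g -> over_point X g' ->
  f g' *: frame_wedge i j g' = f g *: frame_wedge i j g.
Proof.
move=> og og'; have sh := over_point_stab og og'; have [sg _] := og.
have -> : g' = g *m (g^t* *m g') by rewrite mulmxA (SU_mulmxV sg) mul1mx.
rewrite assoc_fibM// wchar_frame// scalerA mulrAC mulVf ?mul1r//.
by rewrite -normr_eq0 wchar_norm// oner_eq0.
Qed.

(* [edot] is antilinear in its first argument, and conj chi = chi^-1. *)
Definition pairing_fun (y : ext) X : Mat -> C^o :=
  fun g => if `[< over_point X g >] then edot (frame_wedge i j g) y else 0.

Fact pairing_fun_assoc y X : pairing_fun y X \in assoc_pred w X.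
Proof.
apply/asboolP; split=> [g H|g h sg sh]; rewrite /pairing_fun; first by rewrite asboolF.
have -> : `[< over_point X (g *m h) >] = `[< over_point X g >].
  by apply/asbool_equiv_eq; exact: over_pointM.
case: asboolP => _; last by rewrite mulr0.
rewrite wchar_frame// edotC edotZr rmorphM /= -edotC; congr (_ * _).
have nz : wchar w h != 0 by rewrite -normr_eq0 wchar_norm// oner_eq0.
by apply: (mulfI nz); rewrite mulfV// -normCK wchar_norm// expr1n.
Qed.

Definition pairing y X : assoc_fib w X := AssocFib (pairing_fun_assoc y X).

Lemma pairingE y X g : over_point X g -> pairing y X g = edot (frame_wedge i j g) y.
Proof. by move=> og; rewrite /pairing /= /pairing_fun asboolT. Qed.

Lemma bracketE X g : over_point X g -> assoc_fun (bracket w g X) g = 1.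
Proof.
move=> og; rewrite /bracket; set P := (X in xget 0 X).
suff : P (xget 0 P) by [].
apply: (@xgetPex _ 0 P); exists (pairing (frame_wedge i j g) X); rewrite /P.
by have [sg _] := og; apply: etrans (pairingE _ og) _; rewrite edot_frame_wedge1.
Qed.

(* As f(g h) = chi(h)^-1 f(g) and omega(g h) = chi(h) omega(g), the product
   f omega does not depend on the choice of g. *)
Definition weight_real A (f : Lbasic R i j A) : ext :=
  let g := xget 1%:M [set g | over_point (theta i j A) g] in
  assoc_fun (f : assoc_fib w (theta i j A)) g *: frame_wedge i j g.

Lemma weight_realE A (f : Lbasic R i j A) g : over_point (theta i j A) g ->
  weight_real f = assoc_fun (f : assoc_fib w (theta i j A)) g *: frame_wedge i j g.
Proof.
move=> og; rewrite /weight_real; set g' := xget _ _.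
by apply: assoc_fib_frame => //; apply: (@xgetPex _ 1%:M [set g | over_point (theta i j A) g]); exists g.
Qed.

Lemma assoc_fib_eq0 X (f : assoc_fib w X) g : over_point X g -> f g = 0 -> f = 0.
Proof.
move=> og fg; apply: val_inj; apply/funext => g' /=.
have [og'|Nog'] := pselect (over_point X g'); last by rewrite assoc_fib_out.
have sh := over_point_stab og og'; have [sg _] := og.
have -> : g' = g *m (g^t* *m g') by rewrite mulmxA (SU_mulmxV sg) mul1mx.
by rewrite assoc_fibM// fg mulr0.
Qed.

Lemma assoc_fib_norm X (f : assoc_fib w X) g : over_point X g ->
  sup [set cabs (f h) | h in @SU R n] = cabs (f g).
Proof.
move=> og; have [sg _] := og.
have ub : ubound [set cabs (f h) | h in @SU R n] (cabs (f g)).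
  move=> _ [g' sg' <-].
  have [og'|Nog'] := pselect (over_point X g'); last by rewrite assoc_fib_out// cabs0 cabs_ge0.
  have sh := over_point_stab og og'.
  have -> : g' = g *m (g^t* *m g') by rewrite mulmxA (SU_mulmxV sg) mul1mx.
  rewrite assoc_fibM// cabsM.
  have nz : wchar w (g^t* *m g') != 0 by rewrite -normr_eq0 wchar_norm// oner_eq0.
  have -> : cabs (wchar w (g^t* *m g'))^-1 = 1; last by rewrite mul1r.
  rewrite cabsV//; suff -> : cabs (wchar w (g^t* *m g')) = 1 by rewrite invr1.
  apply: (fmorph_inj (real_complex R)).
  by rewrite /= cabs_normr wchar_norm.
apply/eqP; rewrite eq_le; apply/andP; split.
  by apply: ge_sup => //; exists (cabs (f g)); exists g.
by apply: ub_le_sup; [exists (cabs (f g))|exists g].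
Qed.

Local Notation V := (@Vcover R n i `&` Vcover j).

Lemma theta_smooth : smooth_mx V (theta i j).
Proof.
move=> a b; apply: (@smooth_on_eq _ _ _ (fun A => spec_proj i j A a b -
    (((j - i)%:R / n%:R)%:M : Mat) a b)).
  by move=> A _; rewrite [spec_proj i j A a b]mxE addrK.
by apply: smooth_onB; [exact: (@spec_proj_smooth R n n0 i j ij)|exact: smooth_on_cst].
Qed.

(** Fibrewise this is evaluation at a point g over theta_ij(A), where omega(g) has norm 1. The real
    content is the last two clauses, where smoothness on the group and on the orbit must be
    compared. *)
Lemma weight_realization : realization weight_real.
Proof.
have og A : V A -> exists g, over_point (theta i j A) g.
  move=> [ViA VjA]; have [g dA] := q_diagonalizes n0 ViA.1.
  by exists g; exact: over_point_diag dA.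
split.
- move=> A /og[g ogA]; exists (frame_wedge i j g) => u; rewrite (weight_realE u ogA).
  by eexists.
- move=> A /og[g ogA] c u v; rewrite !(weight_realE _ ogA) scalerA -scalerDl.
  by [].
- move=> A u /og[g ogA]; rewrite (weight_realE u ogA) => /eqP.
  have [sg _] := ogA.
  rewrite scaler_eq0 (negbTE (frame_wedge_neq0 i j sg)) orbF => /eqP.
  exact: assoc_fib_eq0.
- move=> A u /og[g ogA]; have [sg _] := ogA.
  rewrite (weight_realE u ogA) l2normZ l2norm_frame_wedge// mulr1.
  exact: assoc_fib_norm.
- move=> W' e' [W [e [[oW e0 se] -> ->]]]; split.
  + apply: (open_in_comp _ theta_smooth oW) => A [ViA VjA].
    by have [g [sg E]] := og A (conj ViA VjA); exists g.
  + by move=> A [_ WA]; exact: e0.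
  move=> T; apply: smooth_on_local => A0 [VA0 WA0].
  (* A frame of [Lweight] is smooth as a function on the group; a smooth local lift of theta_ij(A)
     to the group turns it into a smooth function of A. *)
  have sP : smooth_mx (V `&` (theta i j @^-1` W)) (spec_proj i j).
    by apply: smooth_mx_sub (@spec_proj_smooth R n n0 i j ij) => A [].
  have PP A : (V `&` (theta i j @^-1` W)) A ->
      exists2 g, SU g & spec_proj i j A = Ad g (coord_proj R i j).
    by move=> [VA _]; have [g ogA] := og A VA; exists g; [case: ogA|exact: over_point_proj].
  have [D [gam [oD DA0 sgam Hgam]]] := local_section n0 sP PP (conj VA0 WA0).
  exists D; split=> //; set S := _ `&` _.
  have ogam A : S A -> over_point (theta i j A) (gam A).
    move=> [VWA DA]; have [sg E] := Hgam A VWA DA; split=> //.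
    rewrite tdiag_muB// AdB Ad_scalar// -E /spec_proj addrK.
    by [].
  apply: (@smooth_on_eq _ _ _ (fun A =>
      assoc_fun (e (Ad (gam A) (tdiag w)) : assoc_fib w (Ad (gam A) (tdiag w))) (gam A) *
      frame_wedge i j (gam A) T)).
    move=> A SA; have ogA := ogam A SA; rewrite (weight_realE _ ogA) ffunE.
    by have [_ ->] := ogA.
  apply: smooth_onM; last exact: smooth_frame_wedge.
  apply: (smooth_on_comp _ se) => // A SA; have [sg E] := ogam A SA.
  by split=> //; rewrite E; case: SA => -[].
move=> A0 VA0; have [g0 og0] := og A0 VA0; have [sg0 E0] := og0.
pose c : Mat := ((j - i)%:R / n%:R)%:M.
(* For g over X this is |(omega(g0), omega(g))|^2 by [FE], yet it is visibly smooth in X. Where it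
   is nonzero, pairing with omega(g0) is a frame. *)
pose F X := edot (frame_wedge i j g0) (frame_wedge i j ((X + c) *m g0)).
have FE X g : over_point X g -> F X =
    edot (frame_wedge i j g) (frame_wedge i j g0) * edot (frame_wedge i j g0) (frame_wedge i j g).
  by move=> ogX; have [sg _] := ogX; rewrite /F (over_point_proj ogX) frame_wedge_proj// edotZr.
pose W := adorbit w `&` [set X | F X != 0].
exists (V `&` (theta i j @^-1` W)), (fun A => pairing (frame_wedge i j g0) (theta i j A)).
  exists W, (pairing (frame_wedge i j g0)); split=> //; split.
  - apply: open_in_neq0; apply: smooth_fdot => [T|]; first exact: smooth_on_cst.
    apply: smooth_frame_wedge; apply: smooth_mulmx; last exact: smooth_mx_cst.
    by apply: smooth_addmx; [exact: smooth_mx_id|exact: smooth_mx_cst].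
  - move=> X [[g sg E] /= FX]; apply: contra_neq FX => pX.
    have ogX : over_point X g by [].
    by rewrite (FE X g ogX) -(pairingE _ ogX) pX mul0r.
  apply: (@smooth_on_eq _ _ _ (fun g => edot (frame_wedge i j g) (frame_wedge i j g0))).
    by move=> g [sg _]; rewrite pairingE.
  apply: smooth_fdot => T; last exact: smooth_on_cst.
  by apply: smooth_frame_wedge; exact: smooth_mx_id.
split=> //; split; first by exists g0.
by rewrite /= (FE _ g0 og0) !edot_frame_wedge1// mulr1 oner_eq0.
Qed.

End WeightBundles.

(** * The basic gerbe and its comparison with the Gawedzki-Reis gerbe *)

Section BasicGerbe.
Variables (R : realType) (n : nat).
Hypothesis n1 : (1 < n)%N.
Let n0 : (0 < n)%N := ltnW n1.
Local Notation C := (R[i]).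
Local Notation Mat := ('M[C]_n).
Local Notation ext := {ffun {set 'I_n} -> C^o}.
Implicit Types (A g : Mat) (i j k l : 'I_n).

Lemma weight_real_bracket i j A g : (i < j)%N -> over_point i j (theta i j A) g ->
  weight_real (bracket (mu R j - mu R i) g (theta i j A) : Lbasic R i j A) = frame_wedge i j g /\
  (bracket (mu R j - mu R i) g (theta i j A) : Lbasic R i j A) != 0.
Proof.
move=> ij og; have B := bracketE n1 ij og; split.
  by rewrite (weight_realE n1 ij _ og) B scale1r.
by apply: contraTneq (oner_neq0 C) => E; rewrite -B E negbK.
Qed.

Lemma basic_gerbe_realization :
  gerbe_realization (@Vcover R n) (D := @basic_gerbe R n) (fun i j A (u : Lbasic R i j A) => weight_real u).
Proof.
split.
- by move=> i j ij; exact: weight_realization.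
- by [].
- move=> i j k ij jk A u v ViA VjA VkA; have [g dA] := q_diagonalizes n0 ViA.1.
  have [sg _ _] := dA.
  rewrite (weight_realE n1 ij _ (over_point_diag n1 ViA VjA dA)).
  rewrite (weight_realE n1 jk _ (over_point_diag n1 VjA VkA dA)).
  exact: (wedge_norm_frames ij jk sg (erefl _) (erefl _)).
move=> i j k ij jk A ViA VjA VkA; have ik := ltn_trans ij jk.
(* The same choice as in [tbasic], so that the formula for the section holds by computation; one g
   lies over all three values theta_ab(A). *)
pose g : Mat := xget 1%:M [set g | exists lam, diagonalizes A g lam].
have [lam dA] : exists lam, diagonalizes A g lam.
  have [g' dA] := q_diagonalizes n0 ViA.1.
  by apply: (@xgetPex _ 1%:M [set g | exists lam, diagonalizes A g lam]); exists g', (q A).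
have [Eij nij] := weight_real_bracket ij (over_point_diag n1 ViA VjA dA).
have [Ejk njk] := weight_real_bracket jk (over_point_diag n1 VjA VkA dA).
have [Eik nik] := weight_real_bracket ik (over_point_diag n1 ViA VkA dA).
exists (bracket (mu R j - mu R i) g (theta i j A)), (bracket (mu R k - mu R j) g (theta j k A)),
  (bracket (mu R k - mu R i) g (theta i k A)).
split; [exact: nij|exact: njk|exact: nik| |exact: erefl].
by rewrite Eij Ejk Eik frame_wedge_cat// ltnW.
Qed.

Definition basic_to_gr i j A (u : Lbasic R i j A) : Egr R i j A :=
  xget 0 [set z : Egr R i j A | vsval z = weight_real u].

Lemma basic_to_grE i j A (u : Lbasic R i j A) : (i < j)%N -> Vcover i A -> Vcover j A ->
  vsval (basic_to_gr u) = weight_real u.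
Proof.
move=> ij ViA VjA; have [g dA] := q_diagonalizes n0 ViA.1.
rewrite /basic_to_gr; set P := (X in xget 0 X).
suff : P (xget 0 P) by [].
have [z Ez] := Egr_frame n1 ij ViA VjA dA; have og := over_point_diag n1 ViA VjA dA.
apply: (@xgetPex _ 0 P); exists (assoc_fun (u : assoc_fib _ _) g *: z).
change (vsval (assoc_fun (u : assoc_fib _ _) g *: z) = weight_real u).
by rewrite linearZ /= Ez (weight_realE n1 ij _ og).
Qed.

Lemma basic_to_gr_iso i j : (i < j)%N ->
  bundle_iso (Vcover i `&` Vcover j) (basic_to_gr (i := i) (j := j)).
Proof.
move=> ij; apply: (realization_iso (weight_realization R n1 ij) (@Egr_realization R n n1 i j ij)).
  by [].
by move=> A u [ViA VjA]; exact: basic_to_grE.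
Qed.

Lemma basic_gr_equiv : gerbe_equiv (@Vcover R n) (basic_gerbe R n) (gr_gerbe R n).
Proof.
apply: (@gerbe_realization_equiv R n n _ (basic_gerbe R n) (gr_gerbe R n) _ _ basic_to_gr
  basic_gerbe_realization (gr_gerbe_realization R n1)).
by move=> i j ij A u ViA VjA; exact: basic_to_grE.
Qed.

Lemma muB_nu i j : (i < j)%N -> mu R j - mu R i = \sum_(k < n | (i < k <= j)%N) nu R k.
Proof.
move=> ij; apply/rowP => l; rewrite muBE// summxE.
rewrite (eq_bigr (fun k : 'I_n => (k == l)%:R - n%:R^-1)); last first.
  by move=> k _; rewrite !mxE eqxx mulr1 eq_sym.
rewrite sumrB sumr_const mulr_natl; congr (_ - _ *+ _).
  rewrite big_mkcond (bigD1 l)//= eqxx big1 ?addr0 => [|k /negbTE->]; last by case: (_ && _).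
  by case: (_ && _).
by rewrite -sum1_card -(size_block i j) -sum1_size big_filter big_enum_cond.
Qed.

End BasicGerbe.

Theorem mainTheorem5 (R : realType) (n : nat) (hn : (1 < n)%N) :
  (* (V, L, t) is a gerbe over SU(n) *)
  is_gerbe (@SU R n) (@Vcover R n) (@basic_gerbe R n) /\
  (* the Gawedzki-Reis data: the E_ij extend E_{i+1} (x) ... (x) E_j, the
     isomorphisms E_ij (x) E_jk -> E_ik extend the canonical ones, and they
     define a gerbe over SU(n) on the same Vcover *)
  (forall k : 'I_n, is_lbundle (@eigenline R n k)) /\
  (exists rho : forall (i j : 'I_n) (A : 'M[R[i]]_n), Eprod R i j A -> Egr R i j A,
     (forall i j : 'I_n, (i < j)%N ->
        bundle_iso (@SUreg R n) (rho i j) /\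
        forall (A : 'M[R[i]]_n) (v : forall k : 'I_n, eigenline R k A),
          SUreg A ->
          vsval (rho i j A (Eprod_pure v i j)) =
          wedge_seq [seq vsval (v k) | k : 'I_n <- enum 'I_n & (i < k <= j)%N]) /\
     (forall i j k : 'I_n, (i < j)%N -> (j < k)%N ->
        bundle_iso (@Vcover R n i `&` Vcover j `&` Vcover k)
          (@gr_mul R n i j k) /\
        forall (A : 'M[R[i]]_n) (v : forall m : 'I_n, eigenline R m A),
          SUreg A ->
          @gr_mul R n i j k A
            (ptens (rho i j A (Eprod_pure v i j)) (rho j k A (Eprod_pure v j k)))
          = rho i k A (Eprod_pure v i k))) /\
  is_gerbe (@SU R n) (@Vcover R n) (@gr_gerbe R n) /\
  (* the two constructions are equivalent *)
  gerbe_equiv (@Vcover R n) (@basic_gerbe R n) (@gr_gerbe R n) /\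
  (* L_ij = theta_ij^* L_{mu_j - mu_i} = theta_ij^* L_{nu_{i+1} + ... + nu_j},
     and this is isomorphic to E_ij *)
  (forall i j : 'I_n, (i < j)%N ->
     Lbasic R i j =
       pullback (Vcover i `&` Vcover j) (theta i j)
         (Lweight (\sum_(k < n | (i < k <= j)%N) nu R k)) /\
     exists phi : forall A, Lbasic R i j A -> Egr R i j A,
       bundle_iso (Vcover i `&` Vcover j) phi).
Proof.
have n0 := ltnW hn.
have oV := @Vcover_open R n n0; have cV := @Vcover_cover R n n0.
split; first exact: gerbe_realization_gerbe (basic_gerbe_realization R hn) _ oV cV.
split; first by move=> k; exact: realization_lbundle (eigenline_realization R hn k).
split.
  exists (@range_iso R n); split=> [i j ij|i j k ij jk]; split.
  - exact: range_iso_iso.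
  - by move=> A v rA; exact: range_iso_pure.
  - exact: gr_mul_iso.
  - by move=> A v rA; exact: gr_mul_range.
split; first exact: gerbe_realization_gerbe (gr_gerbe_realization R hn) _ oV cV.
split; first exact: basic_gr_equiv.
move=> i j ij; split; first by rewrite /Lbasic muB_nu.
by exists (@basic_to_gr R n i j); exact: basic_to_gr_iso.
Qed.
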